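(* Let $\Omega\subset\mathbb{R}^n$ be an open set which is bounded in one direction and let $0<s<1$. Assume that $\gamma_1,\gamma_2\in L^\infty(\mathbb{R}^n)$ satisfy $\gamma_1(x),\gamma_2(x)\ge\gamma_0>0$. Suppose that $W\subset\Omega_e$ is a nonempty open set such that $\gamma_1,\gamma_2$ are continuous a.e. in $W$. If $\Lambda_{\gamma_1}f|_W=\Lambda_{\gamma_2}f|_W$ for all $f\in C_c^\infty(W)$, then $\gamma_1=\gamma_2$ a.e. in $W$.
   Context: Here $n\ge 1$. $H^s(\mathbb{R}^n)$ is the usual $L^2$-based Sobolev space with norm $\|\mathcal{F}^{-1}((1+|\xi|^2)^{s/2}\hat u)\|_{L^2}$. For open $\Omega$, $\widetilde H^s(\Omega)$ is the closure of $C_c^\infty(\Omega)$ in $H^s(\mathbb{R}^n)$, and $\Omega_e:=\mathbb{R}^n\setminus\overline\Omega$. An open set $\Omega\subset\mathbb{R}^n$ is bounded in one direction if, after a rigid Euclidean motion, it is contained in a set $\mathbb{R}^{n-k}\times\omega$ with $1\le k\le n$ and $\omega\subset\mathbb{R}^k$ bounded and open (equivalently, it lies between two parallel hyperplanes). ''$\gamma$ is continuous a.e. in $W$'' means that $\gamma$ has a representative which is continuous at almost every point of $W$. Let $0<s<1$ and $C_{n,s}=\frac{4^s\Gamma(n/2+s)}{\pi^{n/2}|\Gamma(-s)|}$. For $u,v\in H^s(\mathbb{R}^n)$ set $$B_\gamma(u,v)=\frac{C_{n,s}}{2}\int_{\mathbb{R}^{2n}}\frac{\gamma^{1/2}(x)\gamma^{1/2}(y)}{|x-y|^{n+2s}}(u(x)-u(y))(v(x)-v(y))\,dx\,dy.$$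 Let $X:=H^s(\mathbb{R}^n)/\widetilde H^s(\Omega)$. For $f\in X$, let $u_f\in H^s(\mathbb{R}^n)$ be the unique weak solution of the fractional conductivity equation with exterior value $f$, i.e. the unique $u\in H^s(\mathbb{R}^n)$ with $u-f\in\widetilde H^s(\Omega)$ and $B_\gamma(u,\phi)=0$ for all $\phi\in\widetilde H^s(\Omega)$ (existence and uniqueness are known when $\Omega$ is bounded in one direction and $\gamma\ge\gamma_0>0$). The exterior DN map $\Lambda_\gamma:X\to X^*$ is $\langle\Lambda_\gamma f,g\rangle:=B_\gamma(u_f,g)$. For an open set $W\subset\Omega_e$, $\Lambda_{\gamma_1}f|_W=\Lambda_{\gamma_2}f|_W$ means $\langle\Lambda_{\gamma_1}f,g\rangle=\langle\Lambda_{\gamma_2}f,g\rangle$ for all $g\in C_c^\infty(W)$. *)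

(* Defs.v *)
From HB Require Import structures.
From mathcomp Require Import all_boot all_order all_algebra.
From mathcomp Require Import all_classical all_reals all_analysis.

Set Implicit Arguments.
Unset Strict Implicit.
Unset Printing Implicit Defensive.

Import Order.TTheory GRing.Theory Num.Theory.
Import numFieldNormedType.Exports.

Local Open Scope classical_set_scope.
Local Open Scope ring_scope.

(* Points of R^n are row vectors. The sigma-algebra is the one generated by the
   n coordinates, that is, the Borel sigma-algebra. *)
Definition measure_rV_display : measure_display -> measure_display.
Proof. exact. Qed.

Section measurable_rV.
Context (R : realType) (n : nat).

Let coord (i : 'I_n) (x : 'rV[R]_n) : R := x ord0 i.

Let rV_set0 : g_sigma_preimage coord set0.
Proof. exact: sigma_algebra0. Qed.

Let rV_setC A : g_sigma_preimage coord A -> g_sigma_preimage coord (~` A).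
Proof. exact: sigma_algebraC. Qed.

Let rV_bigcup (F : (set 'rV[R]_n)^nat) :
  (forall i, g_sigma_preimage coord (F i)) ->
  g_sigma_preimage coord (\bigcup_i (F i)).
Proof. exact: sigma_algebra_bigcup. Qed.

HB.instance Definition _ :=
  @isMeasurable.Build (measure_rV_display default_measure_display)
    'rV[R]_n (g_sigma_preimage coord) rV_set0 rV_setC rV_bigcup.

End measurable_rV.

Lemma measurable_coord (R : realType) n (i : 'I_n) :
  measurable_fun setT (fun x : 'rV[R]_n => x ord0 i).
Proof.
move=> _ Y mY; rewrite setTI; apply: sub_sigma_algebra => /=.
rewrite -bigcup_seq/=; exists i => /=; first by rewrite mem_index_enum.
by exists Y => //; rewrite setTI.
Qed.

Lemma measurable_fun_rVP d (T : measurableType d) (R : realType) n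
    (f : T -> 'rV[R]_n) :
  (forall i, measurable_fun setT (fun t => f t ord0 i)) -> measurable_fun setT f.
Proof.
move=> mf; suff : g_sigma_preimage (fun i t => f t ord0 i) `<=` measurable.
  move=> prefS _ A mA; apply: prefS.
  rewrite (_ : (fun i t => f t ord0 i) =
    (fun i => (fun x : 'rV[R]_n => x ord0 i) \o f))// g_sigma_preimage_comp.
  by exists A.
apply: smallest_sub; first exact: sigma_algebra_measurable.
case: n f mf => [|n] f mf; first by rewrite big_ord0.
rewrite -bigcup_mkord_ord; apply: bigcup_sub => i Ii.
by move=> A [B mB <-]; exact: mf.
Qed.

Definition rV_cons (R : realType) n (p : 'rV[R]_n * R) : 'rV[R]_n.+1 :=
  \row_i (if unlift ord0 i is Some j then p.1 ord0 j else p.2).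

Definition rV_uncons (R : realType) n (x : 'rV[R]_n.+1) : 'rV[R]_n * R :=
  (\row_j x ord0 (lift ord0 j), x ord0 ord0).

Lemma rV_consK (R : realType) n : cancel (@rV_cons R n) (@rV_uncons R n).
Proof.
move=> [x t]; congr pair; last by rewrite mxE unlift_none.
by apply/rowP => j; rewrite !mxE liftK.
Qed.

Lemma rV_unconsK (R : realType) n : cancel (@rV_uncons R n) (@rV_cons R n).
Proof.
by move=> x; apply/rowP => i; rewrite mxE; case: unliftP => [j|] ->; rewrite ?mxE.
Qed.

Lemma measurable_rV_cons (R : realType) n :
  measurable_fun setT (@rV_cons R n).
Proof.
apply: measurable_fun_rVP => i; under eq_fun do rewrite mxE.
case: (unlift ord0 i) => [j|]; last exact: measurable_snd.
exact: (measurableT_comp (@measurable_coord R n j)).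
Qed.

Lemma measurable_rV_uncons (R : realType) n :
  measurable_fun setT (@rV_uncons R n).
Proof.
apply: measurable_fun_pair; last exact: measurable_coord.
by apply: measurable_fun_rVP => i; under eq_fun do rewrite mxE; exact: measurable_coord.
Qed.

Section lebesgue_succ.
Context (R : realType) (n : nat).
Variable m : {sigma_finite_measure set 'rV[R]_n -> \bar R}.

Definition lebesgue_succ : set 'rV[R]_n.+1 -> \bar R :=
  pushforward (m \x @lebesgue_measure R)%E (@rV_cons R n).

HB.instance Definition _ := Measure.copy lebesgue_succ
  (measure_function_pushforward__canonical__measure_function_Measure
    (m \x @lebesgue_measure R)%E (@measurable_rV_cons R n)).

Let sigma_finite_lebesgue_succ : sigma_finite setT lebesgue_succ.
Proof.
have /sigma_finiteP[F [FT ndF Foo]] := sigma_finiteT m.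
have /sigma_finiteP[G [GT ndG Goo]] :=
  sigma_finiteT [the {sigma_finite_measure set _ -> \bar R} of @lebesgue_measure R].
exists (fun k => @rV_uncons R n @^-1` (F k `*` G k)).
  rewrite -preimage_bigcup -[LHS](preimage_setT (@rV_uncons R n)).
  congr (_ @^-1` _); rewrite -setXTT FT GT predeqE => -[x y]; split.
    move=> [/= [i _ Fix] [j _ Gjy]]; exists (maxn i j) => //; split.
    - by move: x Fix; exact/subsetPset/ndF/leq_maxl.
    - by move: y Gjy; exact/subsetPset/ndG/leq_maxr.
  by move=> [i _ []/= ? ?]; split; exists i.
move=> k; have [mF Fk] := Foo k; have [mG Gk] := Goo k; split.
  rewrite -[X in measurable X]setTI; apply: measurable_rV_uncons => //.
  exact: measurableX.
rewrite /lebesgue_succ /pushforward -comp_preimage.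
rewrite (_ : _ \o _ = id) ?preimage_id; last exact/funext/rV_consK.
by rewrite product_measure1E// lte_mul_pinfty// ge0_fin_numE.
Qed.

HB.instance Definition _ := @Measure_isSigmaFinite.Build _ _ _
  lebesgue_succ sigma_finite_lebesgue_succ.

End lebesgue_succ.

(* Lebesgue measure on R^n, as the n-fold product of the one on R *)
Fixpoint lebesgue_rec (R : realType) (n : nat) :
    {sigma_finite_measure set 'rV[R]_n -> \bar R} :=
  match n with
  | 0 => @dirac _ 'rV[R]_0 0 R
  | k.+1 => lebesgue_succ (lebesgue_rec R k)
  end.

Definition lebesgue_rV (R : realType) (n : nat) : set 'rV[R]_n -> \bar R :=
  lebesgue_rec R n.

HB.instance Definition _ (R : realType) (n : nat) :=
  SigmaFiniteMeasure.copy (@lebesgue_rV R n) (lebesgue_rec R n).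

Section sobolev.
Context (R : realType) (n : nat).
Local Notation mu := (@lebesgue_rV R n).
Implicit Types (x y xi : 'rV[R]_n) (u v f g gamma phi : 'rV[R]_n -> R).
Implicit Types (A Omega W : set 'rV[R]_n).

Definition dotp x y : R := \sum_(i < n) x ord0 i * y ord0 i.

(* The library norm on 'rV[R]_n is the sup norm. *)
Definition enorm x : R := Num.sqrt (dotp x x).

Definition pderiv (l : seq 'I_n) phi : 'rV[R]_n -> R :=
  foldr (fun i g => 'D_(delta_mx ord0 i) g) phi l.

Definition smooth phi : Prop := forall l : seq 'I_n,
  continuous (pderiv l phi) /\
  forall i x, derivable (pderiv l phi) x (delta_mx ord0 i).

Definition supp phi : set 'rV[R]_n := closure [set x | phi x != 0].

Definition Cc_infty A : set ('rV[R]_n -> R) :=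
  [set phi | [/\ smooth phi, compact (supp phi) & supp phi `<=` A]].

Definition schwartz : set ('rV[R]_n -> R) :=
  [set phi | smooth phi /\ forall (k : nat) (l : seq 'I_n),
    exists C : R, forall x, enorm x ^+ k * `|pderiv l phi x| <= C].

(* Real and imaginary parts of F phi(xi) = \int exp(- i x.xi) phi(x) dx *)
Definition fourier_re phi xi : R := \int[mu]_x (phi x * cos (dotp x xi)).
Definition fourier_im phi xi : R := \int[mu]_x (- phi x * sin (dotp x xi)).

Definition bessel_weight (s : R) xi : R := (1 + enorm xi ^+ 2) `^ (s / 2).

(* v = F^-1 ((1 + |xi|^2)^(s/2) F u) for u, v in L^2, that is,
   F v = (1 + |xi|^2)^(s/2) F u as tempered distributions, where F acts on
   tempered distributions by <F u, phi> = <u, F phi>. By linearity it suffices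
   to test against real-valued phi. *)
Definition bessel_potential (s : R) u : set ('rV[R]_n -> R) :=
  [set v | v \in Lfun mu 2%:E /\ forall phi, schwartz phi ->
    let wphi := fun xi => bessel_weight s xi * phi xi in
    \int[mu]_x (v x * fourier_re phi x) =
      \int[mu]_x (u x * fourier_re wphi x) /\
    \int[mu]_x (v x * fourier_im phi x) =
      \int[mu]_x (u x * fourier_im wphi x)].

(* H^s(R^n) for s >= 0, whose elements are square-integrable functions *)
Definition sobolev (s : R) : set ('rV[R]_n -> R) :=
  [set u | u \in Lfun mu 2%:E /\ bessel_potential s u !=set0].

(* The elements of bessel_potential s u are equal almost everywhere, so for
   u in H^s the infimum is over one number; outside H^s it is +oo. *)
Definition sobolev_norm (s : R) u : \bar R :=
  ereal_inf [set ('N[mu]_(2%:E) [EFin \o v])%E | v in bessel_potential s u].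

(* The closure of C_c^oo(Omega) in H^s(R^n) *)
Definition sobolev_tilde (s : R) Omega : set ('rV[R]_n -> R) :=
  [set u | sobolev s u /\ forall e : R, 0 < e ->
    exists2 phi, Cc_infty Omega phi & (sobolev_norm s (u \- phi)%R < e%:E)%E].

End sobolev.

Section gamma_function.
Context (R : realType).

Definition euler_integral (x : R) : R :=
  \int[lebesgue_measure]_(t in `]0, +oo[) (t `^ (x - 1) * expR (- t)).

(* Euler's integral for x > 0, extended to x <= 0 by
   Gamma x = Gamma (x + k) / (x (x + 1) ... (x + k - 1)) *)
Definition Gamma (x : R) : R :=
  if 0 < x then euler_integral x else
  let k := (Num.truncn (- x)).+1 in
  euler_integral (x + k%:R) / \prod_(i < k) (x + i%:R).

End gamma_function.

Section conductivity.
Context (R : realType) (n : nat).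
Local Notation mu := (@lebesgue_rV R n).
Implicit Types (u v f g gamma phi : 'rV[R]_n -> R).
Implicit Types (Omega W : set 'rV[R]_n).

Definition frac_const (s : R) : R :=
  4 `^ s * Gamma (n%:R / 2 + s) / (pi `^ (n%:R / 2) * `|Gamma (- s)|).

Definition bilinear_form (s : R) gamma u v : R :=
  frac_const s / 2 *
  \int[(mu \x mu)%E]_z
    (Num.sqrt (gamma z.1) * Num.sqrt (gamma z.2)
       / enorm (z.1 - z.2) `^ (n%:R + 2 * s)
     * (u z.1 - u z.2) * (v z.1 - v z.2)).

Definition weak_solution (s : R) Omega gamma f : set ('rV[R]_n -> R) :=
  [set u | [/\ sobolev s u, sobolev_tilde s Omega (u \- f) &
    forall phi, sobolev_tilde s Omega phi -> bilinear_form s gamma u phi = 0]].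

(* u_f, unique up to equality almost everywhere; the default value is
   irrelevant as a weak solution exists. *)
Definition solution (s : R) Omega gamma f : 'rV[R]_n -> R :=
  xget f (weak_solution s Omega gamma f).

(* <Lambda_gamma f, g>, where f and g in H^s(R^n) represent their classes in
   the quotient H^s(R^n) / sobolev_tilde s Omega *)
Definition DN_map (s : R) Omega gamma f g : R :=
  bilinear_form s gamma (solution s Omega gamma f) g.

Definition exterior Omega : set 'rV[R]_n := ~` closure Omega.

(* After x |-> x *m A + b, Omega lies in R^m x omega with omega in R^k. *)
Definition bounded_in_one_direction Omega : Prop :=
  exists (m k : nat) (e : n = (m + k)%N) (A : 'M[R]_n) (b : 'rV[R]_n)
      (omega : set 'rV[R]_k),
    [/\ (1 <= k)%N, A *m A^T = 1%:M, open omega, bounded_set omega &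
      forall x, Omega x ->
        omega (rsubmx (castmx (erefl 1%N, e) (x *m A + b)))].

Definition continuous_ae W gamma : Prop :=
  exists2 gamma', gamma' = gamma %[ae mu] &
    \forall x \ae mu, W x -> {for x, continuous gamma'}.

End conductivity.

(* Main.v *)
(** Test the equality of the DN maps with [g = f] for [f] supported near a point
    [x0] of [W].  Write the solution as [f + w] with [w] in [H~^s(Omega)], so that
    [B(f, w) = - B(w, w)] and [<Lambda f, f> = B(f, f) - B(w, w)].  As [w] vanishes
    on [W], only pairs of points at a distance bounded below contribute to
    [B(f, w)], and Young's inequality gives [B(w, w) <= C |f|_2^2].  If
    [gamma1 > gamma2] near [x0], this bounds the Gagliardo energy of [f] by
    [C |f|_2^2] for every [f] supported near [x0], which concentrating a bump at
    [x0] refutes: its energy gains a factor [N^(2s)] over its [L^2] norm.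

    The analytic input is that [w], which is defined through the Fourier
    transform, has finite Gagliardo energy.  This is proved with the heat
    semigroup [P_t]: testing the definition of the Bessel potential [v] of [u]
    on Gaussians gives [u = \int rho(t) P_t v dt], the Riesz kernel
    [|h|^(-n-2s)] is bounded by [\int t^(-1-s) p_t(h) dt], and the energies
    [\int\int p_t(x-y) (g(x)-g(y))^2 = 2 (|g|^2 - |P_(t/2) g|^2)] telescope along
    the semigroup. *)
Require Import Defs.
From HB Require Import structures.
From mathcomp Require Import all_boot all_order all_algebra.
From mathcomp Require Import all_classical all_reals all_analysis.
From mathcomp Require Import measurable_realfun ring lra.

Set Implicit Arguments.
Unset Strict Implicit.
Unset Printing Implicit Defensive.

Import Order.TTheory GRing.Theory Num.Theory.
Import numFieldNormedType.Exports.

Local Open Scope classical_set_scope.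
Local Open Scope ring_scope.

(** * Affine changes of variables *)

(** The obstacle is finiteness. [Rintegral] is additive only on integrable functions, so expanding
    the form at [f + w] requires finite energy of [w], whereas [sobolev_tilde] only provides a
    Bessel potential. Instead of Plancherel, heat smoothing is used: [heatop e] of [u] and of
    [Jop s v] agree for all [e > 0], and a square-integrable function whose heat evolution vanishes
    at all positive times is 0 almost everywhere.

    The time average in [Jop] is the second difficulty. With [M tau] the squared norm of the flow of
    [v], only bounds and monotonicity of [M] are known, so [M tau - M (c * tau)] can be integrated
    against [dtau / tau] and no more singular weight. Jensen with the density [rho], of order
    [tau^(s/2-1)] at 0, would leave [tau^(-1-s/2)] after scaling. Cauchy-Schwarz is therefore done
    with a weight in [tau / t] that restores scale invariance; the small exponent [del] pays for it.

    In the final contradiction the constant in front of the squared norm depends on the radius [r]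
    but not on the concentration [N], since [r] is fixed before the bump is rescaled. *)

Section affine_line.
Context (R : realType).
Local Notation leb := (@lebesgue_measure R).

Lemma measurable_affine (a b : R) :
  measurable_fun [set: measurableTypeR R] ((fun x => a * x + b) : R -> measurableTypeR R).
Proof. by apply: measurable_funD => //; exact: measurable_funM. Qed.

(** The rescaled image measure gives every half-open interval its length, which characterises
    Lebesgue measure. *)
Lemma pushforward_affine (a b : R) (A : set (measurableTypeR R)) : 0 < a -> measurable A ->
  leb A = (a%:E * leb ((fun x => (a * x + b)%R) @^-1` A))%E.
Proof.
move=> a0 mA.
pose m := mscale (NngNum (ltW a0)) (measure_function_pushforward__canonical__measure_function_Measure leb (measurable_affine a b)).
have -> : (a%:E * leb ((fun x => (a * x + b)%R) @^-1` A))%E = m A by [].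
apply: (@lebesgue_measure_unique R m) => //.
move=> _ [[c d] _ <-]; rewrite /= /m /mscale /= /pushforward.
have -> : (fun x => a * x + b) @^-1` `]c, d]%classic = `](c - b) / a, (d - b) / a]%classic.
  apply/seteqP; split => x /=; rewrite !in_itv /= ltr_pdivrMr// ler_pdivlMr//;
  rewrite ltrBlDr lerBrDr mulrC => /andP[? ?]; exact/andP.
rewrite !lebesgue_measure_itv /= !lte_fin ltr_pM2r ?invr_gt0// ltrBlDr subrK.
case: ifPn => _; last by rewrite mule0.
by rewrite -!EFinB -EFinM; congr EFin; field; rewrite gt_eqF.
Qed.

Lemma ge0_integral_affine (a b : R) (f : R -> \bar R) : 0 < a ->
  measurable_fun setT f -> (forall x, (0 <= f x)%E) ->
  (\int[leb]_x f (a * x + b)%R = a^-1%:E * \int[leb]_x f x)%E.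
Proof.
move=> a0 mf f0.
pose m := measure_function_pushforward__canonical__measure_function_Measure leb (measurable_affine a b).
have -> : (\int[leb]_x f x = \int[mscale (NngNum (ltW a0)) m]_x f x)%E.
  by apply: eq_measure_integral => A mA _; exact: pushforward_affine.
rewrite ge0_integral_mscale// muleA -EFinM mulVf ?gt_eqF// mul1e.
rewrite /m /= ge0_integral_pushforward//.
exact: measurable_affine.
Qed.
End affine_line.

Section integral_rV.
Context (R : realType).
Local Notation leb := (@lebesgue_measure R).
Local Notation mu n := (@lebesgue_rV R n).

Lemma ge0_integral_rVS n (f : 'rV[R]_n.+1 -> \bar R) : measurable_fun setT f ->
  (forall x, (0 <= f x)%E) ->
  (\int[mu (n.+1)]_x f x = \int[mu n]_x \int[leb]_t f (rV_cons (x, t)))%E.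
Proof.
move=> mf f0; rewrite /lebesgue_rV /= /lebesgue_succ.
rewrite ge0_integral_pushforward//; last exact: measurable_rV_cons.
rewrite preimage_setT fubini_tonelli1//.
  exact: measurableT_comp mf (@measurable_rV_cons R n).
by move=> x; exact: f0.
Qed.

Lemma ge0_integral_rV0 (f : 'rV[R]_0 -> \bar R) : measurable_fun setT f ->
  (\int[mu 0]_x f x)%E = f 0%R.
Proof.
by move=> mf; rewrite /lebesgue_rV /= integral_dirac// diracT mul1e.
Qed.

Lemma rV_cons_affine n (a : R) (x b : 'rV[R]_n) t c :
  rV_cons (a *: x + b, a * t + c) = a *: rV_cons (x, t) + rV_cons (b, c).
Proof. by apply/rowP => i; rewrite !mxE; case: unliftP => [j|] _ /=; rewrite ?mxE. Qed.

Lemma measurable_fun_affine_rV n d (T : measurableType d) (a : R) (f g : T -> 'rV[R]_n) :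
  measurable_fun setT f -> measurable_fun setT g ->
  measurable_fun setT (fun x => a *: f x + g x).
Proof.
move=> mf mg; apply: measurable_fun_rVP => i; under eq_fun do rewrite !mxE.
apply: measurable_funD; first apply: measurable_funM => //.
  exact: measurableT_comp (measurable_coord _) mf.
exact: measurableT_comp (measurable_coord _) mg.
Qed.

(** Induction on the dimension: each coordinate that is split off contributes one factor [a^-1]. *)
Lemma ge0_integral_rV_affine n (a : R) (b : 'rV[R]_n) (f : 'rV[R]_n -> \bar R) : 0 < a ->
  measurable_fun setT f -> (forall x, (0 <= f x)%E) ->
  (\int[mu n]_x f (a *: x + b)%R = (a ^- n)%:E * \int[mu n]_x f x)%E.
Proof.
move=> a0; elim: n b f => [|n IH] b f mf f0.
  rewrite expr0 invr1 mul1e !ge0_integral_rV0//; first by congr f; apply/rowP => -[].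
  by apply: measurableT_comp => //; exact: measurable_fun_affine_rV.
pose b' := rV_uncons b; have -> : b = rV_cons b' by rewrite rV_unconsK.
rewrite !ge0_integral_rVS//; last first.
  by apply: measurableT_comp => //; exact: measurable_fun_affine_rV.
case: b' => b1 b2.
under eq_integral => x _.
  under eq_integral do rewrite -rV_cons_affine.
  rewrite (@ge0_integral_affine _ a b2 (fun t => f (rV_cons (a *: x + b1, t))))//; last first.
    apply: measurableT_comp => //; apply: (measurableT_comp (@measurable_rV_cons R n)).
    exact: measurable_fun_pair.
  over.
have mF : measurable_fun setT (fun x => (\int[leb]_t f (rV_cons (x, t)))%E).
  apply: (@measurable_fun_fubini_tonelli_F _ _ _ _ _ leb (fun z => f (rV_cons z))) => //.
  exact: measurableT_comp mf (@measurable_rV_cons R n).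
have F0 x : (0 <= \int[leb]_t f (rV_cons (x, t)))%E by exact: integral_ge0.
rewrite (IH b1 (fun x => a^-1%:E * \int[leb]_t f (rV_cons (x, t)))%E)//; last 2 first.
- exact: measurable_funeM.
- by move=> x; rewrite mule_ge0// lee_fin invr_ge0 ltW.
rewrite ge0_integralZl//; last by rewrite lee_fin invr_ge0 ltW.
by rewrite muleA -EFinM exprS invfM mulrC.
Qed.
End integral_rV.

(** * Measurability *)

Section measurability.
Context (R : realType) d (T : measurableType d).
Implicit Types (f g : T -> R).

Lemma measurable_fun_expR f : measurable_fun setT f -> measurable_fun setT (fun x => expR (f x)).
Proof. by move=> mf; exact: (measurableT_comp (@measurable_expR R) mf). Qed.

Lemma measurable_fun_powR f (p : R) : measurable_fun setT f -> measurable_fun setT (fun x => f x `^ p).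
Proof. by move=> mf; exact: (measurableT_comp (@measurable_powR R p) mf). Qed.

Lemma measurable_fun_sqrt f : measurable_fun setT f -> measurable_fun setT (fun x => Num.sqrt (f x)).
Proof.
move=> mf; apply: (measurableT_comp _ mf).
by apply: continuous_measurable_fun; exact: sqrt_continuous.
Qed.

Lemma measurable_fun_cos f : measurable_fun setT f -> measurable_fun setT (fun x => cos (f x)).
Proof.
move=> mf; apply: (measurableT_comp _ mf).
by apply: continuous_measurable_fun; exact: continuous_cos.
Qed.

Lemma measurable_fun_sin f : measurable_fun setT f -> measurable_fun setT (fun x => sin (f x)).
Proof.
move=> mf; apply: (measurableT_comp _ mf).
by apply: continuous_measurable_fun; exact: continuous_sin.
Qed.

Lemma measurable_fun_ln f : measurable_fun setT f -> measurable_fun setT (fun x => ln (f x)).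
Proof. by move=> mf; exact: (measurableT_comp (@measurable_ln R) mf). Qed.

Lemma measurable_fun_normr f : measurable_fun setT f -> measurable_fun setT (fun x => `|f x|).
Proof. by move=> mf; exact: measurableT_comp. Qed.

Lemma measurable_fun_invr f : measurable_fun setT f -> measurable_fun setT (fun x => (f x)^-1).
Proof.
move=> mf.
(* Inversion is discontinuous at 0, so it is pieced together from the measurable power [-1] on
   either side; at 0 both expressions are 0. *)
have -> : (fun x => (f x)^-1) = (fun x => if 0 < f x then f x `^ (-1) else - ((- f x) `^ (-1))).
  apply/funext => x; case: ltgtP => f0.
  - by rewrite powRN powRr1// ltW.
  - by rewrite powRN powRr1 ?invrN ?opprK// lerNr oppr0 ltW.
  - by rewrite -f0 invr0 oppr0 powR0 ?oppr0// oppr_eq0.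
apply: measurable_fun_ifT; last 2 first.
- exact: measurable_fun_powR.
- by apply: measurableT_comp => //; apply: measurable_fun_powR; exact: measurableT_comp.
- by apply: measurable_fun_ltr.
Qed.

Lemma measurable_fun_rVD n (f g : T -> 'rV[R]_n) : measurable_fun setT f -> measurable_fun setT g ->
  measurable_fun setT (fun x => f x + g x).
Proof.
move=> mf mg; apply: measurable_fun_rVP => i; under eq_fun do rewrite !mxE.
by apply: measurable_funD; exact: measurableT_comp (measurable_coord _) _.
Qed.

Lemma measurable_fun_rVN n (f : T -> 'rV[R]_n) : measurable_fun setT f ->
  measurable_fun setT (fun x => - f x).
Proof.
move=> mf; apply: measurable_fun_rVP => i; under eq_fun do rewrite !mxE.
by apply: measurableT_comp => //; exact: measurableT_comp (measurable_coord _) _.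
Qed.

Lemma measurable_fun_rVZ n f (g : T -> 'rV[R]_n) : measurable_fun setT f -> measurable_fun setT g ->
  measurable_fun setT (fun x => f x *: g x).
Proof.
move=> mf mg; apply: measurable_fun_rVP => i; under eq_fun do rewrite !mxE.
by apply: measurable_funM => //; exact: measurableT_comp (measurable_coord _) _.
Qed.

Lemma measurable_fun_coord n (f : T -> 'rV[R]_n) j i : measurable_fun setT f ->
  measurable_fun setT (fun x => f x j i).
Proof. by move=> mf; rewrite (ord1 j); exact: measurableT_comp (measurable_coord _) _. Qed.

Lemma measurable_fun_dotp n (f g : T -> 'rV[R]_n) : measurable_fun setT f -> measurable_fun setT g ->
  measurable_fun setT (fun x => dotp (f x) (g x)).
Proof.
move=> mf mg; rewrite /dotp; apply: measurable_sum => i.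
by apply: measurable_funM; exact: measurable_fun_coord.
Qed.

Lemma measurable_fun_enorm n (f : T -> 'rV[R]_n) : measurable_fun setT f ->
  measurable_fun setT (fun x => enorm (f x)).
Proof. by move=> mf; apply: measurable_fun_sqrt; exact: measurable_fun_dotp. Qed.

Lemma measurable_fun_fst d1 d2 (T1 : measurableType d1) (T2 : measurableType d2)
  (f : T -> T1 * T2) : measurable_fun setT f -> measurable_fun setT (fun x => (f x).1).
Proof. by move=> mf; exact: (measurableT_comp measurable_fst mf). Qed.

Lemma measurable_fun_snd d1 d2 (T1 : measurableType d1) (T2 : measurableType d2)
  (f : T -> T1 * T2) : measurable_fun setT f -> measurable_fun setT (fun x => (f x).2).
Proof. by move=> mf; exact: (measurableT_comp measurable_snd mf). Qed.

Lemma measurable_fun_opp f : measurable_fun setT f -> measurable_fun setT (fun x => - f x).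
Proof. by move=> mf; exact: measurableT_comp. Qed.

Lemma measurable_fun_if_lt f g (h k : T -> R) : measurable_fun setT f -> measurable_fun setT g ->
  measurable_fun setT h -> measurable_fun setT k ->
  measurable_fun setT (fun x => if f x < g x then h x else k x).
Proof. by move=> mf mg mh mk; apply: measurable_fun_ifT => //; exact: measurable_fun_ltr. Qed.

Lemma measurable_fun_if_le f g (h k : T -> R) : measurable_fun setT f -> measurable_fun setT g ->
  measurable_fun setT h -> measurable_fun setT k ->
  measurable_fun setT (fun x => if f x <= g x then h x else k x).
Proof. by move=> mf mg mh mk; apply: measurable_fun_ifT => //; exact: measurable_fun_ler. Qed.

End measurability.

(** A power cut off to [t > 0]: integrals over the half-line can be written over all of [R], and
    exponents add without a side condition ([pwD]). *)
Definition pw (R : realType) (a t : R) : R := if 0 < t then t `^ a else 0.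

Section pw.
Context (R : realType).
Implicit Types (a b s t : R).

Lemma pw_ge0 a t : 0 <= pw a t.
Proof. by rewrite /pw; case: ifP => // _; exact: powR_ge0. Qed.

Lemma pw_gt0 a t : 0 < t -> 0 < pw a t.
Proof. by move=> t0; rewrite /pw t0 powR_gt0. Qed.

Lemma pwE a t : 0 < t -> pw a t = t `^ a. Proof. by rewrite /pw => ->. Qed.

Lemma pw_le0 a t : t <= 0 -> pw a t = 0.
Proof. by move=> t0; rewrite /pw ltNge t0. Qed.

Lemma pwD a b t : pw (a + b) t = pw a t * pw b t.
Proof.
rewrite /pw; case: ifPn => t0; last by rewrite mul0r.
by rewrite powRD// (gt_eqF t0) implybT.
Qed.

Lemma pwM a s t : 0 < s -> pw a (s * t) = s `^ a * pw a t.
Proof.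
move=> s0; rewrite /pw pmulr_rgt0//; case: ifPn => [t0|_]; last by rewrite mulr0.
by rewrite powRM// ltW.
Qed.

Lemma measurable_fun_pw d (T : measurableType d) (f : T -> R) a :
  measurable_fun setT f -> measurable_fun setT (fun x => pw a (f x)).
Proof. by move=> mf; apply: measurable_fun_if_lt => //; exact: measurable_fun_powR. Qed.

End pw.

(** The head symbol under the binder selects the closure lemma; measurability hypotheses of the
    context serve as leaves and under composition. *)
Ltac meas1 :=
  match goal with
  | |- measurable_fun _ (fun x => x) => exact: measurable_id
  | |- measurable_fun _ (fun x => EFin (@?f x)) => apply/measurable_EFinP => /=
  | |- measurable_fun _ (EFin \o _) => apply/measurable_EFinP => /=
  | |- measurable_fun _ (fun x => ?c) => exact: measurable_cst
  | |- measurable_fun _ (fun x => fst (@?f x)) => apply: (@measurable_fun_fst _ _ _ _ _ _ f)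
  | |- measurable_fun _ (fun x => snd (@?f x)) => apply: (@measurable_fun_snd _ _ _ _ _ _ f)
  | |- measurable_fun _ (fun x => (@?f x, @?g x)) => apply: (@measurable_fun_pair _ _ _ _ _ _ f g)
  | |- measurable_fun _ (fun x => @GRing.add _ (@?f x) (@?g x)) =>
       first [apply: (@measurable_funD _ _ _ _ f g) | apply: (@measurable_fun_rVD _ _ _ _ f g)]
  | |- measurable_fun _ (fun x => @GRing.opp _ (@?f x)) =>
       first [apply: (@measurable_fun_opp _ _ _ f) | apply: (@measurable_fun_rVN _ _ _ _ f)]
  | |- measurable_fun _ (fun x => @GRing.mul _ (@?f x) (@?g x)) => apply: (@measurable_funM _ _ _ _ f g)
  | |- measurable_fun _ (fun x => @GRing.exp _ (@?f x) _) => apply: (@measurable_funX _ _ _ _ f)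
  | |- measurable_fun _ (fun x => @GRing.inv _ (@?f x)) => apply: (@measurable_fun_invr _ _ _ f)
  | |- measurable_fun _ (fun x => @GRing.scale _ _ (@?f x) (@?g x)) => apply: (@measurable_fun_rVZ _ _ _ _ f g)
  | |- measurable_fun _ (fun x => Order.max (@?f x) (@?g x)) => apply: (@measurable_maxr _ _ _ _ f g)
  | |- measurable_fun _ (fun x => Order.min (@?f x) (@?g x)) => apply: (@measurable_minr _ _ _ _ f g)
  | |- measurable_fun _ (fun x => expR (@?f x)) => apply: (@measurable_fun_expR _ _ _ f)
  | |- measurable_fun _ (fun x => ln (@?f x)) => apply: (@measurable_fun_ln _ _ _ f)
  | |- measurable_fun _ (fun x => cos (@?f x)) => apply: (@measurable_fun_cos _ _ _ f)
  | |- measurable_fun _ (fun x => sin (@?f x)) => apply: (@measurable_fun_sin _ _ _ f)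
  | |- measurable_fun _ (fun x => Num.norm (@?f x)) => apply: (@measurable_fun_normr _ _ _ f)
  | |- measurable_fun _ (fun x => powR (@?f x) _) => apply: (@measurable_fun_powR _ _ _ f)
  | |- measurable_fun _ (fun x => pw _ (@?f x)) => apply: (@measurable_fun_pw _ _ _ f)
  | |- measurable_fun _ (fun x => dotp (@?f x) (@?g x)) => apply: (@measurable_fun_dotp _ _ _ _ f g)
  | |- measurable_fun _ (fun x => enorm (@?f x)) => apply: (@measurable_fun_enorm _ _ _ _ f)
  | |- measurable_fun _ (fun x => fun_of_matrix (@?f x) _ _) => apply: (@measurable_fun_coord _ _ _ _ f)
  | |- measurable_fun _ (fun x => Num.sqrt (@?f x)) => apply: (@measurable_fun_sqrt _ _ _ f)
  | H : measurable_fun _ ?f |- measurable_fun _ (fun x => ?f (@?g x)) =>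
      apply: (measurableT_comp H)
  | H : is_true (?f \in _), H' : measurable_fun _ ?f |- measurable_fun _ ?f => exact: H'
  | H : measurable_fun _ ?f |- measurable_fun _ ?f => exact: H
  | |- measurable_fun _ fst => exact: measurable_fst
  | |- measurable_fun _ snd => exact: measurable_snd
  | |- measurable_fun _ _ => first [apply: measurable_fun_if_lt | apply: measurable_fun_if_le]
  end.
Ltac meas := repeat meas1; try by [].

(** * Integration tools *)

Section integral_tools.
Local Open Scope ereal_scope.
Context d (T : measurableType d) (R : realType) (mu : {measure set T -> \bar R}).
Implicit Types f g : T -> R.

Lemma le_int f g : measurable_fun setT f -> measurable_fun setT g ->
  (forall x, (0 <= f x)%R) -> (forall x, (f x <= g x)%R) ->
  \int[mu]_x (f x)%:E <= \int[mu]_x (g x)%:E.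
Proof.
move=> mf mg f0 fg; apply: ge0_le_integral => //.
- by move=> x _; rewrite lee_fin.
- exact/measurable_EFinP.
- exact/measurable_EFinP.
- by move=> x _; rewrite lee_fin.
Qed.

Lemma int_ge0 f : (forall x, (0 <= f x)%R) -> 0 <= \int[mu]_x (f x)%:E.
Proof. by move=> f0; apply: integral_ge0 => x _; rewrite lee_fin. Qed.

Lemma intZl f (k : R) : measurable_fun setT f -> (forall x, (0 <= f x)%R) -> (0 <= k)%R ->
  \int[mu]_x (k * f x)%:E = k%:E * \int[mu]_x (f x)%:E.
Proof.
move=> mf f0 k0; under eq_integral do rewrite EFinM.
by rewrite ge0_integralZl_EFin//; [move=> x _; rewrite lee_fin|exact/measurable_EFinP].
Qed.

Lemma intD f g : measurable_fun setT f -> measurable_fun setT g ->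
  (forall x, (0 <= f x)%R) -> (forall x, (0 <= g x)%R) ->
  \int[mu]_x (f x + g x)%:E = \int[mu]_x (f x)%:E + \int[mu]_x (g x)%:E.
Proof.
move=> mf mg f0 g0; under eq_integral do rewrite EFinD.
by rewrite ge0_integralD//; first [exact/measurable_EFinP | move=> x _; rewrite lee_fin].
Qed.

Lemma ge0_integral_Rintegral f : measurable_fun setT f -> (forall x, (0 <= f x)%R) ->
  \int[mu]_x (f x)%:E < +oo -> mu.-integrable setT (EFin \o f).
Proof.
move=> mf f0 fy; apply/integrableP; split; first exact/measurable_EFinP.
by under eq_integral do rewrite gee0_abs ?lee_fin//.
Qed.

Lemma poweRD_2 (x : \bar R) : 0 <= x -> x `^ 2 = x * x.
Proof.
case: x => [r r0| _|//]; last by rewrite poweRyr ?pnatr_eq0.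
by rewrite poweR_EFin -EFinM powR_mulrn.
Qed.

(** Hölder with exponents 2 and 2, in squared form so that no roots of extended reals appear; the
    integrals may be infinite. *)
Lemma cauchy_schwarz f g : measurable_fun setT f -> measurable_fun setT g ->
  (forall x, (0 <= f x)%R) -> (forall x, (0 <= g x)%R) ->
  (\int[mu]_x (f x * g x)%:E) * (\int[mu]_x (f x * g x)%:E) <=
  \int[mu]_x (f x ^+ 2)%:E * \int[mu]_x (g x ^+ 2)%:E.
Proof.
move=> mf mg f0 g0.
have sq h : (forall x, (0 <= h x)%R) -> \int[mu]_x (h x ^+ 2)%:E = 'N[mu]_2%:E[EFin \o h] * 'N[mu]_2%:E[EFin \o h].
  move=> h0; rewrite -poweRD_2 ?Lnorm_ge0// poweR_Lnorm ?pnatr_eq0//.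
  by apply: eq_integral => x _ /=; rewrite ger0_norm// powR_mulrn.
rewrite (sq f)// (sq g)// muleACA.
have H : \int[mu]_x (f x * g x)%:E <= 'N[mu]_2%:E[EFin \o f] * 'N[mu]_2%:E[EFin \o g].
  apply: le_trans (@hoelder _ _ _ mu f g 2 2 mf mg ltac:(lra) ltac:(lra) ltac:(lra)).
  rewrite Lnorm1; apply: ge0_le_integral => //=.
  - by move=> x _; rewrite lee_fin mulr_ge0.
  - by apply/measurable_EFinP; exact: measurable_funM.
  - by apply/measurable_EFinP/measurable_fun_normr; exact: measurable_funM.
  - by move=> x _; rewrite lee_fin ler_norm.
by apply: lee_pmul => //; apply: int_ge0 => x; exact: mulr_ge0.
Qed.

(** Monotone convergence along an exhaustion of the set where [f] is positive. *)
Lemma integral_le_cvg f (F : (set T)^nat) (C : \bar R) : measurable_fun setT f ->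
  (forall x, (0 <= f x)%R) -> {homo F : n m / (n <= m)%N >-> (n <= m)%O} ->
  (forall i, measurable (F i)) -> (forall x, (0 < f x)%R -> exists i, F i x) ->
  (forall i, \int[mu]_(x in F i) (f x)%:E <= C) -> \int[mu]_x (f x)%:E <= C.
Proof.
move=> mf f0 ndF mF UF FC.
have -> : \int[mu]_x (f x)%:E = \int[mu]_(x in \bigcup_i F i) (f x)%:E.
  rewrite [RHS]integral_mkcond; apply: eq_integral => x _; rewrite patchE.
  case: ifPn => //; rewrite notin_setE => nFx; apply/eqP; rewrite eqe eq_le f0 andbT leNgt.
  by apply/negP => /UF[i Fi]; apply: nFx; exists i.
have mfi i : measurable_fun (F i) (EFin \o f) by apply/measurable_funTS/measurable_EFinP.
have H := @ge0_nondecreasing_set_cvg_integral _ _ _ F (EFin \o f) mu ndF mF mfi _.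
have {}H := H (fun i x _ => f0 x).
rewrite -(cvg_lim _ H)//; apply: lime_le; first by apply/cvg_ex; eexists; exact: H.
by near=> i; exact: FC.
Unshelve. all: end_near. Qed.

End integral_tools.

Section tonelli_tools.
Local Open Scope ereal_scope.
Context d1 d2 (T1 : measurableType d1) (T2 : measurableType d2) (R : realType).
Variable m1 : {sigma_finite_measure set T1 -> \bar R}.
Variable m2 : {sigma_finite_measure set T2 -> \bar R}.
Variable f : T1 -> T2 -> R.
Hypothesis mf : measurable_fun setT (fun z : T1 * T2 => f z.1 z.2).
Hypothesis f0 : forall x y, (0 <= f x y)%R.

Let g := fun z : T1 * T2 => (f z.1 z.2)%:E.
Let mg : measurable_fun setT g. Proof. exact/measurable_EFinP. Qed.
Let g0 z : 0 <= g z. Proof. by rewrite lee_fin. Qed.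

Lemma tonelli : \int[m1]_x \int[m2]_y (f x y)%:E = \int[m2]_y \int[m1]_x (f x y)%:E.
Proof. exact: (@fubini_tonelli _ _ _ _ _ m1 m2 g mg g0). Qed.

Lemma tonelli_prod : \int[m1 \x m2]_z (f z.1 z.2)%:E = \int[m1]_x \int[m2]_y (f x y)%:E.
Proof. exact: (@fubini_tonelli1 _ _ _ _ _ m1 m2 g mg g0). Qed.

Lemma measurable_int2 : measurable_fun setT (fun x => \int[m2]_y (f x y)%:E).
Proof. exact: (@measurable_fun_fubini_tonelli_F _ _ _ _ _ m2 g mg g0). Qed.

Lemma measurable_int1 : measurable_fun setT (fun y => \int[m1]_x (f x y)%:E).
Proof. exact: (@measurable_fun_fubini_tonelli_G _ _ _ _ _ m1 g mg g0). Qed.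

End tonelli_tools.

(** * Integrals of powers on the half-line *)

Section pw_integrals.
Local Open Scope ereal_scope.
Context (R : realType).
Local Notation leb := (@lebesgue_measure R).

Lemma integral_powR_itv (a x y : R) : (a != 0)%R -> (0 < x)%R -> (x < y)%R ->
  \int[leb]_(t in `[x, y]) (t `^ (a - 1))%:E = ((y `^ a - x `^ a) / a)%:E.
Proof.
move=> a0 x0 xy.
have d (t : R) : (0 < t)%R -> is_derive t 1%R (fun t => a^-1 * t `^ a)%R (t `^ (a - 1))%R.
  move=> t0; have H := is_derive1_powR a t0.
  apply: (is_derive_eq (is_deriveZ a^-1 H)); by rewrite /GRing.scale /= mulrA mulVf// mul1r.
have c (t b : R) : (0 < t)%R -> {for t, continuous (fun t => t `^ b)%R}.
  move=> t0; have H := is_derive1_powR b t0.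
  by apply/differentiable_continuous/derivable1_diffP; apply: ex_derive.
rewrite (@continuous_FTC2 _ (fun t => t `^ (a-1))%R (fun t => a^-1 * t `^ a)%R)//.
- by rewrite -EFinB mulrBl; congr (_ - _)%:E%E; rewrite mulrC.
- apply: continuous_in_subspaceT => t; rewrite inE /= in_itv /= => /andP[xt _].
  exact/c/(lt_le_trans x0).
- split.
  + move=> t; rewrite in_itv /= => /andP[xt _]; apply: ex_derive; exact/d/(lt_trans x0).
  + apply: cvg_at_right_filter; apply: cvgM; [exact: cvg_cst|exact: c].
  + apply: cvg_at_left_filter; apply: cvgM; [exact: cvg_cst|exact/c/(lt_trans x0)].
- move=> t; rewrite in_itv /= => /andP[xt _]; rewrite derive1E.
  by have H := d t (lt_trans x0 xt); rewrite derive_val.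
Qed.

Lemma integral_pw_lty (f : R -> R) (a b C : R) : measurable_fun setT f ->
  (0 < a)%R -> (0 < b)%R -> (0 <= C)%R -> (forall t, (0 <= f t)%R) -> (forall t, (t <= 0)%R -> f t = 0%R) ->
  (forall t, (0 < t)%R -> (t <= 1)%R -> (f t <= C * t `^ (a - 1))%R) ->
  (forall t, (1 <= t)%R -> (f t <= C * t `^ (- b - 1))%R) ->
  \int[leb]_t (f t)%:E < +oo.
Proof.
move=> mf a0 b0 C0 f0 fN f1 f2.
suff : \int[leb]_t (f t)%:E <= (C / a + C / b)%:E by move/le_lt_trans; apply; rewrite ltry.
(* The index [n.+2] keeps 1 strictly inside every interval, so that each can be split there; the two
   pieces contribute at most [C / a] and [C / b]. *)
pose F (n : nat) : set R := [set` `[(n.+2%:R^-1)%R : R, n.+2%:R%R]].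
apply: (@integral_le_cvg _ _ R leb f F) => //.
- move=> n m nm; apply/subsetPset => t; rewrite /F /= !in_itv /= => /andP[h1 h2]; apply/andP; split.
    by apply: le_trans h1; rewrite lef_pV2 ?posrE// ler_nat !ltnS.
  by apply: le_trans h2 _; rewrite ler_nat !ltnS.
- by move=> i; exact: measurable_itv.
- move=> t; have [t0|t0] := leP t 0%R; first by rewrite fN ?ltxx.
  move=> _; pose n := (Num.truncn t + Num.truncn t^-1)%N; exists n; rewrite /F /= in_itv /=; apply/andP; split.
    have h : (t^-1 <= n.+2%:R :> R)%R.
      by apply: le_trans (ltW (truncnS_gt _)) _; rewrite ler_nat ltnS /n leqW// leq_addl.
    by rewrite -[leRHS]invrK lef_pV2 ?posrE ?invr_gt0.
  by apply: le_trans (ltW (truncnS_gt _)) _; rewrite ler_nat ltnS /n leqW// leq_addr.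
move=> n; rewrite /F.
have i1 : (n.+2%:R^-1 < 1 :> R)%R by rewrite invf_lt1 ?ltr1n.
have i2 : (1 < n.+2%:R :> R)%R by rewrite ltr1n.
have mE D : measurable_fun D (EFin \o f) by apply/measurable_funTS/measurable_EFinP.
have mP D c : measurable_fun D (fun t : R => (C * t `^ c)%:E).
  by apply/measurable_funTS; meas.
apply: (@le_trans _ _ (\int[leb]_(t in `[(n.+2%:R^-1)%R : R, 1%R]) (f t)%:E +
                      \int[leb]_(t in `[1%R : R, n.+2%:R%R]) (f t)%:E)).
  rewrite (@itv_bndbnd_setU _ _ _ (BRight 1%R)) ?bnd_simp ?(ltW i1) ?(ltW i2)//.
  rewrite ge0_integral_setU//; last 3 first.
    exact: mE.
    by move=> x _; rewrite lee_fin.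
    apply/disj_setPS => x [] /=; rewrite !in_itv /= => /andP[_ h1] /andP[h2 _].
    by rewrite ltNge h1 in h2.
  by rewrite leeD2l// integral_itv_obnd_cbnd//; exact: mE.
rewrite EFinD; apply: leeD.
  apply: (@le_trans _ _ (\int[leb]_(t in `[(n.+2%:R^-1)%R : R, 1%R]) (C * t `^ (a - 1))%:E)).
    apply: ge0_le_integral; [by []|by move=> x _; rewrite lee_fin|exact: mE|exact: mP|].
    by move=> x; rewrite /= in_itv /= => /andP[h1 h2]; rewrite lee_fin f1//; apply: lt_le_trans h1; rewrite invr_gt0.
  under eq_integral do rewrite EFinM.
  rewrite ge0_integralZl_EFin//; last 2 first.
    by move=> x _; rewrite lee_fin powR_ge0.
    by apply/measurable_funTS; meas.
  rewrite integral_powR_itv ?gt_eqF ?invr_gt0//; rewrite -EFinM lee_fin powR1 ler_wpM2l// ler_pdivrMr// mulVf ?gt_eqF// lerBlDr lerDl powR_ge0.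
apply: (@le_trans _ _ (\int[leb]_(t in `[1%R : R, n.+2%:R%R]) (C * t `^ (- b - 1))%:E)).
  apply: ge0_le_integral; [by []|by move=> x _; rewrite lee_fin|exact: mE|exact: mP|].
  by move=> x; rewrite /= in_itv /= => /andP[h1 h2]; rewrite lee_fin f2.
under eq_integral do rewrite EFinM.
rewrite ge0_integralZl_EFin//; last 2 first.
  by move=> x _; rewrite lee_fin powR_ge0.
  by apply/measurable_funTS; meas.
rewrite integral_powR_itv ?oppr_eq0 ?gt_eqF// -EFinM lee_fin powR1 ler_wpM2l//.
by rewrite invrN mulrN -mulNr opprB ler_pdivrMr// mulVf ?gt_eqF// lerBlDr lerDl powR_ge0.
Qed.

End pw_integrals.

(** * The heat kernel *)

Section dotp.
Context (R : realType) (n : nat).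
Implicit Types x y z : 'rV[R]_n.

Lemma dotpC x y : dotp x y = dotp y x.
Proof. by apply: eq_bigr => i _; rewrite mulrC. Qed.

Lemma dotpDl x y z : dotp (x + y) z = dotp x z + dotp y z.
Proof. by rewrite /dotp -big_split; apply: eq_bigr => i _; rewrite mxE mulrDl. Qed.

Lemma dotpZl a x z : dotp (a *: x) z = a * dotp x z.
Proof. by rewrite /dotp mulr_sumr; apply: eq_bigr => i _; rewrite mxE mulrA. Qed.

Lemma dotpDr x y z : dotp z (x + y) = dotp z x + dotp z y.
Proof. by rewrite dotpC dotpDl !(dotpC z). Qed.

Lemma dotpZr a x z : dotp z (a *: x) = a * dotp z x.
Proof. by rewrite dotpC dotpZl dotpC. Qed.

Lemma dotpNl x z : dotp (- x) z = - dotp x z.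
Proof. by rewrite -scaleN1r dotpZl mulN1r. Qed.

Lemma dotpNr x z : dotp z (- x) = - dotp z x.
Proof. by rewrite dotpC dotpNl dotpC. Qed.

Lemma dotp_ge0 x : 0 <= dotp x x.
Proof. by apply: sumr_ge0 => i _; rewrite -expr2 sqr_ge0. Qed.

Lemma dotp_coord_le x i : x ord0 i ^+ 2 <= dotp x x.
Proof.
rewrite /dotp (bigD1 i)//= -expr2 lerDl; apply: sumr_ge0 => j _.
by rewrite -expr2 sqr_ge0.
Qed.

Lemma dotp_eq0 x : dotp x x = 0 -> x = 0.
Proof.
move=> x0; apply/rowP => i; rewrite mxE; apply/eqP; rewrite -sqrf_eq0 eq_le sqr_ge0 andbT.
by rewrite -x0 dotp_coord_le.
Qed.

Lemma enorm_ge0 x : 0 <= enorm x. Proof. exact: sqrtr_ge0. Qed.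

Lemma enorm_sqr x : enorm x ^+ 2 = dotp x x.
Proof. by rewrite /enorm sqr_sqrtr// dotp_ge0. Qed.

Lemma enormZ a x : 0 <= a -> enorm (a *: x) = a * enorm x.
Proof.
by move=> a0; rewrite /enorm dotpZl dotpZr mulrA -expr2 sqrtrM ?sqr_ge0// sqrtr_sqr ger0_norm.
Qed.

End dotp.

Section dotp_cons.
Context (R : realType).
Lemma dotp_cons n (x y : 'rV[R]_n) (s t : R) :
  dotp (rV_cons (x, s)) (rV_cons (y, t)) = dotp x y + s * t.
Proof.
rewrite /dotp big_ord_recl /= !mxE unlift_none /= addrC; congr (_ + _).
by apply: eq_bigr => i _; rewrite !mxE liftK.
Qed.

Lemma dotp_rV0 (x y : 'rV[R]_0) : dotp x y = 0.
Proof. by rewrite /dotp big_ord0. Qed.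
End dotp_cons.

(* Only the values for [t > 0] are meaningful. *)
HB.lock Definition heat (R : realType) n (t : R) (x : 'rV[R]_n) : R :=
  (4 * pi * t) `^ (- (n%:R / 2)) * expR (- dotp x x / (4 * t)).

Section heat.
Context (R : realType).
Local Notation leb := (@lebesgue_measure R).
Local Notation mu n := (@lebesgue_rV R n).

Lemma measurable_fun_heat n d (T : measurableType d) (f : T -> R) (g : T -> 'rV[R]_n) :
  measurable_fun setT f -> measurable_fun setT g -> measurable_fun setT (fun x => heat (f x) (g x)).
Proof. by move=> mf mg; rewrite heat.unlock; meas. Qed.

Lemma heat_ge0 n t (x : 'rV[R]_n) : 0 <= heat t x.
Proof. by rewrite heat.unlock mulr_ge0 ?powR_ge0 ?expR_ge0. Qed.

Lemma heatN n t (x : 'rV[R]_n) : heat t (- x) = heat t x.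
Proof. by rewrite heat.unlock dotpNl dotpNr opprK. Qed.

Lemma heat_sym n t (x y : 'rV[R]_n) : heat t (x - y) = heat t (y - x).
Proof. by rewrite -heatN opprB. Qed.

Lemma integral_gauss_scale (e : R) : 0 < e ->
  (\int[leb]_x (expR (- e * x ^+ 2))%:E = (Num.sqrt (pi / e))%:E)%E.
Proof.
move=> e0; have se : 0 < Num.sqrt e by rewrite sqrtr_gt0.
have -> : (\int[leb]_x (expR (- e * x ^+ 2))%:E = \int[leb]_x (gauss_fun (Num.sqrt e * x + 0))%:E)%E.
  by apply: eq_integral => x _; rewrite addr0 /gauss_fun exprMn sqr_sqrtr ?ltW// mulNr.
rewrite (@ge0_integral_affine R _ _ (fun x => (gauss_fun x)%:E))//; last 2 first.
- by apply/measurable_EFinP; exact: measurable_gauss_fun.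
- by move=> x; rewrite lee_fin gauss_fun_ge0.
by rewrite integralT_gauss -EFinM sqrtrM ?pi_ge0// sqrtrV ?ltW// mulrC.
Qed.

Lemma integral_gauss_rV n (e : R) : 0 < e ->
  (\int[mu n]_x (expR (- e * dotp x x))%:E = ((pi / e) `^ (n%:R / 2))%:E)%E.
Proof.
move=> e0; have m k : measurable_fun setT (fun x : 'rV[R]_k => expR (- e * dotp x x)) by meas.
elim: n => [|n IH].
  rewrite ge0_integral_rV0; last by apply/measurable_EFinP; exact: m.
  by rewrite dotp_rV0 mulr0 expR0 mul0r powRr0.
rewrite ge0_integral_rVS; last 2 first.
- by apply/measurable_EFinP; exact: m.
- by move=> x; rewrite lee_fin expR_ge0.
under eq_integral => x _.
  under eq_integral do rewrite dotp_cons mulrDr expRD -expr2.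
  rewrite intZl; [|by meas|by move=> ?; exact: expR_ge0|exact: expR_ge0].
  rewrite integral_gauss_scale// -EFinM mulrC.
  over.
rewrite intZl; [|exact: m|by move=> ?; exact: expR_ge0|exact: sqrtr_ge0].
rewrite IH -EFinM -powR12_sqrt ?divr_ge0 ?pi_ge0 ?ltW// -powRD; last first.
  by rewrite gt_eqF ?divr_gt0 ?pi_gt0// implybT.
by rewrite -addn1 natrD; congr (_ `^ _)%:E; ring.
Qed.

Lemma heatE n t (x : 'rV[R]_n) :
  heat t x = (4 * pi * t) `^ (- (n%:R / 2)) * expR (- (4 * t)^-1 * dotp x x).
Proof. by rewrite heat.unlock; congr (_ * expR _); ring. Qed.

Lemma integral_heat n t : 0 < t -> (\int[mu n]_x (heat t x)%:E = 1)%E.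
Proof.
move=> t0; under eq_integral do rewrite heatE.
rewrite intZl; [|by meas|by move=> x; exact: expR_ge0|exact: powR_ge0].
rewrite integral_gauss_rV ?invr_gt0 ?mulr_gt0// invrK powRN -EFinM mulrC.
rewrite (_ : pi * (4 * t) = 4 * pi * t); last by ring.
by rewrite divff// gt_eqF// powR_gt0// !mulr_gt0// pi_gt0.
Qed.

Lemma integral_heat_sub n t (y : 'rV[R]_n) : 0 < t -> (\int[mu n]_x (heat t (x - y))%:E = 1)%E.
Proof.
move=> t0; have := @ge0_integral_rV_affine R n 1 (- y) (fun x => (heat t x)%:E) ltr01.
rewrite expr1n invr1 mul1e integral_heat// => <-.
- by apply: eq_integral => x _; rewrite scale1r.
- by apply/measurable_EFinP; apply: measurable_fun_heat; meas.
- by move=> x; rewrite lee_fin heat_ge0.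
Qed.

(** Completing the square in [z]: the product is a Gaussian in [z] around a weighted mean of [x] and
    [y], of total mass 1, times a factor free of [z]. *)
Lemma heatM n a b (x y z : 'rV[R]_n) : 0 < a -> 0 < b ->
  heat a (x - z) * heat b (z - y) =
  heat (a + b) (x - y) * heat (a * b / (a + b)) (z - ((b / (a + b)) *: x + (a / (a + b)) *: y)).
Proof.
move=> a0 b0; have ab0 : 0 < a + b by exact: addr_gt0.
have p0 := @pi_gt0 R.
rewrite heat.unlock mulrACA [RHS]mulrACA -!expRD; congr (_ * expR _).
  have h (c : R) : 0 < c -> 0 <= 4 * pi * c by move=> c0; apply/ltW; rewrite !mulr_gt0.
  rewrite -!powRM ?h ?divr_gt0 ?mulr_gt0//; congr (_ `^ _).
  by field; exact: lt0r_neq0.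
rewrite !(dotpDl, dotpDr, dotpNl, dotpNr, dotpZl, dotpZr) !(dotpC y) !(dotpC z).
by field; rewrite !lt0r_neq0.
Qed.

Lemma integral_heatM n a b (x y : 'rV[R]_n) : 0 < a -> 0 < b ->
  (\int[mu n]_z (heat a (x - z) * heat b (z - y))%:E = (heat (a + b) (x - y))%:E)%E.
Proof.
move=> a0 b0; under eq_integral do rewrite heatM//.
rewrite intZl ?heat_ge0//.
- by rewrite integral_heat_sub ?mule1// divr_gt0 ?mulr_gt0// addr_gt0.
- by apply: measurable_fun_heat; meas.
- by move=> z; exact: heat_ge0.
Qed.

Lemma expR_le_inv (z : R) : 0 <= z -> expR (- z) <= (1 + z)^-1.
Proof.
by move=> z0; rewrite expRN lef_pV2 ?posrE ?expR_gt0 ?ltr_pwDl// expR_ge1Dx.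
Qed.

(* Trading half of the exponent for a power of [dotp x x / t]. *)
Lemma heat_double n t (x : 'rV[R]_n) : 0 < t ->
  heat t x = 2 `^ (n%:R / 2) * expR (- dotp x x / (8 * t)) * heat (2 * t) x.
Proof.
move=> t0; have p0 := @pi_gt0 R; rewrite heat.unlock.
rewrite (_ : 4 * pi * (2 * t) = 2 * (4 * pi * t)); last by ring.
rewrite [(2 * _) `^ _]powRM ?mulr_ge0 ?ltW// powRN (powRN 2).
have h : 2 `^ (n%:R / 2) != 0 :> R by rewrite gt_eqF// powR_gt0.
have h' : (4 * pi * t) `^ (n%:R / 2) != 0 by rewrite gt_eqF// powR_gt0// !mulr_gt0.
have -> : expR (- dotp x x / (4 * t)) = expR (- dotp x x / (8 * t)) * expR (- dotp x x / (4 * (2 * t))).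
  by rewrite -expRD; congr expR; field; rewrite lt0r_neq0.
by field; rewrite h h'.
Qed.

(** [z * expR (- z) <= 1] at [z = dotp x x / (8 * t)], the half of the exponent split off by
    [heat_double]. *)
Lemma dotp_heat_le n t (x : 'rV[R]_n) : 0 < t ->
  dotp x x * heat t x <= 2 `^ (n%:R / 2) * 8 * t * heat (2 * t) x.
Proof.
move=> t0; rewrite heat_double// mulrA ler_wpM2r ?heat_ge0//.
rewrite mulrCA -!mulrA ler_wpM2l ?powR_ge0//.
have z0 : 0 <= dotp x x / (8 * t) by rewrite divr_ge0 ?dotp_ge0// mulr_ge0 ?ltW.
have := expR_le_inv z0; rewrite -mulNr => /(ler_wpM2l (dotp_ge0 x)) /le_trans; apply.
rewrite ler_pdivrMr ?ltr_pwDl// mulrDr mulr1.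
rewrite (_ : 8 * t * (dotp x x / (8 * t)) = dotp x x); last by field; rewrite lt0r_neq0.
by rewrite lerDr mulr_ge0 ?ltW.
Qed.

(** Away from the diagonal the heat kernel gains a factor [t], which makes its integral against
    [t^(-1-s)] converge at 0. *)
Lemma heat_far_le n t (x : 'rV[R]_n) r : 0 < t -> 0 < r -> r ^+ 2 <= dotp x x ->
  heat t x <= 2 `^ (n%:R / 2) * 8 / r ^+ 2 * t * heat (2 * t) x.
Proof.
move=> t0 r0 rx; have r20 : 0 < r ^+ 2 by exact: exprn_gt0.
rewrite -(ler_pM2l r20) (le_trans (ler_wpM2r (heat_ge0 _ _) rx))//.
apply: le_trans (dotp_heat_le _ t0) _.
rewrite le_eqVlt; apply/orP; left; apply/eqP; field; exact: lt0r_neq0.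
Qed.

Lemma heat_le n t (x : 'rV[R]_n) : 0 < t -> heat t x <= (4 * pi * t) `^ (- (n%:R / 2)).
Proof.
move=> t0; rewrite heat.unlock ler_piMr ?powR_ge0// -expR0 ler_expR.
by rewrite mulNr oppr_le0 divr_ge0 ?dotp_ge0// mulr_ge0 ?ltW.
Qed.

End heat.

(** * Fourier transform of Gaussians *)

Section integrable_tools.
Context d (T : measurableType d) (R : realType) (mu : {measure set T -> \bar R}).
Implicit Types f g : T -> R.

Lemma integrable_dom f g : measurable_fun setT f -> measurable_fun setT g ->
  (forall x, `|f x| <= g x) -> (\int[mu]_x (g x)%:E < +oo)%E -> mu.-integrable setT (EFin \o f).
Proof.
move=> mf mg fg gy; apply/integrableP; split; first exact/measurable_EFinP.
apply: le_lt_trans gy; apply: ge0_le_integral => //.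
- by apply/measurable_EFinP; exact: measurable_fun_normr.
- exact/measurable_EFinP.
- by move=> x _; rewrite lee_fin.
Qed.

Lemma integrable_mull f (r : R) : mu.-integrable setT (EFin \o f) ->
  mu.-integrable setT (EFin \o (fun x => r * f x)).
Proof.
move=> fi; rewrite (_ : EFin \o _ = (fun x => r%:E * (EFin \o f) x)%E)//.
exact: integrableZl.
Qed.

Lemma integrable_add f g : mu.-integrable setT (EFin \o f) -> mu.-integrable setT (EFin \o g) ->
  mu.-integrable setT (EFin \o (fun x => f x + g x)).
Proof.
move=> fi gi; rewrite (_ : EFin \o _ = (fun x => (EFin \o f) x + (EFin \o g) x)%E)//.
exact: integrableD.
Qed.

Lemma integrable_sub f g : mu.-integrable setT (EFin \o f) -> mu.-integrable setT (EFin \o g) ->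
  mu.-integrable setT (EFin \o (fun x => f x - g x)).
Proof.
move=> fi gi; rewrite (_ : EFin \o _ = (fun x => (EFin \o f) x - (EFin \o g) x)%E)//.
exact: integrableB.
Qed.

End integrable_tools.

Lemma cvg0_le_harmonic (R : realType) (u : R^nat) (K : R) : (forall n, `|u n| <= K * n.+1%:R^-1) ->
  u n @[n --> \oo] --> 0.
Proof.
move=> uK; apply: norm_cvg0.
apply: (@squeeze_cvgr _ _ _ _ (fun=> 0) (fun n => K * harmonic n)).
- by apply: nearW => n; rewrite normr_ge0 uK.
- exact: cvg_cst.
- by rewrite -(mulr0 K); apply: cvgM; [exact: cvg_cst|exact: cvg_harmonic].
Qed.

(** A crude decay of the Gaussian at the integers, enough to remove the boundary terms of an
    integration by parts. *)
Lemma expR_sqr_le_harmonic (R : realType) (e : R) (n : nat) : 0 < e ->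
  expR (- e * n%:R ^+ 2) <= 2 * (1 + e) / e * n.+1%:R^-1.
Proof.
move=> e0; rewrite mulNr; have n0 : 0 <= e * n%:R ^+ 2 by rewrite mulr_ge0 ?sqr_ge0 ?ltW.
apply: le_trans (expR_le_inv n0) _.
rewrite -[leRHS]invrK lef_pV2 ?posrE ?ltr_pwDl//; last first.
  by rewrite invr_gt0 !mulr_gt0 ?invr_gt0 ?addr_gt0.
have -> : (2 * (1 + e) / e / n.+1%:R)^-1 = (n%:R + 1) * e / (2 * (1 + e)).
  by rewrite -natr1; field; rewrite !lt0r_neq0// ltr_pwDr.
rewrite ler_pdivrMr ?mulr_gt0 ?addr_gt0//.
have := sqr_ge0 (n%:R - 1 : R); have : 0 <= n%:R :> R by []; nra.
Qed.

Section gauss_fourier.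
Context (R : realType).
Local Notation leb := (@lebesgue_measure R).
Implicit Types (e y th x : R).

(** On a symmetric interval the integral is a difference of boundary values; dominated convergence
    extends this to the line. *)
Lemma integral_derive_eq0 (g g' : R -> R) : (forall x, is_derive x 1 g (g' x)) -> continuous g' ->
  leb.-integrable setT (EFin \o g') ->
  g n%:R @[n --> \oo] --> 0 -> g (- n%:R) @[n --> \oo] --> 0 ->
  (\int[leb]_x (g' x)%:E = 0)%E.
Proof.
move=> dg cg ig g0 gN0.
pose D (n : nat) : set R := [set` `[- n.+1%:R, n.+1%:R]].
have mD n : measurable (D n : set (measurableTypeR R)) by exact: measurable_itv.
have mg' : measurable_fun setT g' by exact: continuous_measurable_fun.
have H1 : (\int[leb]_x ((g' \_ (D n)) x)%:E)%E @[n --> \oo] --> (\int[leb]_x (g' x)%:E)%E.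
  apply: (@dominated_cvg _ _ _ leb setT measurableT (fun n x => ((g' \_ (D n)) x)%:E) (EFin \o g') (fun x => `|(g' x)%:E|%E)) => //.
  - by move=> n; apply/measurable_EFinP; apply/(measurable_restrictT _ _).1 => //; exact: measurable_funTS.
  - move=> x _; apply: cvg_near_cst.
    exists (Num.truncn `|x|)%N => // n /= nx; rewrite patchE; have -> // : x \in D n.
    apply/mem_set; rewrite /D /= in_itv /= -ler_norml; apply: le_trans (ltW (truncnS_gt _)) _.
    by rewrite ler_nat ltnS.
  - exact: integrable_abse.
  - by move=> n x _; rewrite patchE; case: ifPn => // _; rewrite /= normr0 lee_fin.
have H2 n : (\int[leb]_x ((g' \_ (D n)) x)%:E = (g n.+1%:R)%:E - (g (- n.+1%:R))%:E)%E.
  rewrite -[LHS]/(\int[leb]_x ((EFin \o (g' \_ (D n))) x))%E -restrict_EFin.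
  rewrite -integral_mkcond (@continuous_FTC2 _ g' g)//.
  - by rewrite gtrN.
  - exact: continuous_subspaceT.
  - have c x : {for x, continuous g}.
      by apply/differentiable_continuous/derivable1_diffP; have [] := dg x.
    split; [by move=> x _; have [] := dg x|exact/cvg_at_right_filter/c|exact/cvg_at_left_filter/c].
  - by move=> x _; rewrite derive1E; have H := dg x; rewrite derive_val.
have H3 : ((g n.+1%:R)%:E - (g (- n.+1%:R))%:E)%E @[n --> \oo] --> (0 : \bar R).
  rewrite -(sube0 0%E); apply: cvgeB => //; apply: cvg_EFin; first exact: nearW.
  + by move: g0; rewrite -(cvg_shiftS (fun n => g n%:R)).
  + exact: nearW.
  + by move: gN0; rewrite -(cvg_shiftS (fun n => g (- n%:R))).
apply: (@cvg_unique _ _ _ _ _ _ H1) => //.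
by move: H3; apply: cvg_trans; apply: near_eq_cvg; apply: nearW => n; rewrite H2.
Qed.

(** Lets a factor [x] be absorbed by half of the Gaussian [expR (- e * x ^+ 2)]. *)
Lemma abs_le_expR e x : 0 < e -> `|x| <= (1 + e^-1) * expR (e / 2 * x ^+ 2).
Proof.
move=> e0; apply: (@le_trans _ _ ((1 + e^-1) * (1 + e / 2 * x ^+ 2))).
  have -> : (1 + e^-1) * (1 + e / 2 * x ^+ 2) = 1 + e^-1 + e / 2 * x ^+ 2 + x ^+ 2 / 2.
    by field; rewrite gt_eqF.
  have h1 : 0 < e^-1 by rewrite invr_gt0.
  have h2 : 0 <= e / 2 * x ^+ 2 by rewrite mulr_ge0 ?sqr_ge0// divr_ge0// ltW.
  rewrite -(real_normK (num_real x)) in h2 *.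
  have := sqr_ge0 (`|x| - 1); nra.
by rewrite ler_wpM2l ?expR_ge1Dx// addr_ge0// invr_ge0 ltW.
Qed.

Let F e th y x := expR (- e * x ^+ 2) * cos (y * x + th).
Let c e th y := \int[leb]_x (F e th y x).

Let dF e th y x : is_derive y 1 (fun y => F e th y x) (- x * expR (- e * x ^+ 2) * sin (y * x + th)).
Proof.
rewrite /F; apply: is_derive_eq.
by rewrite /GRing.scale /=; ring.
Qed.

Let dG e th y x : is_derive x 1 (fun x => expR (- e * x ^+ 2) * sin (y * x + th))
  (y * F e th y x + 2 * e * (- x * expR (- e * x ^+ 2) * sin (y * x + th))).
Proof.
rewrite /F; apply: is_derive_eq.
by rewrite /GRing.scale /=; ring.
Qed.

Lemma integrable_gauss_cos e th y : 0 < e -> leb.-integrable setT (EFin \o F e th y).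
Proof.
move=> e0; apply: (@integrable_dom _ _ R leb (F e th y) (fun x => expR (- e * x ^+ 2))).
- by rewrite /F; meas.
- by meas.
- by move=> x; rewrite /F normrM ger0_norm ?expR_ge0// ler_piMr ?expR_ge0// cos_max.
- by rewrite integral_gauss_scale// ltry.
Qed.

Let dom e th y x : 0 < e -> `|- x * expR (- e * x ^+ 2) * sin (y * x + th)| <=
   (1 + e^-1) * expR (- (e / 2) * x ^+ 2).
Proof.
move=> e0; rewrite !normrM normrN (ger0_norm (expR_ge0 _)).
apply: (@le_trans _ _ (`|x| * expR (- e * x ^+ 2))).
  by rewrite ler_piMr ?sin_max// mulr_ge0 ?expR_ge0.
apply: le_trans (ler_wpM2r (expR_ge0 _) (abs_le_expR x e0)) _.
by rewrite -[leLHS]mulrA -expRD le_eqVlt; apply/orP; left; apply/eqP; congr (_ * expR _); field.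
Qed.

(** As a function of [y] the integral solves [c' = - (y / (2 * e)) * c]: differentiate under the
    integral sign, then integrate by parts. The phase [th] covers cosine and sine together and takes
    up the other coordinates in the induction on the dimension. *)
Lemma integral_gauss_cos e th y : 0 < e ->
  \int[leb]_x (expR (- e * x ^+ 2) * cos (y * x + th)) =
  Num.sqrt (pi / e) * expR (- y ^+ 2 / (4 * e)) * cos th.
Proof.
move=> e0.
have e20 : 0 < e / 2 by rewrite divr_gt0.
pose G x := (1 + e^-1) * expR (- (e / 2) * x ^+ 2).
have G0 x : 0 <= G x by rewrite mulr_ge0 ?expR_ge0// addr_ge0// invr_ge0 ltW.
have Gy : (\int[leb]_x (G x)%:E < +oo)%E.
  rewrite /G intZl; [|by meas|by move=> x; exact: expR_ge0|by rewrite addr_ge0// invr_ge0 ltW].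
  by rewrite integral_gauss_scale// -EFinM ltry.
have iG : leb.-integrable setT (EFin \o G).
  by apply: ge0_integral_Rintegral => //; rewrite /G; meas.
have parts y0 : \int[leb]_x (- x * expR (- e * x ^+ 2) * sin (y0 * x + th)) = - (y0 / (2 * e)) * c e th y0.
  have iS : leb.-integrable setT (EFin \o (fun x => - x * expR (- e * x ^+ 2) * sin (y0 * x + th))).
    apply: (@integrable_dom _ _ R leb _ G) => //; [by meas|by rewrite /G; meas|by move=> x; exact: dom].
  have iF := @integrable_gauss_cos e th y0 e0.
  have bd (z : R) (n : nat) : z ^+ 2 = n%:R ^+ 2 ->
      `|expR (- e * z ^+ 2) * sin (y0 * z + th)| <= 2 * (1 + e) / e * n.+1%:R^-1.
    move=> zn; apply: le_trans (expR_sqr_le_harmonic n e0).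
    by rewrite normrM ger0_norm ?expR_ge0// zn ler_piMr ?expR_ge0// sin_max.
  pose H x := y0 * F e th y0 x + 2 * e * (- x * expR (- e * x ^+ 2) * sin (y0 * x + th)).
  have iH : leb.-integrable setT (EFin \o H).
    by apply: (@integrable_add _ _ _ leb); exact: integrable_mull.
  have cH : continuous H.
    by move=> x; rewrite /H /F; apply: differentiable_continuous; apply/derivable1_diffP; apply: ex_derive.
  have h : (\int[leb]_x (H x)%:E = 0)%E.
    apply: (@integral_derive_eq0 _ H (dG e th y0) cH iH).
      by apply: cvg0_le_harmonic => n; exact: bd.
    by apply: cvg0_le_harmonic => n; apply: bd; rewrite sqrrN.
  have {h} : \int[leb]_x H x = 0 by rewrite /Rintegral h.
  rewrite RintegralD//; [|exact: integrable_mull..].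
  rewrite !RintegralZl// -/(c e th y0) => h.
  apply/eqP; rewrite -subr_eq0; apply/eqP.
  apply: (@mulfI _ (2 * e)); first by rewrite mulf_neq0// gt_eqF.
  rewrite mulr0 -[RHS]h; field; exact: lt0r_neq0.
have dc y0 : is_derive y0 1 (c e th) (- (y0 / (2 * e)) * c e th y0).
  have d1E z x : partial1of2 (F e th) z x = - x * expR (- e * x ^+ 2) * sin (z * x + th).
    by rewrite partial1of2E; have H := dF e th z x; rewrite derive_val.
  have Iy : `]y0 - 1, y0 + 1[%classic y0 by rewrite /= in_itv /= ltrDl ltr01 gtrDl ltrN10.
  have iF (z : R) : `]y0 - 1, y0 + 1[%classic z -> leb.-integrable setT (EFin \o F e th z).
    by move=> _; exact: integrable_gauss_cos.
  have dF' (z x : R) : `]y0 - 1, y0 + 1[%classic z -> setT x -> derivable ((F e th)^~ x) z 1.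
    by move=> _ _; have [] := dF e th z x.
  have Gub (z x : R) : `]y0 - 1, y0 + 1[%classic z -> setT x -> `|partial1of2 (F e th) z x| <= G x.
    by move=> _ _; rewrite d1E; exact: dom.
  have D1 := @derivable_under_integral R _ _ leb (F e th) setT measurableT y0 _ _ Iy iF dF' G G0 iG Gub.
  have D2 := @differentiation_under_integral R _ _ leb (F e th) setT measurableT y0 _ _ Iy iF dF' G G0 iG Gub.
  apply: DeriveDef => //; rewrite -derive1E D2 -parts.
  by apply: eq_Rintegral => x _; exact: d1E.
(* Times the integrating factor the solution has derivative 0, so it equals its value at [y = 0]. *)
have q y0 : is_derive y0 1 (fun y => c e th y * expR (y ^+ 2 / (4 * e))) 0.
  have H := dc y0; apply: is_derive_eq.
  rewrite /GRing.scale /=; field; exact: lt0r_neq0.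
have := @is_derive_0_is_cst _ _ y 0 q.
rewrite expr0n mul0r expR0 mulr1 => h.
have c0 : c e th 0 = Num.sqrt (pi / e) * cos th.
  rewrite /c /F; under eq_Rintegral do rewrite mul0r add0r.
  rewrite RintegralZr//.
    by rewrite /Rintegral integral_gauss_scale.
  apply: ge0_integral_Rintegral; [by meas|by move=> x; exact: expR_ge0|].
  by rewrite integral_gauss_scale// ltry.
rewrite -[LHS]/(c e th y) mulrAC -c0 -h -mulrA -expRD.
by rewrite -mulrDl subrr mul0r expR0 mulr1.
Qed.

End gauss_fourier.

Section integral_rV_fubini.
Context (R : realType).
Local Notation leb := (@lebesgue_measure R).
Local Notation mu n := (@lebesgue_rV R n).

Lemma integral_rVS n (f : 'rV[R]_n.+1 -> R) : (mu n.+1).-integrable setT (EFin \o f) ->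
  (\int[mu n.+1]_x (f x)%:E = \int[mu n]_x \int[leb]_t (f (rV_cons (x, t)))%:E)%E.
Proof.
move=> fi; have /integrableP[mf fy] := fi.
have fi' : (mu n \x leb)%E.-integrable setT (EFin \o f \o @rV_cons R n).
  apply/integrableP; split; first exact: measurableT_comp mf (@measurable_rV_cons R n).
  apply: le_lt_trans fy; rewrite /lebesgue_rV /= /lebesgue_succ ge0_integral_pushforward//.
  - exact: measurable_rV_cons.
  - by apply/measurable_EFinP/measurable_fun_normr/measurable_EFinP.
transitivity (\int[mu n \x leb]_z ((EFin \o f) \o @rV_cons R n) z)%E.
  rewrite /lebesgue_rV /= /lebesgue_succ integral_pushforward//; exact: measurable_rV_cons.
by rewrite -(integral12_prod_meas1 fi').
Qed.

Lemma integrable_gauss_cos_rV n e (y : 'rV[R]_n) th : 0 < e ->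
  (mu n).-integrable setT (EFin \o (fun x => expR (- e * dotp x x) * cos (dotp y x + th))).
Proof.
move=> e0; apply: (@integrable_dom _ _ R (mu n) _ (fun x => expR (- e * dotp x x))).
- by meas.
- by meas.
- by move=> x; rewrite normrM ger0_norm ?expR_ge0// ler_piMr ?expR_ge0// cos_max.
- by rewrite integral_gauss_rV// ltry.
Qed.

Lemma integral_gauss_cos_rV n e (y : 'rV[R]_n) th : 0 < e ->
  \int[mu n]_x (expR (- e * dotp x x) * cos (dotp y x + th)) =
  (pi / e) `^ (n%:R / 2) * expR (- dotp y y / (4 * e)) * cos th.
Proof.
move=> e0; elim: n y th => [|n IH] y th.
  rewrite /Rintegral ge0_integral_rV0; last by apply/measurable_EFinP; meas.
  by rewrite !dotp_rV0 mulr0 !mul0r powRr0 oppr0 mul0r expR0 add0r !mul1r.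
have -> : y = rV_cons (rV_uncons y) by rewrite rV_unconsK.
case: (rV_uncons y) => y1 y2.
rewrite /Rintegral integral_rVS; last exact: integrable_gauss_cos_rV.
pose K := Num.sqrt (pi / e) * expR (- y2 ^+ 2 / (4 * e)).
(* For fixed [x] this is the one-dimensional integral with phase [dotp y1 x + th]. *)
have inner x : (\int[leb]_t (expR (- e * dotp (rV_cons (x, t)) (rV_cons (x, t))) *
     cos (dotp (rV_cons (y1, y2)) (rV_cons (x, t)) + th))%:E =
     (K * (expR (- e * dotp x x) * cos (dotp y1 x + th)))%:E)%E.
  have i1 := @integrable_gauss_cos R e (dotp y1 x + th) y2 e0.
  have := @integral_gauss_cos R e (dotp y1 x + th) y2 e0.
  rewrite /Rintegral => h; have {}h := congr1 EFin h; move: h; rewrite fineK; last exact: integrable_fin_num.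
  move=> h; transitivity ((expR (- e * dotp x x))%:E * \int[leb]_t (expR (- e * t ^+ 2) * cos (y2 * t + (dotp y1 x + th)))%:E)%E.
    rewrite -integralZl//; apply: eq_integral => t _; rewrite !dotp_cons mulrDr expRD -EFinM -expr2 -mulrA.
    by congr (_ * (_ * cos _))%:E; ring.
  by rewrite h -EFinM /K; congr EFin; ring.
under eq_integral do rewrite inner.
rewrite -[LHS]/(\int[mu n]_x (K * (expR (- e * dotp x x) * cos (dotp y1 x + th)))).
rewrite RintegralZl//; last exact: integrable_gauss_cos_rV.
rewrite IH dotp_cons /K -powR12_sqrt ?divr_ge0 ?pi_ge0 ?ltW//.
have -> : (pi / e) `^ (n.+1%:R / 2) = (pi / e) `^ (n%:R / 2) * (pi / e) `^ 2^-1.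
  rewrite -powRD ?gt_eqF ?divr_gt0 ?pi_gt0 ?implybT//.
  by rewrite -natr1; congr (_ `^ _); ring.
have -> : - (dotp y1 y1 + y2 * y2) / (4 * e) = - dotp y1 y1 / (4 * e) + - y2 ^+ 2 / (4 * e) by ring.
by rewrite expRD; ring.
Qed.

Lemma heat_fourier n e (y : 'rV[R]_n) th : 0 < e ->
  \int[mu n]_x (expR (- e * dotp x x) * cos (dotp y x + th)) =
  (2 * pi) ^+ n * heat e y * cos th.
Proof.
move=> e0; have p0 := @pi_gt0 R; rewrite integral_gauss_cos_rV// heat.unlock; congr (_ * _); rewrite mulrA; congr (_ * _).
have -> : (2 * pi : R) ^+ n = ((2 * pi) ^+ 2) `^ (n%:R / 2).
  rewrite -!powR_mulrn ?mulr_ge0 ?ltW// -powRrM; congr (_ `^ _); by field.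
have -> : (2 * pi : R) ^+ 2 = (pi / e) * (4 * pi * e) by field; exact: lt0r_neq0.
have h : 0 < 4 * pi * e by rewrite !mulr_gt0.
have h' : 0 < pi / e by rewrite divr_gt0.
rewrite (powRM _ (ltW h') (ltW h)) powRN mulfK//.
by rewrite gt_eqF// powR_gt0.
Qed.

End integral_rV_fubini.

(** * The heat semigroup *)

(** Integrability is not assumed: the positive and negative parts are measurable by Tonelli and are
    recombined, whatever value the integral takes. *)
Lemma measurable_Rintegral d1 d2 (T1 : measurableType d1) (T2 : measurableType d2) (R : realType)
  (m2 : {sigma_finite_measure set T2 -> \bar R}) (k : T1 -> T2 -> R) :
  measurable_fun setT (fun z : T1 * T2 => k z.1 z.2) ->
  measurable_fun setT (fun x => \int[m2]_y (k x y)).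
Proof.
move=> mk; pose F := fun z : T1 * T2 => (k z.1 z.2)%:E.
have mF : measurable_fun setT F by exact/measurable_EFinP.
apply: measurableT_comp => //=.
rewrite (_ : (fun x => _) = (fun x => fubini_F m2 F^\+ x - fubini_F m2 F^\- x)%E); last first.
  apply/funext => x; rewrite [LHS]integralE /fubini_F.
  by congr (_ - _)%E; apply: eq_integral => y _; rewrite ?funeposE ?funenegE.
apply: emeasurable_funB; apply: measurable_fun_fubini_tonelli_F => //.
- exact: measurable_funepos.
- exact: measurable_funeneg.
Qed.

Section Rintegral_tools.
Context d1 d2 (T1 : measurableType d1) (T2 : measurableType d2) (R : realType).
Variable m1 : {sigma_finite_measure set T1 -> \bar R}.
Variable m2 : {sigma_finite_measure set T2 -> \bar R}.

Lemma EFin_Rintegral d (T : measurableType d) (mu : {measure set T -> \bar R}) (f : T -> R) :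
  mu.-integrable setT (EFin \o f) -> (\int[mu]_x f x)%:E = (\int[mu]_x (f x)%:E)%E.
Proof. by move=> fi; rewrite /Rintegral fineK//; exact: integrable_fin_num. Qed.

Lemma Rintegral_swap (k : T1 -> T2 -> R) :
  measurable_fun setT (fun z : T1 * T2 => k z.1 z.2) ->
  (forall x, m2.-integrable setT (EFin \o k x)) ->
  (forall y, m1.-integrable setT (EFin \o (k ^~ y))) ->
  (\int[m1]_x \int[m2]_y (`|k x y|)%:E < +oo)%E ->
  \int[m1]_x \int[m2]_y k x y = \int[m2]_y \int[m1]_x k x y.
Proof.
move=> mk i2 i1 ky.
have ki : (m1 \x m2)%E.-integrable setT (EFin \o (fun z : T1 * T2 => k z.1 z.2)).
  apply/integrableP; split; first exact/measurable_EFinP.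
  rewrite (_ : (\int[_]_x _)%E = (\int[m1]_x \int[m2]_y (`|k x y|)%:E)%E)//.
  by rewrite -(@tonelli_prod _ _ _ _ _ m1 m2 (fun x y => `|k x y|))//; exact: measurable_fun_normr.
have := Fubini ki => /(congr1 fine) /=.
rewrite /Rintegral; congr (_ = _); congr fine; apply: eq_integral => x _; rewrite -EFin_Rintegral//.
Qed.

End Rintegral_tools.

Section heat_semigroup.
Context (R : realType) (n : nat).
Local Notation mu := (@lebesgue_rV R n).
Implicit Types (g h v : 'rV[R]_n -> R).

Definition L2 g := measurable_fun setT g /\ (\int[mu]_x (g x ^+ 2)%:E < +oo)%E.

Definition sqnorm g : R := \int[mu]_x (g x ^+ 2).

Definition heatop (t : R) g x : R := \int[mu]_y (heat t (x - y) * g y).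

Lemma L2_integrable_sqr g : L2 g -> mu.-integrable setT (EFin \o (fun x => g x ^+ 2)).
Proof. by move=> [mg gy]; apply: ge0_integral_Rintegral => //; [meas|move=> x; exact: sqr_ge0]. Qed.

Lemma sqnormE g : L2 g -> (\int[mu]_x (g x ^+ 2)%:E = (sqnorm g)%:E)%E.
Proof. by move=> gL; rewrite /sqnorm EFin_Rintegral//; exact: L2_integrable_sqr. Qed.

Lemma sqnorm_ge0 g : 0 <= sqnorm g.
Proof. by apply: Rintegral_ge0 => x _; exact: sqr_ge0. Qed.

Lemma L2_integrable_mul g h : L2 g -> L2 h -> mu.-integrable setT (EFin \o (fun x => g x * h x)).
Proof.
move=> [mg gy] [mh hy]; apply: (@integrable_dom _ _ R mu _ (fun x => g x ^+ 2 + h x ^+ 2)); [by meas|by meas| |].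
  move=> x; rewrite normrM -(real_normK (num_real (g x))) -(real_normK (num_real (h x))).
  have := sqr_ge0 (`|g x| - `|h x|); have := normr_ge0 (g x); have := normr_ge0 (h x); nra.
by rewrite intD; [exact: lte_add_pinfty|by meas|by meas|by move=> x; exact: sqr_ge0..].
Qed.

Lemma measurable_heatop2 d (T : measurableType d) (f : T -> R) (g' : T -> 'rV[R]_n) g :
  measurable_fun setT g -> measurable_fun setT f -> measurable_fun setT g' ->
  measurable_fun setT (fun x => heatop (f x) g (g' x)).
Proof.
move=> mg mf mg'; rewrite /heatop.
apply: (@measurable_Rintegral _ _ T _ _ mu (fun x y => heat (f x) (g' x - y) * g y)).
by apply: measurable_funM; [apply: measurable_fun_heat; meas|meas].
Qed.

Lemma measurable_heatop t g : measurable_fun setT g -> measurable_fun setT (heatop t g).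
Proof. by move=> mg; apply: measurable_heatop2 => //; meas. Qed.

Let mheat t (x : 'rV[R]_n) : measurable_fun setT (fun y : 'rV[R]_n => heat t (x - y)).
Proof. by apply: measurable_fun_heat; meas. Qed.

Let mheat2 t : measurable_fun setT (fun z : 'rV[R]_n * 'rV[R]_n => heat t (z.1 - z.2)).
Proof. by apply: measurable_fun_heat; meas. Qed.

Lemma integral_heat_sub' t (x : 'rV[R]_n) : 0 < t -> (\int[mu]_y (heat t (x - y))%:E = 1)%E.
Proof. by move=> t0; under eq_integral do rewrite heat_sym; exact: integral_heat_sub. Qed.

(** The kernel is integrable and bounded by [K], and [|g| <= 1 + g ^+ 2]; hence the convolution
    converges at every point and not merely almost everywhere. *)
Lemma heatop_integrable t g x : 0 < t -> L2 g ->
  mu.-integrable setT (EFin \o (fun y => heat t (x - y) * g y)).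
Proof.
move=> t0 [mg gy]; pose K := (4 * pi * t) `^ (- (n%:R / 2)).
apply: (@integrable_dom _ _ R mu _ (fun y => heat t (x - y) + K * g y ^+ 2)); [by meas|by meas| |].
  move=> y; rewrite normrM ger0_norm ?heat_ge0//.
  have h0 := heat_ge0 t (x - y); have := heat_le (x - y) t0; rewrite -/K => hK.
  rewrite -(real_normK (num_real (g y))).
  have := sqr_ge0 (`|g y| - 1); have := normr_ge0 (g y) => n0 n1.
  apply: (@le_trans _ _ (heat t (x - y) * (1 + `|g y| ^+ 2))); first by rewrite ler_wpM2l//; nra.
  by rewrite mulrDr mulr1 lerD2l ler_wpM2r// sqr_ge0.
rewrite intD; [|exact: mheat|by meas|by move=> y; exact: heat_ge0|].
  rewrite integral_heat_sub'// intZl; [|by meas|by move=> y; exact: sqr_ge0|exact: powR_ge0].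
  by apply: lte_add_pinfty; rewrite ?ltry// lte_mul_pinfty// lee_fin powR_ge0.
by move=> y; rewrite mulr_ge0 ?sqr_ge0 ?powR_ge0.
Qed.

Lemma heatop_sqr_integrable t g x : 0 < t -> L2 g ->
  mu.-integrable setT (EFin \o (fun y => heat t (x - y) * g y ^+ 2)).
Proof.
move=> t0 [mg gy]; pose K := (4 * pi * t) `^ (- (n%:R / 2)).
apply: (@integrable_dom _ _ R mu _ (fun y => K * g y ^+ 2)); [by meas|by meas| |].
  move=> y; rewrite ger0_norm; last by apply: mulr_ge0; [exact: heat_ge0|exact: sqr_ge0].
  by apply: ler_wpM2r; [exact: sqr_ge0|exact: heat_le].
rewrite intZl; [|by meas|by move=> y; exact: sqr_ge0|exact: powR_ge0].
by rewrite lte_mul_pinfty// lee_fin powR_ge0.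
Qed.

Lemma integral_heat_conv t (f : 'rV[R]_n -> R) : 0 < t -> measurable_fun setT f -> (forall x, 0 <= f x) ->
  (\int[mu]_x \int[mu]_y (heat t (x - y) * f y)%:E = \int[mu]_y (f y)%:E)%E.
Proof.
move=> t0 mf f0.
rewrite (@tonelli _ _ _ _ _ mu mu (fun x y => heat t (x - y) * f y)); last 2 first.
- by apply: measurable_funM; [exact: mheat2|meas].
- by move=> x y; rewrite mulr_ge0 ?heat_ge0.
apply: eq_integral => y _; under eq_integral do rewrite mulrC.
rewrite intZl; [|by apply: measurable_fun_heat; meas|by move=> ?; exact: heat_ge0|exact: f0].
by rewrite integral_heat_sub// mule1.
Qed.

(** Jensen for the probability density [heat t (x - y)], obtained from Cauchy-Schwarz by splitting
    the kernel into two square roots. *)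
Lemma heatop_sqr_le t g x : 0 < t -> L2 g ->
  heatop t g x ^+ 2 <= \int[mu]_y (heat t (x - y) * g y ^+ 2).
Proof.
move=> t0 gL; have [mg gy] := gL.
have i1 := heatop_integrable x t0 gL; have i2 := heatop_sqr_integrable x t0 gL.
rewrite -lee_fin (EFin_Rintegral i2) -(real_normK (num_real _)).
apply: (@le_trans _ _ ((\int[mu]_y (heat t (x - y) * `|g y|)%:E) * (\int[mu]_y (heat t (x - y) * `|g y|)%:E)))%E.
  have h : (`|heatop t g x|%:E <= \int[mu]_y (heat t (x - y) * `|g y|)%:E)%E.
    rewrite EFin_normr_Rintegral//; apply: le_trans (le_abse_integral _ _ _) _ => //.
      by apply/measurable_EFinP; meas.
    apply: ge0_le_integral => //=.
    + by apply/measurable_EFinP/measurable_fun_normr; meas.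
    + by apply/measurable_EFinP; meas.
    + by move=> y _; rewrite normrM ger0_norm ?heat_ge0.
  by rewrite expr2 EFinM lee_pmul// lee_fin.
have := @cauchy_schwarz _ _ R mu (fun y => Num.sqrt (heat t (x - y))) (fun y => Num.sqrt (heat t (x - y)) * `|g y|).
have sq y : Num.sqrt (heat t (x - y)) * Num.sqrt (heat t (x - y)) = heat t (x - y).
  by rewrite -expr2 sqr_sqrtr// heat_ge0.
have e1 : (\int[mu]_y (Num.sqrt (heat t (x - y)) ^+ 2)%:E = 1)%E.
  by rewrite -(integral_heat_sub' x t0); apply: eq_integral => y _; rewrite expr2 sq.
have e2 : (\int[mu]_y ((Num.sqrt (heat t (x - y)) * `|g y|) ^+ 2)%:E = \int[mu]_y (heat t (x - y) * g y ^+ 2)%:E)%E.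
  by apply: eq_integral => y _; rewrite exprMn expr2 sq (real_normK (num_real _)).
have e3 : (\int[mu]_y (Num.sqrt (heat t (x - y)) * (Num.sqrt (heat t (x - y)) * `|g y|))%:E =
    \int[mu]_y (heat t (x - y) * `|g y|)%:E)%E.
  by apply: eq_integral => y _; rewrite mulrA sq.
rewrite e1 e2 e3 mul1e; apply; [by have := mheat t x => ?; meas|by have := mheat t x => ?; meas|by move=> y; exact: sqrtr_ge0|].
by move=> y; rewrite mulr_ge0 ?sqrtr_ge0.
Qed.

Lemma heatop_L2 t g : 0 < t -> L2 g -> L2 (heatop t g).
Proof.
move=> t0 gL; have [mg gy] := gL; split; first exact: measurable_heatop.
apply: le_lt_trans gy; rewrite -(@integral_heat_conv t (fun y => g y ^+ 2))//; [|by meas|by move=> x; exact: sqr_ge0].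
apply: ge0_le_integral => //.
- by move=> x _; rewrite lee_fin sqr_ge0.
- by apply/measurable_EFinP; have := measurable_heatop t mg => ?; meas.
- apply: (@measurable_int2 _ _ 'rV[R]_n _ _ mu (fun x y => heat t (x - y) * g y ^+ 2)).
    by apply: measurable_funM; [exact: mheat2|meas].
  by move=> x y; rewrite mulr_ge0 ?heat_ge0 ?sqr_ge0.
- move=> x _; rewrite -EFin_Rintegral; last exact: heatop_sqr_integrable.
  by rewrite lee_fin heatop_sqr_le.
Qed.

Lemma heatop_form_lty t g h : 0 < t -> L2 g -> L2 h ->
  (\int[mu]_x \int[mu]_y (`|heat t (x - y) * (g x * h y)|)%:E < +oo)%E.
Proof.
move=> t0 [mg gy] [mh hy].
have mF : measurable_fun setT (fun z : 'rV[R]_n * 'rV[R]_n => `|heat t (z.1 - z.2) * (g z.1 * h z.2)|).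
  by apply: measurable_fun_normr; apply: measurable_funM; [exact: mheat2|meas].
have mG : measurable_fun setT (fun z : 'rV[R]_n * 'rV[R]_n => heat t (z.1 - z.2) * g z.1 ^+ 2).
  by apply: measurable_funM; [exact: mheat2|meas].
have mH : measurable_fun setT (fun z : 'rV[R]_n * 'rV[R]_n => heat t (z.1 - z.2) * h z.2 ^+ 2).
  by apply: measurable_funM; [exact: mheat2|meas].
have G0 x y : 0 <= heat t (x - y) * g x ^+ 2 by rewrite mulr_ge0 ?heat_ge0 ?sqr_ge0.
have H0 x y : 0 <= heat t (x - y) * h y ^+ 2 by rewrite mulr_ge0 ?heat_ge0 ?sqr_ge0.
apply: (@le_lt_trans _ _ (\int[mu]_x \int[mu]_y (heat t (x - y) * g x ^+ 2)%:E + \int[mu]_x \int[mu]_y (heat t (x - y) * h y ^+ 2)%:E)%E).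
  rewrite -(@tonelli_prod _ _ _ _ _ mu mu (fun x y => `|heat t (x - y) * (g x * h y)|))//.
  rewrite -(@tonelli_prod _ _ _ _ _ mu mu (fun x y => heat t (x - y) * g x ^+ 2))//.
  rewrite -(@tonelli_prod _ _ _ _ _ mu mu (fun x y => heat t (x - y) * h y ^+ 2))//.
  rewrite -intD//; apply: le_int => //; first exact: measurable_funD.
  move=> z; rewrite normrM ger0_norm ?heat_ge0// -mulrDr ler_wpM2l ?heat_ge0// normrM.
  rewrite -(real_normK (num_real (g _))) -(real_normK (num_real (h _))).
  have := sqr_ge0 (`|g z.1| - `|h z.2|); have := normr_ge0 (g z.1); have := normr_ge0 (h z.2); nra.
rewrite integral_heat_conv//; [|by meas|by move=> x; exact: sqr_ge0].
rewrite lte_add_pinfty//; apply: le_lt_trans gy; rewrite le_eqVlt; apply/orP; left; apply/eqP.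
apply: eq_integral => x _; under eq_integral do rewrite mulrC.
rewrite intZl; [|exact: mheat|by move=> ?; exact: heat_ge0|exact: sqr_ge0].
by rewrite integral_heat_sub'// mule1.
Qed.

(** Fubini and the symmetry of the kernel; [heatop_form_lty] supplies absolute convergence. *)
Lemma heatop_sym t g h : 0 < t -> L2 g -> L2 h ->
  \int[mu]_x (g x * heatop t h x) = \int[mu]_x (heatop t g x * h x).
Proof.
move=> t0 gL hL; have [mg gy] := gL; have [mh hy] := hL.
transitivity (\int[mu]_x \int[mu]_y (heat t (x - y) * (g x * h y))).
  apply: eq_Rintegral => x _; rewrite /heatop -RintegralZl//; last exact: heatop_integrable.
  by apply: eq_Rintegral => y _; ring.
rewrite Rintegral_swap//.
- apply: eq_Rintegral => y _; rewrite /heatop -RintegralZr//; last exact: heatop_integrable.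
  by apply: eq_Rintegral => x _; rewrite heat_sym; ring.
- by apply: measurable_funM; [exact: mheat2|meas].
- move=> x; rewrite (_ : _ \o _ = EFin \o (fun y => g x * (heat t (x - y) * h y))).
    by apply: integrable_mull; exact: heatop_integrable.
  by apply/funext => y /=; congr EFin; ring.
- move=> y; rewrite (_ : _ \o _ = EFin \o (fun x => h y * (heat t (y - x) * g x))).
    by apply: integrable_mull; exact: heatop_integrable.
  by apply/funext => x /=; rewrite heat_sym; congr EFin; ring.
- exact: heatop_form_lty.
Qed.

Lemma heatop_semigroup a b g x : 0 < a -> 0 < b -> L2 g ->
  heatop a (heatop b g) x = heatop (a + b) g x.
Proof.
move=> a0 b0 gL; have [mg gy] := gL; have ab0 : 0 < a + b by exact: addr_gt0.
have mk : measurable_fun setT (fun z : 'rV[R]_n * 'rV[R]_n => heat a (x - z.1) * (heat b (z.1 - z.2) * g z.2)).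
  by apply: measurable_funM; [apply: measurable_fun_heat; meas|apply: measurable_funM; [exact: mheat2|meas]].
transitivity (\int[mu]_z \int[mu]_y (heat a (x - z) * (heat b (z - y) * g y))).
  by apply: eq_Rintegral => z _; rewrite /heatop -RintegralZl//; exact: heatop_integrable.
have iz y : mu.-integrable setT (EFin \o (fun z => heat a (x - z) * heat b (z - y))).
  apply: ge0_integral_Rintegral; [by apply: measurable_funM; apply: measurable_fun_heat; meas|
     by move=> z; rewrite mulr_ge0 ?heat_ge0|].
  by rewrite integral_heatM// ltry.
have iz' y : \int[mu]_z (heat a (x - z) * heat b (z - y)) = heat (a + b) (x - y).
  by rewrite /Rintegral integral_heatM.
rewrite Rintegral_swap//.
- apply: eq_Rintegral => y _; rewrite -iz' -RintegralZr//.
  by apply: eq_Rintegral => z _; rewrite mulrA.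
- by move=> z; apply: integrable_mull; exact: heatop_integrable.
- move=> y; rewrite (_ : _ \o _ = EFin \o (fun z => g y * (heat a (x - z) * heat b (z - y)))).
    exact: integrable_mull.
  by apply/funext => z /=; congr EFin; ring.
- rewrite (@tonelli _ _ _ _ _ mu mu (fun z y => `|heat a (x - z) * (heat b (z - y) * g y)|))//; last first.
    exact: measurable_fun_normr.
  have gL' : L2 (fun y => `|g y|).
    by split; [meas|under eq_integral do rewrite (real_normK (num_real _))].
  have /integrableP[_] := heatop_integrable x ab0 gL'.
  apply: le_lt_trans; rewrite le_eqVlt; apply/orP; left; apply/eqP; apply: eq_integral => y _.
  have -> : (`|(EFin \o (fun y => heat (a + b) (x - y) * `|g y|)%R) y| = (`|g y| * heat (a + b) (x - y))%:E)%E.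
    by rewrite /= ger0_norm ?mulr_ge0 ?heat_ge0// mulrC.
  rewrite -iz' EFinM EFin_Rintegral//.
  rewrite -intZl; [|by apply: measurable_funM; apply: measurable_fun_heat; meas|
     by move=> z; rewrite mulr_ge0 ?heat_ge0|exact: normr_ge0].
  by apply: eq_integral => z _; rewrite !normrM !(ger0_norm (heat_ge0 _ _)); congr EFin; ring.
Qed.

(** The flow up to time [t] is the square of the self-adjoint flow up to time [t / 2]. *)
Lemma heatop_form t g : 0 < t -> L2 g ->
  \int[mu]_x (g x * heatop t g x) = sqnorm (heatop (t / 2) g).
Proof.
move=> t0 gL; have t20 : 0 < t / 2 by rewrite divr_gt0.
transitivity (\int[mu]_x (heatop (t / 2) g x * heatop (t / 2) g x)); last first.
  by apply: eq_Rintegral => x _; rewrite expr2.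
rewrite -(heatop_sym t20 gL (heatop_L2 t20 gL)).
by apply: eq_Rintegral => x _; rewrite (heatop_semigroup x t20 t20 gL) -splitr.
Qed.

(** Expand the square: the kernel has mass 1 in each variable, and the cross term is given by
    [heatop_form]. *)
Lemma heat_energyE t g : 0 < t -> L2 g ->
  (\int[mu]_x \int[mu]_y (heat t (x - y) * (g x - g y) ^+ 2)%:E =
   (2 * (sqnorm g - sqnorm (heatop (t / 2) g)))%:E)%E.
Proof.
move=> t0 gL; have [mg gy] := gL.
pose q x := \int[mu]_y (heat t (x - y) * g y ^+ 2).
have ih x : mu.-integrable setT (EFin \o (fun y => heat t (x - y))).
  apply: ge0_integral_Rintegral; [exact: mheat|by move=> y; exact: heat_ge0|by rewrite integral_heat_sub'// ltry].
have ih1 x : \int[mu]_y heat t (x - y) = 1 by rewrite /Rintegral integral_heat_sub'.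
have inner x : (\int[mu]_y (heat t (x - y) * (g x - g y) ^+ 2)%:E =
  (g x ^+ 2 + q x - 2 * (g x * heatop t g x))%:E)%E.
  have i1 := @integrable_mull _ _ R mu _ (g x ^+ 2) (ih x).
  have i2 := heatop_sqr_integrable x t0 gL.
  have i3 := @integrable_mull _ _ R mu _ (2 * g x) (heatop_integrable x t0 gL).
  have i12 := integrable_add i1 i2.
  transitivity (\int[mu]_y (g x ^+ 2 * heat t (x - y) + heat t (x - y) * g y ^+ 2 - 2 * g x * (heat t (x - y) * g y))%:E)%E.
    by apply: eq_integral => y _; congr EFin; ring.
  rewrite -EFin_Rintegral; last exact: integrable_sub.
  rewrite RintegralB// RintegralD// !RintegralZl//; last exact: heatop_integrable.
  by rewrite ih1 mulr1 -mulrA.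
under eq_integral do rewrite inner.
have mq : measurable_fun setT q.
  apply: (@measurable_Rintegral _ _ 'rV[R]_n _ _ mu (fun x y => heat t (x - y) * g y ^+ 2)).
  by apply: measurable_funM; [exact: mheat2|meas].
have qE : (\int[mu]_x (q x)%:E = (sqnorm g)%:E)%E.
  rewrite -sqnormE// -(@integral_heat_conv t (fun y => g y ^+ 2))//; [|by meas|by move=> x; exact: sqr_ge0].
  by apply: eq_integral => x _; rewrite EFin_Rintegral//; exact: heatop_sqr_integrable.
have iq : mu.-integrable setT (EFin \o q).
  apply: ge0_integral_Rintegral => //; last by rewrite qE ltry.
  by move=> x; apply: Rintegral_ge0 => y _; rewrite mulr_ge0 ?heat_ge0 ?sqr_ge0.
have ig := L2_integrable_sqr gL.
have igP := integrable_mull 2 (L2_integrable_mul gL (heatop_L2 t0 gL)).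
have i12 := integrable_add ig iq.
rewrite -EFin_Rintegral; last exact: integrable_sub.
congr EFin; rewrite RintegralB// RintegralD// RintegralZl//; last exact: (L2_integrable_mul gL (heatop_L2 t0 gL)).
have qE' : \int[mu]_x (q x) = sqnorm g by rewrite /Rintegral qE.
by rewrite heatop_form// qE' -/(sqnorm g); ring.
Qed.

(** The energy at time [2 * t] is nonnegative. *)
Lemma heatop_contract t g : 0 < t -> L2 g -> sqnorm (heatop t g) <= sqnorm g.
Proof.
move=> t0 gL; have t20 : 0 < 2 * t by rewrite mulr_gt0.
have := heat_energyE t20 gL; rewrite (_ : 2 * t / 2 = t); last by field.
move=> h; have : (0 <= (2 * (sqnorm g - sqnorm (heatop t g)))%:E)%E.
  rewrite -h; apply: integral_ge0 => x _; apply: integral_ge0 => y _.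
  by rewrite lee_fin mulr_ge0 ?heat_ge0 ?sqr_ge0.
by rewrite lee_fin pmulr_rge0// subr_ge0.
Qed.

End heat_semigroup.

(** * The Bessel kernel in time *)

Section Rintegral_swap_ae.
Context d1 d2 (T1 : measurableType d1) (T2 : measurableType d2) (R : realType).
Variable m1 : {sigma_finite_measure set T1 -> \bar R}.
Variable m2 : {sigma_finite_measure set T2 -> \bar R}.

(** An iterated [Rintegral] applies [fine] to the inner integral; for an integrable function the
    infinite values it discards form a null set. *)
Lemma Rintegral_fine d (T : measurableType d) (mu : {measure set T -> \bar R}) (F : T -> \bar R) :
  mu.-integrable setT F -> \int[mu]_x fine (F x) = fine (\int[mu]_x F x).
Proof.
move=> Fi; have /integrableP[mF _] := Fi.
rewrite /Rintegral; congr fine; apply: ae_eq_integral => //.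
- by apply/measurable_EFinP; exact: measurableT_comp.
- have := integrable_ae measurableT Fi; apply: filterS => x xF _.
  by rewrite fineK// xF.
Qed.

Lemma Rintegral_Fubini (k : T1 -> T2 -> R) :
  (m1 \x m2)%E.-integrable setT (EFin \o (fun z : T1 * T2 => k z.1 z.2)) ->
  \int[m1]_x \int[m2]_y k x y = \int[(m1 \x m2)%E]_z k z.1 z.2 /\
  \int[m2]_y \int[m1]_x k x y = \int[(m1 \x m2)%E]_z k z.1 z.2.
Proof.
move=> ki; split.
  transitivity (\int[m1]_x fine (fubini_F m2 (EFin \o (fun z : T1 * T2 => k z.1 z.2)) x)); first by [].
  by rewrite Rintegral_fine ?(integral12_prod_meas1 ki)//; exact: (@integrable_fubini_F _ _ _ _ _ m1 m2 _ ki).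
transitivity (\int[m2]_y fine (fubini_G m1 (EFin \o (fun z : T1 * T2 => k z.1 z.2)) y)); first by [].
rewrite Rintegral_fine ?(integral21_prod_meas1 ki)//; apply/integrableP; split.
  exact: (@measurable_fubini_G _ _ _ _ _ m1 m2 _ ki).
have /integrableP[mk _] := ki; have /(integrable21ltyP m1 m2 mk) := ki.
apply: le_lt_trans; apply: ge0_le_integral => //.
- by apply: measurableT_comp => //; exact: (@measurable_fubini_G _ _ _ _ _ m1 m2 _ ki).
- apply: (@measurable_fun_fubini_tonelli_G _ _ _ _ _ m1 (fun z => `|(k z.1 z.2)%:E|)%E) => //.
  exact: measurableT_comp.
- move=> y _; apply: le_abse_integral => //; exact: (measurableT_comp mk).
Qed.

Lemma integrable_prod (k : T1 -> T2 -> R) :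
  measurable_fun setT (fun z : T1 * T2 => k z.1 z.2) ->
  (\int[m1]_x \int[m2]_y (`|k x y|)%:E < +oo)%E ->
  (m1 \x m2)%E.-integrable setT (EFin \o (fun z : T1 * T2 => k z.1 z.2)).
Proof.
move=> mk ky; apply/integrableP; split; first exact/measurable_EFinP.
rewrite (_ : (\int[_]_x _)%E = (\int[m1]_x \int[m2]_y (`|k x y|)%:E)%E)//.
by rewrite -(@tonelli_prod _ _ _ _ _ m1 m2 (fun x y => `|k x y|))//; exact: measurable_fun_normr.
Qed.

(** In contrast to [Rintegral_swap], the slices are integrable only almost everywhere, as happens
    for the integral defining [Jop]. *)
Lemma Rintegral_swap_ae (k : T1 -> T2 -> R) :
  measurable_fun setT (fun z : T1 * T2 => k z.1 z.2) ->
  (\int[m1]_x \int[m2]_y (`|k x y|)%:E < +oo)%E ->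
  \int[m1]_x \int[m2]_y k x y = \int[m2]_y \int[m1]_x k x y.
Proof. by move=> mk ky; have [-> ->] := Rintegral_Fubini (integrable_prod mk ky). Qed.

End Rintegral_swap_ae.

(** * Euler's integral *)

Section euler.
Context (R : realType).
Local Notation leb := (@lebesgue_measure R).

Lemma measurable_euler (a : R) : measurable_fun setT (fun t : R => pw (a - 1) t * expR (- t)).
Proof. by meas. Qed.

Lemma expR_le_powR (a : R) : 0 < a -> exists2 C : R, 0 <= C & forall t : R, 1 <= t -> expR (- t) <= C * t `^ (- a).
Proof.
move=> a0; pose k := (Num.truncn a).+1; exists (k`!%:R); first by [].
move=> t t1; have t0 : 0 < t by exact: lt_le_trans t1.
have h : t `^ a <= k`!%:R * expR t.
  apply: (@le_trans _ _ (t ^+ k)).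
    by rewrite -powR_mulrn ?(ltW t0)// ler_powR// ltW// truncnS_gt.
  have := expR_ge1Dxn (Num.truncn a) (ltW t0); rewrite -/k => h.
  have kf : 0 < k`!%:R :> R by rewrite ltr0n fact_gt0.
  rewrite mulrC -ler_pdivrMr//; apply: le_trans h; by rewrite lerDr.
rewrite expRN powRN ler_pdivlMr ?powR_gt0// mulrC ler_pdivrMr ?expR_gt0//.
Qed.

Lemma euler_lty (a : R) : 0 < a -> (\int[leb]_t (pw (a - 1) t * expR (- t))%:E < +oo)%E.
Proof.
move=> a0; have a10 : 0 < a + 1 by rewrite addr_gt0.
have [C C0 HC] := expR_le_powR a10.
apply: (@integral_pw_lty R _ a 1 (C + 1)) => //.
- exact: measurable_euler.
- by rewrite addr_ge0.
- by move=> t; rewrite mulr_ge0 ?pw_ge0 ?expR_ge0.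
- by move=> t t0; rewrite pw_le0// mul0r.
- move=> t t0 t1; rewrite pwE// mulrC ler_wpM2r ?powR_ge0//.
  by rewrite (@le_trans _ _ 1) ?lerDr// -expR0 ler_expR oppr_le0 ltW.
- move=> t t1; have t0 : 0 < t by exact: lt_le_trans t1.
  rewrite pwE//; apply: (@le_trans _ _ (t `^ (a - 1) * (C * t `^ (- (a + 1))))).
    by rewrite ler_wpM2l ?powR_ge0// HC.
  rewrite mulrCA -powRD ?(gt_eqF t0) ?implybT//.
  rewrite (_ : a - 1 + - (a + 1) = - 1 - 1); last by ring.
  by rewrite ler_wpM2r ?powR_ge0// lerDl.
Qed.

Lemma euler_integralE (a : R) : euler_integral a = \int[leb]_t (pw (a - 1) t * expR (- t)).
Proof.
rewrite /euler_integral Rintegral_mkcond; apply: eq_Rintegral => t _.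
rewrite patchE /pw; case: ifPn.
  by rewrite inE /= in_itv /= andbT => ->.
by rewrite notin_setE /= in_itv /= andbT => /negP/negbTE ->; rewrite mul0r.
Qed.

(** On [[1, 2]] the integrand is at least [expR (- 2) / 2], because [a - 1 >= - 1]. *)
Lemma euler_integral_gt0 (a : R) : 0 < a -> 0 < euler_integral a.
Proof.
move=> a0; rewrite euler_integralE lt_neqAle; apply/andP; split; last first.
  by apply: Rintegral_ge0 => t _; rewrite mulr_ge0 ?pw_ge0 ?expR_ge0.
apply/eqP => /esym h0; have iE : (\int[leb]_t (pw (a - 1) t * expR (- t))%:E = 0)%E.
  rewrite -EFin_Rintegral ?h0//; apply: ge0_integral_Rintegral; [exact: measurable_euler| |exact: euler_lty].
  by move=> t; rewrite mulr_ge0 ?pw_ge0 ?expR_ge0.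
have : ((expR (- 2) / 2)%:E <= \int[leb]_t (pw (a - 1) t * expR (- t))%:E)%E.
  have mD : measurable ([set` `[1%R, 2%R]] : set (measurableTypeR R)) by exact: measurable_itv.
  apply: (@le_trans _ _ (\int[leb]_(t in `[1%R, 2%R]) (pw (a - 1) t * expR (- t))%:E)%E); last first.
    apply: ge0_subset_integral => //; first by apply/measurable_EFinP; exact: measurable_euler.
    by move=> t _; rewrite lee_fin mulr_ge0 ?pw_ge0 ?expR_ge0.
  apply: (@le_trans _ _ (\int[leb]_(t in `[1%R, 2%R]) (expR (- 2) / 2)%:E)%E).
    rewrite integral_cst//= [X in (_ * X)%E](_ : _ = 1%E) ?mule1//.
    transitivity (lebesgue_measure [set` `[1%R : R, 2%R]]); first by [].
    rewrite lebesgue_measure_itv /= lte_fin ltr1n -EFinB; congr EFin; by ring.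
  apply: ge0_le_integral => //.
  - by apply/measurable_funTS/measurable_EFinP; exact: measurable_euler.
  - move=> t; rewrite /= in_itv /= => /andP[t1 t2]; rewrite lee_fin mulrC.
    have t0 : 0 < t by exact: lt_le_trans t1.
    rewrite ler_pM ?expR_ge0 ?invr_ge0 ?ler_expR ?lerN2// pwE//.
    apply: (@le_trans _ _ (t `^ (- 1))).
      by rewrite powRN powRr1 ?(ltW t0)// lef_pV2 ?posrE.
    by rewrite ler_powR// lerBrDl subrr ltW.
by rewrite iE lee_fin leNgt divr_gt0 ?expR_gt0.
Qed.

End euler.

(* The density with [\int rho s t * expR (- t * b) = (1 + b) `^ (- (s / 2))]. *)
HB.lock Definition rho (R : realType) (s t : R) : R :=
  pw (s / 2 - 1) t * expR (- t) / euler_integral (s / 2).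

Section bessel_kernel.
Context (R : realType) (s : R).
Hypothesis s0 : 0 < s.
Local Notation leb := (@lebesgue_measure R).

Local Notation rho := (rho s).

Let s20 : 0 < s / 2. Proof. by rewrite divr_gt0. Qed.
Let G0 : 0 < euler_integral (s / 2). Proof. exact: euler_integral_gt0. Qed.

Lemma rho_ge0 t : 0 <= rho t.
Proof. by rewrite rho.unlock divr_ge0 ?(ltW G0)// mulr_ge0 ?pw_ge0 ?expR_ge0. Qed.

Lemma rho_le0 t : t <= 0 -> rho t = 0.
Proof. by move=> t0; rewrite rho.unlock pw_le0// !mul0r. Qed.

Lemma measurable_fun_rho d (T : measurableType d) (f : T -> R) :
  measurable_fun setT f -> measurable_fun setT (fun x => rho (f x)).
Proof. by move=> mf; rewrite rho.unlock; meas. Qed.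

(** Euler's integral after the substitution of [(1 + b) * t] for [t]. At [b = dotp x x] the
    right-hand side is the inverse Bessel weight; at [b = 0] it says that [rho] is a probability
    density. *)
Lemma integral_rho_exp (b : R) : 0 <= b ->
  (\int[leb]_t (rho t * expR (- t * b))%:E = ((1 + b) `^ (- (s / 2)))%:E)%E.
Proof.
move=> b0; have b10 : 0 < 1 + b by rewrite ltr_pwDl.
pose f t := pw (s / 2 - 1) t * expR (- t).
have mf : measurable_fun setT f by exact: measurable_euler.
have f0 t : 0 <= f t by rewrite /f mulr_ge0 ?pw_ge0 ?expR_ge0.
have fE : (\int[leb]_t (f t)%:E = (euler_integral (s / 2))%:E)%E.
  rewrite euler_integralE EFin_Rintegral//; apply: ge0_integral_Rintegral => //; exact: euler_lty.
have := @ge0_integral_affine R (1 + b) 0 (fun t => (f t)%:E) b10.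
rewrite fE -EFinM => h.
transitivity (\int[leb]_t (((1 + b) `^ (1 - s / 2) / euler_integral (s / 2)) * f ((1 + b) * t + 0))%:E)%E.
  apply: eq_integral => t _; congr EFin; rewrite addr0 /f pwM// rho.unlock.
  rewrite (_ : expR (- ((1 + b) * t)) = expR (- t) * expR (- t * b)); last first.
    by rewrite -expRD; congr expR; ring.
  have : (1 + b) `^ (1 - s / 2) * (1 + b) `^ (s / 2 - 1) = 1.
    rewrite -powRD ?(gt_eqF b10) ?implybT// (_ : 1 - s / 2 + (s / 2 - 1) = 0) ?powRr0//; by ring.
  move=> e; rewrite -[LHS]mul1r -{1}e; field; exact: lt0r_neq0.
rewrite intZl; [|by rewrite /f; meas|by move=> t; exact: f0|by rewrite divr_ge0 ?powR_ge0 ?ltW].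
rewrite h; [|exact/measurable_EFinP|by move=> t; rewrite lee_fin].
rewrite -EFinM; congr EFin.
have -> : (1 + b) `^ (- (s / 2)) = (1 + b) `^ (1 - s / 2) * (1 + b)^-1.
  rewrite -(powR_inv1 (ltW b10)) -powRD ?(gt_eqF b10) ?implybT//; congr (_ `^ _); by ring.
by field; rewrite !lt0r_neq0.
Qed.

Lemma integral_rho : (\int[leb]_t (rho t)%:E = 1)%E.
Proof.
have := integral_rho_exp (lexx 0); rewrite addr0 powR1 => <-.
by apply: eq_integral => t _; rewrite mulr0 expR0 mulr1.
Qed.

Lemma integrable_rho : leb.-integrable setT (EFin \o rho).
Proof.
apply: ge0_integral_Rintegral; [apply: measurable_fun_rho; exact: measurable_id|exact: rho_ge0|].
by rewrite integral_rho ltry.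
Qed.

End bessel_kernel.

(** * The Bessel operator *)

Section bessel_operator.
Context (R : realType) (n : nat) (s : R).
Hypothesis s0 : 0 < s.
Local Notation mu := (@lebesgue_rV R n).
Local Notation leb := (@lebesgue_measure R).
Local Notation rho := (rho s).
Implicit Types (v g : 'rV[R]_n -> R).

(* [(1 - \Delta)^(- s / 2)] as an average of the heat semigroup. *)
Definition Jop v x : R := \int[leb]_t (rho t * heatop t v x).

Let mrho : measurable_fun setT rho.
Proof. by apply: measurable_fun_rho; exact: measurable_id. Qed.

Let mP v : measurable_fun setT v ->
  measurable_fun setT (fun z : 'rV[R]_n * R => heatop z.2 v z.1).
Proof. by move=> mv; apply: measurable_heatop2; meas. Qed.

Let mP1 v x : measurable_fun setT v -> measurable_fun setT (fun t : R => heatop t v x).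
Proof. by move=> mv; apply: measurable_heatop2; meas. Qed.

Let msq v : measurable_fun setT v ->
  measurable_fun setT (fun z : 'rV[R]_n * R => rho z.2 * heatop z.2 v z.1 ^+ 2).
Proof.
move=> mv; have := mP mv => ?; apply: measurable_funM; first by apply: measurable_fun_rho; meas.
by apply: measurable_funX.
Qed.

Lemma measurable_Jop v : measurable_fun setT v -> measurable_fun setT (Jop v).
Proof.
move=> mv; apply: (@measurable_Rintegral _ _ 'rV[R]_n _ _ leb (fun x t => rho t * heatop t v x)).
by apply: measurable_funM; [apply: measurable_fun_rho; meas|exact: mP].
Qed.

Let sq v x := (\int[leb]_t (rho t * heatop t v x ^+ 2)%:E)%E.

Let sq_ge0 v x : (0 <= sq v x)%E.
Proof. by apply: int_ge0 => t; rewrite mulr_ge0 ?rho_ge0 ?sqr_ge0. Qed.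

Let measurable_sq v : measurable_fun setT v -> measurable_fun setT (sq v).
Proof.
move=> mv; apply: (@measurable_int2 _ _ 'rV[R]_n _ _ leb (fun x t => rho t * heatop t v x ^+ 2)).
  exact: msq.
by move=> x t; rewrite mulr_ge0 ?rho_ge0 ?sqr_ge0.
Qed.

(** Tonelli, the contraction property of the heat flow, and the total mass 1 of [rho]. *)
Lemma Jop_sq_int v : L2 v -> (\int[mu]_x \int[leb]_t (rho t * heatop t v x ^+ 2)%:E <= (sqnorm v)%:E)%E.
Proof.
move=> vL; have [mv vy] := vL.
rewrite (@tonelli _ _ _ _ _ mu leb (fun x t => rho t * heatop t v x ^+ 2)); last 2 first.
- exact: msq.
- by move=> x t; rewrite mulr_ge0 ?rho_ge0 ?sqr_ge0.
apply: (@le_trans _ _ (\int[leb]_t (sqnorm v * rho t)%:E)%E); last first.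
  by rewrite intZl ?sqnorm_ge0//; [rewrite integral_rho// mule1|move=> t; exact: rho_ge0].
apply: ge0_le_integral => //.
- by move=> t _; apply: int_ge0 => x; rewrite mulr_ge0 ?rho_ge0 ?sqr_ge0.
- apply: (@measurable_int1 _ _ 'rV[R]_n _ _ mu (fun x t => rho t * heatop t v x ^+ 2)).
    exact: msq.
  by move=> x t; rewrite mulr_ge0 ?rho_ge0 ?sqr_ge0.
- by apply/measurable_EFinP; exact: measurable_funM.
move=> t _; have [t0|t0] := leP t 0.
  by rewrite rho_le0// mulr0; under eq_integral do rewrite mul0r; rewrite integral0.
have PL := heatop_L2 t0 vL; have [mPt _] := PL.
rewrite intZl; [|by meas|by move=> x; exact: sqr_ge0|exact: rho_ge0].
by rewrite sqnormE// -EFinM lee_fin mulrC ler_wpM2r ?rho_ge0// heatop_contract.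
Qed.

(** The integral defining [Jop] converges absolutely wherever [sq] is finite ([Jop_integrable]); off
    this set, which has full measure, its value carries no information. *)
Lemma Jop_ae v : L2 v -> \forall x \ae mu, (sq v x < +oo)%E.
Proof.
move=> vL; have [mv _] := vL.
have : mu.-integrable setT (sq v).
  apply/integrableP; split; first exact: measurable_sq.
  under eq_integral do rewrite gee0_abs ?sq_ge0//.
  by apply: le_lt_trans (Jop_sq_int vL) _; rewrite ltry.
move/(integrable_ae measurableT); apply: filterS => x /(_ I).
by rewrite ge0_fin_numE ?sq_ge0.
Qed.

Lemma Jop_integrable v x : measurable_fun setT v -> (sq v x < +oo)%E ->
  leb.-integrable setT (EFin \o (fun t => rho t * heatop t v x)).
Proof.
move=> mv sy; have := mP1 x mv => mPx.
apply: (@integrable_dom _ _ R leb _ (fun t => rho t + rho t * heatop t v x ^+ 2)); [by meas|by meas| |].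
  move=> t; have r0 := rho_ge0 s0 t; rewrite normrM ger0_norm// -[X in _ <= X + _]mulr1 -mulrDr ler_wpM2l//.
  rewrite -(real_normK (num_real (heatop _ _ _))); have := sqr_ge0 (`|heatop t v x| - 1).
  by have := normr_ge0 (heatop t v x); nra.
rewrite intD//; [|by meas|by move=> t; exact: rho_ge0|].
  by apply: lte_add_pinfty => //; rewrite integral_rho// ltry.
by move=> t; rewrite mulr_ge0 ?rho_ge0 ?sqr_ge0.
Qed.

Lemma abs_Rintegral_le d (T : measurableType d) (m : {measure set T -> \bar R}) (f : T -> R) :
  m.-integrable setT (EFin \o f) -> (`|\int[m]_x f x|%:E <= \int[m]_x (`|f x|)%:E)%E.
Proof.
move=> fi; have /integrableP[mf _] := fi; rewrite EFin_normr_Rintegral//.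
exact: le_abse_integral.
Qed.

(** Jensen for the probability density [rho]. *)
Lemma Jop_sqr_le v x : measurable_fun setT v -> ((Jop v x ^+ 2)%:E <= sq v x)%E.
Proof.
move=> mv; have [sy|] := ltP (sq v x) +oo%E; last by rewrite leye_eq => /eqP ->; rewrite leey.
have Ji := Jop_integrable mv sy; have := mP1 x mv => mPx.
rewrite -(real_normK (num_real _)).
apply: (@le_trans _ _ ((\int[leb]_t (rho t * `|heatop t v x|)%:E) * (\int[leb]_t (rho t * `|heatop t v x|)%:E)))%E.
  have h : (`|Jop v x|%:E <= \int[leb]_t (rho t * `|heatop t v x|)%:E)%E.
    apply: le_trans (abs_Rintegral_le Ji) _; rewrite le_eqVlt; apply/orP; left; apply/eqP.
    by apply: eq_integral => t _; rewrite normrM ger0_norm ?rho_ge0.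
  by rewrite expr2 EFinM lee_pmul// lee_fin.
have rr t : Num.sqrt (rho t) * Num.sqrt (rho t) = rho t by rewrite -expr2 sqr_sqrtr// rho_ge0.
have := @cauchy_schwarz _ _ R leb (fun t => Num.sqrt (rho t)) (fun t => Num.sqrt (rho t) * `|heatop t v x|).
have e1 : (\int[leb]_t (Num.sqrt (rho t) ^+ 2)%:E = 1)%E.
  by rewrite -(integral_rho s0); apply: eq_integral => t _; rewrite expr2 rr.
have e2 : (\int[leb]_t ((Num.sqrt (rho t) * `|heatop t v x|) ^+ 2)%:E = sq v x)%E.
  by apply: eq_integral => t _; rewrite exprMn expr2 rr (real_normK (num_real _)).
have e3 : (\int[leb]_t (Num.sqrt (rho t) * (Num.sqrt (rho t) * `|heatop t v x|))%:E =
    \int[leb]_t (rho t * `|heatop t v x|)%:E)%E.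
  by apply: eq_integral => t _; rewrite mulrA rr.
rewrite e1 e2 e3 mul1e; apply; [by meas|by meas|by move=> t; exact: sqrtr_ge0|].
by move=> t; rewrite mulr_ge0 ?sqrtr_ge0.
Qed.

Lemma Jop_sqnorm v : L2 v -> (\int[mu]_x (Jop v x ^+ 2)%:E <= (sqnorm v)%:E)%E.
Proof.
move=> vL; have [mv _] := vL; apply: le_trans (Jop_sq_int vL); apply: ge0_le_integral => //.
- by move=> x _; rewrite lee_fin sqr_ge0.
- by have := measurable_Jop mv => ?; meas.
- exact: measurable_sq.
- by move=> x _; exact: Jop_sqr_le.
Qed.

Lemma Jop_L2 v : L2 v -> L2 (Jop v).
Proof.
move=> vL; have [mv _] := vL; split; first exact: measurable_Jop.
by apply: le_lt_trans (Jop_sqnorm vL) _; rewrite ltry.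
Qed.

(** Under the average the semigroup law adds the times. Testing the Bessel potential leads to the
    same right-hand side ([heatop_bessel]), and this agreement is what identifies [u] with
    [Jop v]. *)
Lemma heatop_Jop e v x0 : 0 < e -> L2 v ->
  heatop e (Jop v) x0 = \int[leb]_t (rho t * heatop (t + e) v x0).
Proof.
move=> e0 vL; have [mv vy] := vL; pose K := (4 * pi * e) `^ (- (n%:R / 2)).
have mh : measurable_fun setT (fun y : 'rV[R]_n => heat e (x0 - y)) by apply: measurable_fun_heat; meas.
have mk : measurable_fun setT (fun z : 'rV[R]_n * R => heat e (x0 - z.1) * (rho z.2 * heatop z.2 v z.1)).
  apply: measurable_funM; first by apply: measurable_fun_heat; meas.
  by apply: measurable_funM; [apply: measurable_fun_rho; meas|exact: mP].
transitivity (\int[mu]_y \int[leb]_t (heat e (x0 - y) * (rho t * heatop t v y))).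
  (* The factor [heat e (x0 - y)] can be moved inside only where the inner integral converges, that
     is for almost every [y]. *)
  rewrite /heatop /Rintegral; congr fine; apply: ae_eq_integral => //.
  - by have := measurable_Jop mv => ?; meas.
  - apply/measurable_EFinP; apply: (@measurable_Rintegral _ _ 'rV[R]_n _ _ leb
      (fun y t => heat e (x0 - y) * (rho t * heatop t v y))) mk.
  - have := Jop_ae vL; apply: filterS => y sy _; congr EFin.
    by rewrite /Jop -RintegralZl//; exact: Jop_integrable.
rewrite Rintegral_swap_ae//.
- apply: eq_Rintegral => t _; have [t0|t0] := leP t 0.
    rewrite rho_le0// mul0r; under eq_Rintegral do rewrite mul0r mulr0.
    by rewrite Rintegral_cst// mul0r.
  rewrite addrC -heatop_semigroup// [in RHS]/heatop -RintegralZl//; last first.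
    by apply: heatop_integrable => //; exact: heatop_L2.
  by apply: eq_Rintegral => y _; rewrite mulrCA.
have r0 := rho_ge0 s0; have h0 := @heat_ge0 R n.
have mk' : measurable_fun setT (fun z : 'rV[R]_n * R => rho z.2 * heatop z.2 v z.1 ^+ 2).
  exact: msq.
apply: (@le_lt_trans _ _ (\int[mu]_y (heat e (x0 - y))%:E + K%:E * \int[mu]_y (sq v y))%E); last first.
  rewrite integral_heat_sub'//; apply: lte_add_pinfty; first by rewrite ltry.
  rewrite lte_mul_pinfty ?lee_fin ?powR_ge0//.
  by apply: le_lt_trans (Jop_sq_int vL) _; rewrite ltry.
rewrite -ge0_integralZl_EFin ?powR_ge0//; last exact: measurable_sq.
rewrite -ge0_integralD; [|by []|by move=> y _; rewrite lee_fin|exact/measurable_EFinP|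
  by move=> y _; rewrite mule_ge0 ?lee_fin ?powR_ge0 ?sq_ge0|by apply: measurable_funeM; exact: measurable_sq].
apply: ge0_le_integral => //.
- by move=> y _; apply: int_ge0.
- apply: (@measurable_int2 _ _ 'rV[R]_n _ _ leb (fun y t => `|heat e (x0 - y) * (rho t * heatop t v y)|)) => //.
  exact: measurable_fun_normr.
- by apply: emeasurable_funD; [exact/measurable_EFinP|apply: measurable_funeM; exact: measurable_sq].
move=> y _; have := mP1 y mv => mPy.
rewrite -[X in (_ <= X + _)%E]mule1 -(integral_rho s0) -intZl//.
rewrite /sq -intZl ?powR_ge0//; [|by meas|by move=> t; rewrite mulr_ge0 ?sqr_ge0].
rewrite -intD; [|by meas|by meas|by move=> t; rewrite mulr_ge0|
  by move=> t; apply: mulr_ge0; [exact: powR_ge0|by rewrite mulr_ge0 ?sqr_ge0]].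
apply: le_int => //; [by meas|by meas|move=> t].
have [t0|t0] := leP t 0; first by rewrite rho_le0// !mul0r !mulr0 normr0 addr0.
rewrite !normrM (ger0_norm (h0 _ _)) (ger0_norm (r0 _)).
have := heat_le (x0 - y) e0; rewrite -/K => hK.
rewrite (_ : _ + _ = rho t * (heat e (x0 - y) + K * heatop t v y ^+ 2)); last by ring.
rewrite mulrCA ler_wpM2l//; apply: (@le_trans _ _ (heat e (x0 - y) * (1 + heatop t v y ^+ 2))).
  rewrite ler_wpM2l// -(real_normK (num_real (heatop _ _ _))); have := sqr_ge0 (`|heatop t v y| - 1).
  by have := normr_ge0 (heatop t v y); nra.
by rewrite mulrDr mulr1 lerD2l ler_wpM2r// sqr_ge0.
Qed.

(** The Bessel kernel smoothed by the heat flow for time [e]: for [e > 0] it is bounded, whereas the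
    Bessel kernel may be singular at 0. *)
Definition bkern (e : R) (z : 'rV[R]_n) : R := \int[leb]_t (rho t * heat (t + e) z).

Lemma heat_le_add e t (z : 'rV[R]_n) : 0 < e -> rho t * heat (t + e) z <= rho t * (4 * pi * e) `^ (- (n%:R / 2)).
Proof.
move=> e0; have [t0|t0] := leP t 0; first by rewrite rho_le0// !mul0r.
rewrite ler_wpM2l ?rho_ge0//; apply: le_trans (heat_le _ _) _; first by rewrite addr_gt0.
have p0 := @pi_gt0 R.
have a4 : 0 < 4 * pi :> R by exact: mulr_gt0.
have a1 : 0 < 4 * pi * e by exact: mulr_gt0.
have a2 : 0 < 4 * pi * (t + e) by apply: mulr_gt0 => //; exact: addr_gt0.
rewrite !powRN lef_pV2 ?posrE ?powR_gt0//.
apply: ge0_ler_powR; [by rewrite divr_ge0|by rewrite nnegrE ltW|by rewrite nnegrE ltW|].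
by rewrite (ler_pM2l a4) lerDr ltW.
Qed.

(** Fubini again; together with [heatop_Jop] it shows that [bkern e] is the convolution kernel of
    [heatop e] applied after [Jop]. *)
Lemma bkern_conv e v x0 : 0 < e -> L2 v ->
  \int[mu]_x (v x * bkern e (x - x0)) = \int[leb]_t (rho t * heatop (t + e) v x0).
Proof.
move=> e0 vL; have [mv vy] := vL; pose K := (4 * pi * e) `^ (- (n%:R / 2)).
have r0 := rho_ge0 s0; have h0 := @heat_ge0 R n.
have mk : measurable_fun setT (fun z : 'rV[R]_n * R => v z.1 * (rho z.2 * heat (z.2 + e) (z.1 - x0))).
  apply: measurable_funM; first by meas.
  by apply: measurable_funM; [apply: measurable_fun_rho; meas|apply: measurable_fun_heat; meas].
have bi (x : 'rV[R]_n) : leb.-integrable setT (EFin \o (fun t => rho t * heat (t + e) x)).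
  apply: (@integrable_dom _ _ R leb _ (fun t => K * rho t)).
  - by apply: measurable_funM => //; apply: measurable_fun_heat; meas.
  - by meas.
  - by move=> t; rewrite ger0_norm ?mulr_ge0// [leRHS]mulrC; exact: heat_le_add.
  - by rewrite intZl; [rewrite integral_rho// mule1 ltry|exact: mrho|move=> t; exact: rho_ge0|exact: powR_ge0].
transitivity (\int[mu]_x \int[leb]_t (v x * (rho t * heat (t + e) (x - x0)))).
  by apply: eq_Rintegral => x _; rewrite /bkern RintegralZl.
rewrite Rintegral_swap_ae//.
  apply: eq_Rintegral => t _; have [t0|t0] := leP t 0.
    rewrite rho_le0// mul0r; under eq_Rintegral do rewrite mul0r mulr0.
    by rewrite Rintegral_cst// mul0r.
  rewrite /heatop -RintegralZl//; last by apply: heatop_integrable => //; rewrite addr_gt0.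
  by apply: eq_Rintegral => x _; rewrite heat_sym; ring.
have mvn : measurable_fun setT (fun z : 'rV[R]_n * R => `|v z.1 * (rho z.2 * heat (z.2 + e) (z.1 - x0))|).
  exact: measurable_fun_normr.
rewrite (@tonelli _ _ _ _ _ mu leb (fun x t => `|v x * (rho t * heat (t + e) (x - x0))|))//.
apply: (@le_lt_trans _ _ (\int[leb]_t ((1 + K * sqnorm v) * rho t)%:E)%E); last first.
  rewrite intZl//; first by rewrite integral_rho// mule1 ltry.
  by rewrite addr_ge0// mulr_ge0 ?powR_ge0 ?sqnorm_ge0.
apply: ge0_le_integral => //.
- by move=> t _; exact: int_ge0.
- by apply: (@measurable_int1 _ _ 'rV[R]_n _ _ mu (fun x t => `|v x * (rho t * heat (t + e) (x - x0))|)).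
- by apply/measurable_EFinP; meas.
move=> t _; have [t0|t0] := leP t 0.
  by rewrite rho_le0// mulr0; under eq_integral do rewrite mul0r mulr0 normr0; rewrite integral0.
have te0 : 0 < t + e by rewrite addr_gt0.
have mh : measurable_fun setT (fun x : 'rV[R]_n => heat (t + e) (x - x0)) by apply: measurable_fun_heat; meas.
apply: (@le_trans _ _ (\int[mu]_x (rho t * (heat (t + e) (x - x0)) + (rho t * K) * v x ^+ 2)%:E)%E).
  apply: le_int => //; [by meas|by meas|move=> x].
  rewrite !normrM (ger0_norm (h0 _ _)) (ger0_norm (r0 _)).
  have := heat_le_add t (x - x0) e0; rewrite -/K => hK.
  apply: (@le_trans _ _ (rho t * heat (t + e) (x - x0) * (1 + v x ^+ 2))).
    rewrite mulrC ler_wpM2l ?mulr_ge0// -(real_normK (num_real (v x))); have := sqr_ge0 (`|v x| - 1).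
    by have := normr_ge0 (v x); nra.
  by rewrite mulrDr mulr1 lerD2l ler_wpM2r// sqr_ge0.
rewrite intD; [|by meas|by meas|by move=> x; rewrite mulr_ge0|by move=> x; rewrite mulr_ge0 ?sqr_ge0 ?mulr_ge0 ?powR_ge0].
rewrite !intZl//; [|by meas|by move=> x; exact: sqr_ge0|by rewrite mulr_ge0 ?powR_ge0].
rewrite integral_heat_sub// mule1 sqnormE// -EFinM -EFinD lee_fin le_eqVlt; apply/orP; left; apply/eqP; ring.
Qed.

Lemma bkern_ge0 e z : 0 <= bkern e z.
Proof. by apply: Rintegral_ge0 => t _; rewrite mulr_ge0 ?rho_ge0 ?heat_ge0. Qed.

Lemma bkern_integrand e (z : 'rV[R]_n) : 0 < e ->
  leb.-integrable setT (EFin \o (fun t => rho t * heat (t + e) z)).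
Proof.
move=> e0; apply: (@integrable_dom _ _ R leb _ (fun t => (4 * pi * e) `^ (- (n%:R / 2)) * rho t)).
- by apply: measurable_funM => //; apply: measurable_fun_heat; meas.
- by meas.
- by move=> t; rewrite ger0_norm ?mulr_ge0 ?rho_ge0 ?heat_ge0// [leRHS]mulrC; exact: heat_le_add.
- by rewrite intZl; [rewrite integral_rho// mule1 ltry|exact: mrho|move=> t; exact: rho_ge0|exact: powR_ge0].
Qed.

Lemma bkern_le e (z : 'rV[R]_n) : 0 < e -> bkern e z <= (4 * pi * e) `^ (- (n%:R / 2)).
Proof.
move=> e0; pose K := (4 * pi * e) `^ (- (n%:R / 2)).
have i1 := integrable_mull K (integrable_rho s0).
apply: (@le_trans _ _ (\int[leb]_t (K * rho t))).
  apply: le_Rintegral => //; first exact: bkern_integrand.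
  by move=> t _; rewrite [leRHS]mulrC; exact: heat_le_add.
rewrite RintegralZl//; last exact: integrable_rho.
by rewrite {1}/Rintegral integral_rho// mulr1.
Qed.

Lemma measurable_bkern e : measurable_fun setT (bkern e).
Proof.
apply: (@measurable_Rintegral _ _ 'rV[R]_n _ _ leb (fun z t => rho t * heat (t + e) z)).
by apply: measurable_funM; [apply: measurable_fun_rho; meas|apply: measurable_fun_heat; meas].
Qed.

Lemma bkern_integrable e v y : 0 < e -> L2 v ->
  mu.-integrable setT (EFin \o (fun x => v x * bkern e (x - y))).
Proof.
move=> e0 [mv vy]; pose K := (4 * pi * e) `^ (- (n%:R / 2)).
have r0 := rho_ge0 s0; have h0 := @heat_ge0 R n.
have mb := measurable_bkern e.
have mby : measurable_fun setT (fun x : 'rV[R]_n => bkern e (x - y)) by meas.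
apply: (@integrable_dom _ _ R mu _ (fun x => bkern e (x - y) + K * v x ^+ 2)); [by meas|by meas| |].
  move=> x; rewrite normrM (ger0_norm (bkern_ge0 _ _)).
  have := bkern_le (x - y) e0; rewrite -/K => hK; have b0 := bkern_ge0 e (x - y).
  apply: (@le_trans _ _ (bkern e (x - y) * (1 + v x ^+ 2))).
    rewrite mulrC ler_wpM2l// -(real_normK (num_real (v x))); have := sqr_ge0 (`|v x| - 1).
    by have := normr_ge0 (v x); nra.
  by rewrite mulrDr mulr1 lerD2l ler_wpM2r// sqr_ge0.
rewrite intD; [|by meas|by meas|by move=> x; exact: bkern_ge0|
  by move=> x; apply: mulr_ge0; [exact: powR_ge0|exact: sqr_ge0]].
apply: lte_add_pinfty; last first.
  rewrite intZl; [|by meas|by move=> x; exact: sqr_ge0|exact: powR_ge0].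
  by rewrite lte_mul_pinfty// lee_fin powR_ge0.
rewrite (_ : (\int[mu]_x _)%E = (\int[mu]_x \int[leb]_t (rho t * heat (t + e) (x - y))%:E)%E); last first.
  by apply: eq_integral => x _; rewrite EFin_Rintegral//; exact: bkern_integrand.
rewrite (@tonelli _ _ _ _ _ mu leb (fun x t => rho t * heat (t + e) (x - y))); last 2 first.
- by apply: measurable_funM; [apply: measurable_fun_rho; meas|apply: measurable_fun_heat; meas].
- by move=> x t; rewrite mulr_ge0.
rewrite (_ : (\int[leb]_t _)%E = (\int[leb]_t (rho t)%:E)%E); first by rewrite integral_rho// ltry.
apply: eq_integral => t _; have [t0|t0] := leP t 0.
  by rewrite rho_le0//; under eq_integral do rewrite mul0r; rewrite integral0.
rewrite intZl; [|by apply: measurable_fun_heat; meas|by move=> x; exact: h0|exact: r0].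
by rewrite integral_heat_sub ?mule1// addr_gt0.
Qed.

(** By [integral_rho_exp] the inverse weight is an average over [t] of Gaussians
    [expR (- t * dotp x x)]; times [expR (- e * dotp x x)] each of them transforms into
    [heat (t + e)]. *)
Lemma fourier_bkern e (y : 'rV[R]_n) th : 0 < e ->
  \int[mu]_x ((bessel_weight s x)^-1 * (expR (- e * dotp x x) * cos (dotp y x + th))) =
  (2 * pi) ^+ n * bkern e y * cos th.
Proof.
move=> e0; have r0 := rho_ge0 s0.
have wE (x : 'rV[R]_n) : (bessel_weight s x)^-1 = \int[leb]_t (rho t * expR (- t * dotp x x)).
  by rewrite /bessel_weight enorm_sqr -powRN /Rintegral integral_rho_exp ?dotp_ge0.
have mk : measurable_fun setT (fun z : 'rV[R]_n * R => rho z.2 * (expR (- (z.2 + e) * dotp z.1 z.1) * cos (dotp y z.1 + th))).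
  by apply: measurable_funM; [apply: measurable_fun_rho; meas|meas].
transitivity (\int[mu]_x \int[leb]_t (rho t * (expR (- (t + e) * dotp x x) * cos (dotp y x + th)))).
  apply: eq_Rintegral => x _; rewrite wE -RintegralZr//.
    apply: eq_Rintegral => t _; rewrite -mulrA; congr (_ * _); rewrite mulrA -expRD; congr (expR _ * _); ring.
  apply: ge0_integral_Rintegral; [by meas|by move=> t; rewrite mulr_ge0 ?expR_ge0|].
  by rewrite integral_rho_exp ?dotp_ge0// ltry.
rewrite Rintegral_swap_ae//.
  transitivity (((2 * pi) ^+ n * cos th) * \int[leb]_t (rho t * heat (t + e) y)); last by rewrite /bkern; ring.
  rewrite -RintegralZl//.
    apply: eq_Rintegral => t _; have [t0|t0] := leP t 0.
      rewrite rho_le0//; under eq_Rintegral do rewrite mul0r.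
      by rewrite Rintegral_cst// !mul0r mulr0.
    have te0 : 0 < t + e by rewrite addr_gt0.
    rewrite RintegralZl//; last exact: integrable_gauss_cos_rV.
    by rewrite heat_fourier//; ring.
  apply: (@integrable_dom _ _ R leb _ (fun t => (4 * pi * e) `^ (- (n%:R / 2)) * rho t)).
  - by apply: measurable_funM => //; apply: measurable_fun_heat; meas.
  - by meas.
  - by move=> t; rewrite ger0_norm ?mulr_ge0 ?heat_ge0// [leRHS]mulrC; exact: heat_le_add.
  - by rewrite intZl; [rewrite integral_rho// mule1 ltry|exact: mrho|move=> t; exact: rho_ge0|exact: powR_ge0].
have mkn := measurable_fun_normr mk.
rewrite (@tonelli _ _ _ _ _ mu leb (fun x t => `|rho t * (expR (- (t + e) * dotp x x) * cos (dotp y x + th))|))//.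
apply: (@le_lt_trans _ _ (\int[leb]_t ((pi / e) `^ (n%:R / 2) * rho t)%:E)%E); last first.
  by rewrite intZl ?powR_ge0//; rewrite integral_rho// mule1 ltry.
apply: ge0_le_integral => //.
- by move=> t _; exact: int_ge0.
- by apply: (@measurable_int1 _ _ 'rV[R]_n _ _ mu (fun x t => `|rho t * (expR (- (t + e) * dotp x x) * cos (dotp y x + th))|)).
- by apply/measurable_EFinP; meas.
move=> t _; have [t0|t0] := leP t 0.
  by rewrite rho_le0// mulr0; under eq_integral do rewrite mul0r normr0; rewrite integral0.
apply: (@le_trans _ _ (\int[mu]_x (rho t * expR (- e * dotp x x))%:E)%E).
  apply: le_int => //; [by meas|by meas|move=> x].
  rewrite normrM ger0_norm// ler_wpM2l// normrM ger0_norm ?expR_ge0//.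
  apply: (@le_trans _ _ (expR (- (t + e) * dotp x x))); first by rewrite ler_piMr ?expR_ge0// cos_max.
  rewrite ler_expR !mulNr lerN2 ler_wpM2r ?dotp_ge0// lerDr; exact: ltW.
rewrite intZl; [|by meas|by move=> x; exact: expR_ge0|exact: r0].
by rewrite integral_gauss_rV// -EFinM lee_fin mulrC.
Qed.

End bessel_operator.

(** * Gaussian test functions and the Bessel potential *)

Section continuity.
Context (R : realType) (T : topologicalType).
Implicit Types f g : T -> R.

Lemma continuous_add f g : continuous f -> continuous g -> continuous (fun x => f x + g x).
Proof. by move=> cf cg x; apply: continuousD; [exact: cf|exact: cg]. Qed.

Lemma continuous_mul f g : continuous f -> continuous g -> continuous (fun x => f x * g x).
Proof. by move=> cf cg x; apply: continuousM; [exact: cf|exact: cg]. Qed.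

Lemma continuous_cst (a : R) : continuous (fun _ : T => a).
Proof. exact: cst_continuous. Qed.

Lemma continuous_compo (U : topologicalType) (h : U -> T) f :
  continuous h -> continuous f -> continuous (fun x => f (h x)).
Proof. by move=> ch cf x; apply: continuous_comp; [exact: ch|exact: cf]. Qed.

End continuity.

Lemma continuous_sumr (R : realType) (T : topologicalType) I (r : seq I) (F : I -> T -> R) :
  (forall i, continuous (F i)) -> continuous (fun x => \sum_(i <- r) F i x).
Proof.
move=> cF; elim: r => [|i r IH]; first by under eq_fun do rewrite big_nil; exact: cst_continuous.
by under eq_fun do rewrite big_cons; move=> x; apply: cvgD; [exact: cF|exact: IH].
Qed.

Section directional_derivative.
Context (R : realType) (n : nat).
Implicit Types (f g : 'rV[R]_n -> R) (x v : 'rV[R]_n).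

(** Reduces directional derivatives to one real variable, where the chain rule [is_derive1_comp]
    applies. *)
Lemma is_derive_line f x v (df : R) :
  is_derive (0 : R) 1 (fun h : R => f (h *: v + x)) df -> is_derive x v f df.
Proof.
have E : (fun h : R => h^-1 *: (((fun h : R => f (h *: v + x)) \o shift 0) (h *: 1) - f (0 *: v + x))) =
         (fun h : R => h^-1 *: ((f \o shift x) (h *: v) - f x)).
  by apply/funext => h /=; rewrite addr0 scale0r add0r [h *: 1]mulr1.
move=> [d1 d2]; apply: DeriveDef.
  by move: d1; rewrite /derivable E.
by rewrite -d2 /derive E.
Qed.

Lemma line_is_derive f x v (df : R) :
  is_derive x v f df -> is_derive (0 : R) 1 (fun h : R => f (h *: v + x)) df.
Proof.
have E : (fun h : R => h^-1 *: (((fun h : R => f (h *: v + x)) \o shift 0) (h *: 1) - f (0 *: v + x))) =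
         (fun h : R => h^-1 *: ((f \o shift x) (h *: v) - f x)).
  by apply/funext => h /=; rewrite addr0 scale0r add0r [h *: 1]mulr1.
move=> [d1 d2]; apply: DeriveDef.
  by move: d1; rewrite /derivable E.
by rewrite -d2 /derive E.
Qed.

Lemma is_derive_comp f (g : R -> R) x v (df dg : R) :
  is_derive (f x) 1 g dg -> is_derive x v f df -> is_derive x v (fun y => g (f y)) (dg * df).
Proof.
move=> hg hf; apply: is_derive_line.
apply: (@is_derive1_comp _ g (fun h : R => f (h *: v + x))); last exact: line_is_derive.
by rewrite scale0r add0r.
Qed.

Lemma is_derive_coord i x v : is_derive x v (fun y : 'rV[R]_n => y ord0 i) (v ord0 i).
Proof.
apply: is_derive_line; under eq_fun do rewrite !mxE.
by apply: is_derive_eq; rewrite /GRing.scale /=; ring.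
Qed.

Lemma is_derive_dotp x v : is_derive x v (fun y => dotp y y) (2 * dotp x v).
Proof.
apply: is_derive_line.
under eq_fun do rewrite !(dotpDl, dotpDr, dotpZl, dotpZr).
by apply: is_derive_eq; rewrite /GRing.scale /= (dotpC v x); ring.
Qed.

Lemma is_derive_dotpl a x v : is_derive x v (fun y => dotp a y) (dotp a v).
Proof.
apply: is_derive_line.
under eq_fun do rewrite !(dotpDr, dotpZr).
by apply: is_derive_eq; rewrite /GRing.scale /=; ring.
Qed.

Lemma dotp_delta (a : 'rV[R]_n) i : dotp a (delta_mx ord0 i) = a ord0 i.
Proof.
rewrite /dotp (bigD1 i)//= mxE !eqxx mulr1 big1 ?addr0// => j ji.
by rewrite mxE eqxx (negbTE ji) mulr0.
Qed.

Lemma continuous_coord i : continuous (fun y : 'rV[R]_n => y ord0 i).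
Proof. exact: coord_continuous. Qed.

Lemma continuous_dotp2 (f g : 'rV[R]_n -> 'rV[R]_n) : continuous f -> continuous g ->
  continuous (fun y => dotp (f y) (g y)).
Proof.
move=> cf cg; rewrite /dotp; apply: continuous_sumr => i; apply: continuous_mul.
  exact: (continuous_compo cf (@coord_continuous _ _ _ ord0 i)).
exact: (continuous_compo cg (@coord_continuous _ _ _ ord0 i)).
Qed.

Lemma continuous_dotp : continuous (fun y : 'rV[R]_n => dotp y y).
Proof. by apply: continuous_dotp2 => x; exact: cvg_id. Qed.

Lemma continuous_dotpl a : continuous (fun y : 'rV[R]_n => dotp a y).
Proof. by apply: continuous_dotp2 => x; [exact: cst_continuous|exact: cvg_id]. Qed.

End directional_derivative.

Section schwartz_functions.
Context (R : realType) (n : nat) (x0 : 'rV[R]_n) (e : R).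
Hypothesis e0 : 0 < e.

(* A syntactic class of functions of polynomial growth that is closed under
   partial derivatives. *)
Inductive expr :=
  | Coord of 'I_n | Const of R | Add of expr & expr | Mul of expr & expr
  | Pow of R | Cos | Sin.

Fixpoint eval (t : expr) (x : 'rV[R]_n) : R :=
  match t with
  | Coord i => x ord0 i
  | Const c => c
  | Add a b => eval a x + eval b x
  | Mul a b => eval a x * eval b x
  | Pow a => (1 + dotp x x) `^ a
  | Cos => cos (dotp x0 x)
  | Sin => sin (dotp x0 x)
  end.

Fixpoint diff (i : 'I_n) (t : expr) : expr :=
  match t with
  | Coord j => Const (j == i)%:R
  | Const _ => Const 0
  | Add a b => Add (diff i a) (diff i b)
  | Mul a b => Add (Mul a (diff i b)) (Mul b (diff i a))
  | Pow a => Mul (Const (2 * a)) (Mul (Coord i) (Pow (a - 1)))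
  | Cos => Mul (Const (- x0 ord0 i)) Sin
  | Sin => Mul (Const (x0 ord0 i)) Cos
  end.

Let base_gt0 (x : 'rV[R]_n) : 0 < 1 + dotp x x.
Proof. by rewrite ltr_pwDl ?dotp_ge0. Qed.

Lemma is_derive_eval i t x : is_derive x (delta_mx ord0 i) (eval t) (eval (diff i t) x).
Proof.
elim: t => [j|c|a IHa b IHb|a IHa b IHb|a| |] /=.
- apply: is_derive_eq; first exact: is_derive_coord.
  by rewrite mxE eqxx eq_sym.
- exact: is_derive_cst.
- exact: (is_deriveD IHa IHb).
- exact: (is_derive_eq (is_deriveM IHa IHb)).
- have d1 : is_derive x (delta_mx ord0 i) (fun y => 1 + dotp y y) (2 * x ord0 i).
    apply: is_derive_eq; first by apply: is_deriveD; exact: is_derive_dotp.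
    by rewrite add0r dotp_delta.
  apply: is_derive_eq; first exact: is_derive_comp (is_derive1_powR a (base_gt0 x)) d1.
  by ring.
- apply: is_derive_eq; first exact: is_derive_comp (is_derive_cos _) (is_derive_dotpl _ _ _).
  by rewrite dotp_delta; ring.
- apply: is_derive_eq; first exact: is_derive_comp (is_derive_sin _) (is_derive_dotpl _ _ _).
  by rewrite dotp_delta; ring.
Qed.

Lemma continuous_eval t : continuous (eval t).
Proof.
elim: t => [j|c|a IHa b IHb|a IHa b IHb|a| |] /=.
- exact: coord_continuous.
- exact: continuous_cst.
- exact: continuous_add.
- exact: continuous_mul.
- move=> x; apply: (@continuous_comp _ _ _ (fun y : 'rV[R]_n => 1 + dotp y y) (fun t => t `^ a) x).
    by apply: continuous_add; [exact: continuous_cst|exact: continuous_dotp].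
  apply: differentiable_continuous; apply/derivable1_diffP.
  by have [] := is_derive1_powR a (base_gt0 x).
- exact: (continuous_compo (@continuous_dotpl _ _ x0) (@continuous_cos R)).
- exact: (continuous_compo (@continuous_dotpl _ _ x0) (@continuous_sin R)).
Qed.

Lemma eval_growth t : exists C m, 0 <= C /\ forall x, `|eval t x| <= C * (1 + dotp x x) ^+ m.
Proof.
have b1 (x : 'rV[R]_n) : 1 <= 1 + dotp x x by rewrite lerDl dotp_ge0.
have b0 (x : 'rV[R]_n) : 0 <= 1 + dotp x x by rewrite ltW.
elim: t => [j|c|a [C1 [m1 [C10 H1]]] b [C2 [m2 [C20 H2]]]|a [C1 [m1 [C10 H1]]] b [C2 [m2 [C20 H2]]]|a| |] /=.
- exists 1, 1%N; split => // x; rewrite mul1r expr1.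
  have := dotp_coord_le x j; rewrite -(real_normK (num_real (x ord0 j))) => h.
  by have := sqr_ge0 (`|x ord0 j| - 1); have := normr_ge0 (x ord0 j); nra.
- by exists `|c|, 0%N; split => // x; rewrite expr0 mulr1.
- exists (C1 + C2), (m1 + m2)%N; split; first by rewrite addr_ge0.
  move=> x; apply: le_trans (ler_normD _ _) _; rewrite mulrDl lerD//.
    apply: le_trans (H1 x) _; rewrite ler_wpM2l// ler_weXn2l// leq_addr//.
  by apply: le_trans (H2 x) _; rewrite ler_wpM2l// ler_weXn2l// leq_addl.
- exists (C1 * C2), (m1 + m2)%N; split; first by rewrite mulr_ge0.
  by move=> x; rewrite normrM exprD mulrACA ler_pM.
- exists 1, (Num.truncn `|a|).+1; split => // x; rewrite mul1r ger0_norm ?powR_ge0//.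
  rewrite -powR_mulrn// ler_powR//; apply: le_trans (ler_norm _) _.
  by rewrite ltW// truncnS_gt.
- by exists 1, 0%N; split => // x; rewrite expr0 mulr1 cos_max.
- by exists 1, 0%N; split => // x; rewrite expr0 mulr1 sin_max.
Qed.

Let E (x : 'rV[R]_n) : R := expR (- e * dotp x x).
(** The partial derivative conjugated by the Gaussian: it acts on the factor [t] alone and stays in
    the class. *)
Let ediff i t := Add (diff i t) (Mul (Const (- 2 * e)) (Mul (Coord i) t)).

Let is_derive_E i t x :
  is_derive x (delta_mx ord0 i) (fun y => E y * eval t y) (E x * eval (ediff i t) x).
Proof.
have d1 : is_derive x (delta_mx ord0 i) (fun y => - e * dotp y y) (- e * (2 * x ord0 i)).
  apply: is_derive_eq; first by apply: is_deriveM; exact: is_derive_dotp.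
  by rewrite dotp_delta /GRing.scale /= mulr0 addr0.
have d2 : is_derive x (delta_mx ord0 i) E (expR (- e * dotp x x) * (- e * (2 * x ord0 i))).
  exact: is_derive_comp (is_derive_expR _) d1.
apply: is_derive_eq; first by apply: is_deriveM d2 (is_derive_eval i t x).
by rewrite /GRing.scale /= /E; ring.
Qed.

Let pderiv_E l t : exists t', pderiv l (fun y => E y * eval t y) = (fun y => E y * eval t' y).
Proof.
elim: l => [|i l [t' IH]]; first by exists t.
exists (ediff i t'); rewrite /= IH; apply/funext => x.
by have H := is_derive_E i t' x; rewrite derive_val.
Qed.

Lemma schwartz_gauss_eval t : schwartz (fun x => expR (- e * dotp x x) * eval t x).
Proof.
rewrite -[X in schwartz X]/(fun x => E x * eval t x); split.
  move=> l; have [t' ->] := pderiv_E l t; split.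
    apply: continuous_mul; last exact: continuous_eval.
    apply: continuous_compo; last exact: continuous_expR.
    by apply: continuous_mul; [exact: continuous_cst|exact: continuous_dotp].
  by move=> i x; have [] := is_derive_E i t' x.
move=> k l; have [t' ->] := pderiv_E l t.
have [C [m [C0 H]]] := eval_growth t'.
(* One term of the exponential series at [z = e * (1 + dotp x x)] bounds the polynomial factor; the
   summand 1 in [z] accounts for [expR e]. *)
exists (C * ((k + m)`!%:R / e ^+ (k + m) * expR e)) => x.
have d0 := dotp_ge0 x.
have b0 : 0 <= 1 + dotp x x by rewrite ltW.
rewrite normrM (ger0_norm (expR_ge0 _)).
have h1 : enorm x ^+ k <= (1 + dotp x x) ^+ k.
  apply: lerXn2r; rewrite ?nnegrE ?enorm_ge0//.
  by rewrite -enorm_sqr; have := sqr_ge0 (enorm x - 1); have := enorm_ge0 x; nra.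
apply: (@le_trans _ _ ((1 + dotp x x) ^+ k * (E x * (C * (1 + dotp x x) ^+ m)))).
  by apply: ler_pM => //; rewrite ?exprn_ge0 ?enorm_ge0 ?mulr_ge0 ?expR_ge0// ler_wpM2l ?expR_ge0.
rewrite [leLHS](_ : _ = C * ((1 + dotp x x) ^+ (k + m) * E x)); last by rewrite exprD; ring.
rewrite ler_wpM2l//.
have z0 : 0 <= e * (1 + dotp x x) by rewrite mulr_ge0// ltW.
have h2 : (e * (1 + dotp x x)) ^+ (k + m) / (k + m)`!%:R <= expR (e * (1 + dotp x x)).
  case: (k + m)%N => [|N]; first by rewrite expr0 divr1 (le_trans _ (expR_ge1Dx _))// lerDl.
  by apply: le_trans (expR_ge1Dxn N z0); rewrite lerDr.
have f0 : 0 < (k + m)`!%:R :> R by rewrite ltr0n fact_gt0.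
have eN : 0 < e ^+ (k + m) by exact: exprn_gt0.
move: h2; rewrite ler_pdivrMr// exprMn mulrDr mulr1 expRD => h2.
rewrite /E mulNr expRN ler_pdivrMr ?expR_gt0//.
rewrite -(ler_pM2l eN) (le_trans h2)// le_eqVlt; apply/orP; left; apply/eqP.
by field; exact: lt0r_neq0.
Qed.

End schwartz_functions.

Section bessel_relation.
Context (R : realType) (n : nat) (s : R).
Hypothesis s0 : 0 < s.
Local Notation mu := (@lebesgue_rV R n).
Local Notation leb := (@lebesgue_measure R).
Implicit Types (u v : 'rV[R]_n -> R).

Let c := (2 * pi : R) ^+ n / 2.

Let c0 : c != 0.
Proof. by rewrite gt_eqF// divr_gt0// exprn_gt0// mulr_gt0// pi_gt0. Qed.

(** The test functions are chosen so that multiplication by the weight leaves a Gaussian times a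
    cosine or sine. One side of the definition then produces heat kernels and the other side
    [bkern], both centred at [x0] and [- x0]. *)
Lemma heatop_bessel u v e x0 : 0 < e -> L2 u -> L2 v -> bessel_potential s u v ->
  heatop e u x0 = \int[leb]_t (rho s t * heatop (t + e) v x0).
Proof.
move=> e0 uL vL [_ uv].
have w0 (x : 'rV[R]_n) : 0 < bessel_weight s x.
  by rewrite /bessel_weight powR_gt0// ltr_pwDl// sqr_ge0.
have wP (x : 'rV[R]_n) : (bessel_weight s x)^-1 = (1 + dotp x x) `^ (- (s / 2)).
  by rewrite powRN /bessel_weight enorm_sqr.
pose A (y : 'rV[R]_n) := \int[mu]_x (u x * heat e (x - y)).
pose B (y : 'rV[R]_n) := \int[mu]_x (v x * bkern s e (x - y)).
have iA y : mu.-integrable setT (EFin \o (fun x => u x * heat e (x - y))).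
  rewrite (_ : EFin \o _ = EFin \o (fun x => heat e (y - x) * u x)); first exact: heatop_integrable.
  by apply/funext => x /=; rewrite heat_sym mulrC.
have iB y := bkern_integrable s0 y e0 vL.
(* Test functions are real, so the translation to [x0] enters through a cosine and a sine. The
   inverse weight is smooth of polynomial growth, so the Gaussian keeps the product Schwartz. *)
pose fc (x : 'rV[R]_n) := expR (- e * dotp x x) * eval x0 (Mul (Pow n (- (s / 2))) (Cos R n)) x.
pose fs (x : 'rV[R]_n) := expR (- e * dotp x x) * eval x0 (Mul (Pow n (- (s / 2))) (Sin R n)) x.
pose E1 (x : 'rV[R]_n) := expR (- e * dotp x x).
pose E2 (x : 'rV[R]_n) := (bessel_weight s x)^-1 * E1 x.
have i1 y : mu.-integrable setT (EFin \o (fun x => E1 x * cos (dotp y x + 0))).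
  exact: integrable_gauss_cos_rV.
have i2 y : mu.-integrable setT (EFin \o (fun x => E2 x * cos (dotp y x + 0))).
  apply: (@integrable_dom _ _ R mu _ (fun x => expR (- e * dotp x x))).
  - by rewrite /E2 /E1 /bessel_weight; meas.
  - by meas.
  - move=> x; rewrite normrM /E2 normrM (ger0_norm (expR_ge0 _)).
    have w1 : `|(bessel_weight s x)^-1| <= 1.
      rewrite ger0_norm ?invr_ge0 ?(ltW (w0 x))// invf_le1//.
      have sq0 := sqr_ge0 (enorm x).
      have h1 : (1 : R) `^ (s / 2) <= (1 + enorm x ^+ 2) `^ (s / 2).
        by apply: ge0_ler_powR; [rewrite divr_ge0// (ltW s0)|rewrite nnegrE|rewrite nnegrE addr_ge0|rewrite lerDl].
      by rewrite powR1 in h1.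
    apply: (@le_trans _ _ (1 * E1 x * 1)); last by rewrite mulr1 mul1r.
    by rewrite ler_pM ?mulr_ge0 ?expR_ge0 ?cos_max// ler_wpM2r ?expR_ge0.
  - by rewrite integral_gauss_rV// ltry.
(* Product-to-sum formula: a cosine factor averages the transform over the shifts by [x0] and
   [- x0]. The factor 1/2 is part of [c]. *)
have fre (G K : 'rV[R]_n -> R) x : (forall y, mu.-integrable setT (EFin \o (fun x => G x * cos (dotp y x + 0)))) ->
  (forall y, \int[mu]_x (G x * cos (dotp y x + 0)) = (2 * pi) ^+ n * K y * cos 0) ->
  fourier_re (fun y => G y * cos (dotp x0 y)) x = c * (K (x - x0) + K (x + x0)).
  move=> iG GK; transitivity (\int[mu]_y (2^-1 * (G y * cos (dotp (x - x0) y + 0) + G y * cos (dotp (x + x0) y + 0)))).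
    apply: eq_Rintegral => y _; rewrite !addr0 dotpDl dotpNl dotpDl cosB cosD (dotpC y x); by field.
  rewrite RintegralZl//; last exact: integrable_add.
  by rewrite RintegralD// !GK cos0 /c; field.
have fim (G K : 'rV[R]_n -> R) x : (forall y, mu.-integrable setT (EFin \o (fun x => G x * cos (dotp y x + 0)))) ->
  (forall y, \int[mu]_x (G x * cos (dotp y x + 0)) = (2 * pi) ^+ n * K y * cos 0) ->
  fourier_im (fun y => G y * sin (dotp x0 y)) x = c * (K (x + x0) - K (x - x0)).
  move=> iG GK; transitivity (\int[mu]_y (2^-1 * (G y * cos (dotp (x + x0) y + 0) - G y * cos (dotp (x - x0) y + 0)))).
    apply: eq_Rintegral => y _; rewrite !addr0 dotpDl dotpDl dotpNl cosB cosD (dotpC y x); by field.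
  rewrite RintegralZl//; last exact: integrable_sub.
  by rewrite RintegralB// !GK cos0 /c; field.
have k1 y : \int[mu]_x (E1 x * cos (dotp y x + 0)) = (2 * pi) ^+ n * heat e y * cos 0.
  exact: heat_fourier.
have k2 y : \int[mu]_x (E2 x * cos (dotp y x + 0)) = (2 * pi) ^+ n * bkern s e y * cos 0.
  by rewrite -fourier_bkern//; apply: eq_Rintegral => x _; rewrite /E2 mulrA.
have ec : fc = (fun y => E2 y * cos (dotp x0 y)).
  by apply/funext => y; rewrite /fc /E2 /E1 /= wP; ring.
have es : fs = (fun y => E2 y * sin (dotp x0 y)).
  by apply/funext => y; rewrite /fs /E2 /E1 /= wP; ring.
have ewc : (fun xi => bessel_weight s xi * fc xi) = (fun y => E1 y * cos (dotp x0 y)).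
  by apply/funext => y; rewrite ec /E2; field; exact: lt0r_neq0.
have ews : (fun xi => bessel_weight s xi * fs xi) = (fun y => E1 y * sin (dotp x0 y)).
  by apply/funext => y; rewrite es /E2; field; exact: lt0r_neq0.
have pm (w : 'rV[R]_n -> R) (K : 'rV[R]_n -> R) :
  (forall y, mu.-integrable setT (EFin \o (fun x => w x * K (x - y)))) ->
  (\int[mu]_x (w x * (c * (K (x - x0) + K (x + x0)))) =
    c * (\int[mu]_x (w x * K (x - x0)) + \int[mu]_x (w x * K (x - - x0)))) /\
  (\int[mu]_x (w x * (c * (K (x + x0) - K (x - x0)))) =
    c * (\int[mu]_x (w x * K (x - - x0)) - \int[mu]_x (w x * K (x - x0)))).
  move=> iw; have a1 := iw x0; have a2 := iw (- x0); split.
    rewrite -(RintegralD measurableT a1 a2) -(RintegralZl _ measurableT (integrable_add a1 a2)).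
    by apply: eq_Rintegral => x _; rewrite opprK; ring.
  rewrite -(RintegralB measurableT a2 a1) -(RintegralZl _ measurableT (integrable_sub a2 a1)).
  by apply: eq_Rintegral => x _; rewrite opprK; ring.
have [uA1 uA2] := pm u (heat e) iA; have [vB1 vB2] := pm v (bkern s e) iB.
have [hc _] := uv fc (schwartz_gauss_eval x0 e0 _).
have [_ hs] := uv fs (schwartz_gauss_eval x0 e0 _).
have e1 : B x0 + B (- x0) = A x0 + A (- x0).
  apply: (mulfI c0); rewrite -uA1 -vB1; move: hc; rewrite ewc ec.
  under eq_Rintegral do rewrite (fre _ _ _ i2 k2).
  by under [RHS]eq_Rintegral do rewrite (fre _ _ _ i1 k1).
have e2 : B (- x0) - B x0 = A (- x0) - A x0.
  apply: (mulfI c0); rewrite -uA2 -vB2; move: hs; rewrite ews es.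
  under eq_Rintegral do rewrite (fim _ _ _ i2 k2).
  by under [RHS]eq_Rintegral do rewrite (fim _ _ _ i1 k1).
(* The sum and the difference of the values at [x0] and [- x0] determine the value at [x0]. *)
have e3 : B x0 = A x0.
  by move: e1 e2; move: (B x0) (B (- x0)) (A x0) (A (- x0)) => p q r w; clear; lra.
rewrite -(bkern_conv s0 x0 e0 vL) -[RHS]/(B x0) e3.
by apply: eq_Rintegral => x _; rewrite heat_sym mulrC.
Qed.

End bessel_relation.

(** * Borel sets and Lipschitz energies *)

Section iterated_le.
Context d1 d2 (T1 : measurableType d1) (T2 : measurableType d2) (R : realType).
Variable m1 : {sigma_finite_measure set T1 -> \bar R}.
Variable m2 : {sigma_finite_measure set T2 -> \bar R}.

Lemma le_int2 (f g : T1 -> T2 -> R) :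
  measurable_fun setT (fun z : T1 * T2 => f z.1 z.2) -> measurable_fun setT (fun z : T1 * T2 => g z.1 z.2) ->
  (forall x y, 0 <= f x y) -> (forall x y, f x y <= g x y) ->
  (\int[m1]_x \int[m2]_y (f x y)%:E <= \int[m1]_x \int[m2]_y (g x y)%:E)%E.
Proof.
move=> mf mg f0 fg; have g0 x y : 0 <= g x y by exact: le_trans (fg x y).
have mf2 x : measurable_fun setT (f x).
  exact: (measurableT_comp mf (@pair1_measurable _ _ T1 T2 x)).
have mg2 x : measurable_fun setT (g x).
  exact: (measurableT_comp mg (@pair1_measurable _ _ T1 T2 x)).
apply: ge0_le_integral => //.
- by move=> x _; exact: int_ge0.
- exact: (@measurable_int2 _ _ T1 _ _ m2 f).
- exact: (@measurable_int2 _ _ T1 _ _ m2 g).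
- by move=> x _; exact: le_int.
Qed.

Lemma intZl2 (f : T1 -> T2 -> R) (c : R) : 0 <= c ->
  measurable_fun setT (fun z : T1 * T2 => f z.1 z.2) -> (forall x y, 0 <= f x y) ->
  (\int[m1]_x \int[m2]_y (c * f x y)%:E = c%:E * \int[m1]_x \int[m2]_y (f x y)%:E)%E.
Proof.
move=> c0 mf f0; rewrite -ge0_integralZl_EFin//.
- apply: eq_integral => x _; apply: intZl => //.
  exact: (measurableT_comp mf (@pair1_measurable _ _ T1 T2 x)).
- by move=> x _; exact: int_ge0.
- exact: (@measurable_int2 _ _ T1 _ _ m2 f).
Qed.

End iterated_le.

Section borel_rV.
Context (R : realType) (n : nat).
Local Notation mu := (@lebesgue_rV R n).

Lemma measurable_cube (c : 'rV[R]_n) (r : R) :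
  measurable [set x : 'rV[R]_n | forall i, `|x ord0 i - c ord0 i| < r].
Proof.
rewrite [X in measurable X](_ : _ = ~` \bigcup_i [set x : 'rV[R]_n | r <= `|x ord0 i - c ord0 i|]); last first.
  apply/seteqP; split=> [x /= H [i _ /=]|x H i /=]; first by rewrite leNgt H.
  by rewrite ltNge; apply/negP => h; apply: H; exists i.
apply: measurableC; apply: countable_bigcupT_measurable; first exact: countableP.
move=> i; have m : measurable_fun setT (fun x : 'rV[R]_n => `|x ord0 i - c ord0 i|) by meas.
have := m measurableT _ (measurable_itv `[r, +oo[); rewrite setTI.
by congr measurable; apply/seteqP; split => x /=; rewrite in_itv/= andbT.
Qed.

(** The sigma-algebra is generated by the coordinates. An open set is the countable union of the
    cubes with rational centre and radius [1 / (k + 1)] that it contains. *)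
Lemma open_measurable_rV (U : set 'rV[R]_n) : open U -> measurable U.
Proof.
move=> oU; pose cb (q : 'rV[rat]_n * nat) := [set x : 'rV[R]_n |
  forall i, `|x ord0 i - (map_mx ratr q.1 : 'rV[R]_n) ord0 i| < q.2.+1%:R^-1].
pose F q := if `[< cb q `<=` U >] then cb q else set0.
suff -> : U = \bigcup_q F q.
  apply: countable_bigcupT_measurable; first exact: countableP.
  by move=> q; rewrite /F; case: ifP => _; [exact: measurable_cube|exact: measurable0].
apply/seteqP; split => [x Ux|x [q _]]; last by rewrite /F; case: asboolP => // H /H.
have /nbhs_ballP[e /= e0 xe] : nbhs x U by exact: open_nbhs_nbhs.
(* Radius below [e / 2]: a cube whose centre is that close to [x] lies in the ball of radius [e]
   around [x]. *)
have [N _ HN] := near_infty_natSinv_lt (PosNum (divr_gt0 e0 (ltr0n _ 2))).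
have {}HN := HN N (leqnn _).
have qP i : exists q : rat, `|x ord0 i - ratr q| < N.+1%:R^-1.
  have N0 : 0 < N.+1%:R^-1 :> R by rewrite invr_gt0.
  have xN : x ord0 i < N.+1%:R^-1 + x ord0 i by rewrite ltrDr.
  have [q] := rat_in_itvoo xN; rewrite in_itv/= => /andP[h1 h2]; exists q; rewrite distrC ger0_norm ?subr_ge0 ?ltW//.
  by rewrite ltrBlDr.
pose q : 'rV[rat]_n := \row_i xchoose (qP i).
exists (q, N) => //; rewrite /F; case: asboolP => [_ i|]; first by rewrite !mxE /=; exact: xchooseP (qP i).
case=> y /= Hy; apply: xe; split => // i j; rewrite (ord1 i) {i}.
have := Hy j; rewrite !mxE /= => h1; have := xchooseP (qP j) => h2.
have /= {}HN := HN.
rewrite /ball/= -(subrKA (ratr (xchoose (qP j)))) (le_lt_trans (ler_normD _ _))//.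
rewrite (splitr e) ltrD//; first by apply: lt_trans HN.
by rewrite distrC; apply: lt_trans HN.
Qed.

Lemma continuous_measurable_rV (f : 'rV[R]_n -> R) : continuous f -> measurable_fun setT f.
Proof.
move=> cf; apply: (measurability _ (@RGenOpens.measurableE R)) => _ [_ [a [b ->] <-]].
rewrite setTI; apply: open_measurable_rV.
by move/continuousP: cf; apply; exact: interval_open.
Qed.

Lemma norm_sqr_le_dotp (x : 'rV[R]_n) : `|x| ^+ 2 <= dotp x x.
Proof.
have [->|x0] := eqVneq `|x| 0; first by rewrite expr0n dotp_ge0.
have [i E] := mx_norm_neq0 x0; rewrite (E : `|x| = _) (ord1 i.1) real_normK ?num_real//.
exact: dotp_coord_le.
Qed.

Lemma coord_le_norm (x : 'rV[R]_n) i : `|x ord0 i| <= `|x|.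
Proof. by rewrite [leRHS]mx_normrE (le_trans _ (le_bigmax _ _ (ord0, i))). Qed.

Lemma dotp_le_norm (x : 'rV[R]_n) : dotp x x <= n%:R * `|x| ^+ 2.
Proof.
apply: (@le_trans _ _ (\sum_(i < n) `|x| ^+ 2)).
  apply: ler_sum => i _; rewrite -expr2 -(real_normK (num_real _)) lerXn2r ?nnegrE//.
  exact: coord_le_norm.
by rewrite sumr_const card_ord mulr_natl.
Qed.

Lemma integral_energy_weight t (k : 'rV[R]_n -> R) : 0 < t -> measurable_fun setT k -> (forall x, 0 <= k x) ->
  (\int[mu]_x \int[mu]_y (heat t (x - y) * (k x + k y))%:E = 2%:E * \int[mu]_x (k x)%:E)%E.
Proof.
move=> t0 mk k0.
have mh : measurable_fun setT (fun z : 'rV[R]_n * 'rV[R]_n => heat t (z.1 - z.2)).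
  by apply: measurable_fun_heat; meas.
have mh1 x : measurable_fun setT (fun y : 'rV[R]_n => heat t (x - y)).
  by apply: measurable_fun_heat; meas.
have h0 := @heat_ge0 R n.
transitivity (\int[mu]_x ((k x)%:E + \int[mu]_y (heat t (x - y) * k y)%:E))%E.
  apply: eq_integral => x _; have := mh1 x => mhx.
  rewrite -[in RHS](mule1 (k x)%:E) -(integral_heat_sub' x t0) -intZl//.
  rewrite -intD; [|by meas|by meas|by move=> y; rewrite mulr_ge0|by move=> y; rewrite mulr_ge0].
  by apply: eq_integral => y _; congr EFin; ring.
rewrite ge0_integralD//; [|by move=> x _; rewrite lee_fin|exact/measurable_EFinP| |]; last 2 first.
- by move=> x _; apply: int_ge0 => y; rewrite mulr_ge0.
- apply: (@measurable_int2 _ _ 'rV[R]_n _ _ mu (fun x y => heat t (x - y) * k y)).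
    by meas.
  by move=> x y; rewrite mulr_ge0.
by rewrite integral_heat_conv// -mule2n mule_natl.
Qed.

(** [dotp_heat_le] trades the squared distance for a factor [t]; the integrable weight [k] localises
    the Lipschitz bound so that the remaining integral is finite. *)
Lemma heat_energy_lipschitz (f k : 'rV[R]_n -> R) : measurable_fun setT f -> measurable_fun setT k ->
  (forall x, 0 <= k x) -> (\int[mu]_x (k x)%:E < +oo)%E ->
  (forall x y, (f x - f y) ^+ 2 <= dotp (x - y) (x - y) * (k x + k y)) ->
  exists2 C : R, 0 <= C & forall t, 0 < t ->
    (\int[mu]_x \int[mu]_y (heat t (x - y) * (f x - f y) ^+ 2)%:E <= (C * t)%:E)%E.
Proof.
move=> mf mk k0 ky fk; pose K : R := 2 `^ (n%:R / 2) * 8.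
have K0 : 0 <= K by rewrite mulr_ge0 ?powR_ge0.
have ik : (\int[mu]_x (k x)%:E = (\int[mu]_x k x)%:E)%E.
  by rewrite EFin_Rintegral//; exact: ge0_integral_Rintegral.
exists (K * 2 * \int[mu]_x k x).
  by rewrite !mulr_ge0//; apply: Rintegral_ge0.
move=> t t0; have t20 : 0 < 2 * t by exact: mulr_gt0.
have mh r : measurable_fun setT (fun z : 'rV[R]_n * 'rV[R]_n => heat r (z.1 - z.2)).
  by apply: measurable_fun_heat; meas.
have mh1 := mh t; have mh2 := mh (2 * t); have h0 := @heat_ge0 R n.
have kk x y : 0 <= k x + k y by rewrite addr_ge0.
apply: (@le_trans _ _ (\int[mu]_x \int[mu]_y (K * t * (heat (2 * t) (x - y) * (k x + k y)))%:E)%E).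
  apply: le_int2; [by meas|by meas|by move=> x y; rewrite mulr_ge0 ?sqr_ge0|] => x y.
  apply: (le_trans (ler_wpM2l (h0 t (x - y)) (fk x y))).
  by have := ler_wpM2r (kk x y) (dotp_heat_le (x - y) t0); rewrite -/K; lra.
have Kt : 0 <= K * t by rewrite mulr_ge0// ltW.
rewrite (@intZl2 _ _ _ _ _ mu mu (fun x y => heat (2 * t) (x - y) * (k x + k y)))//; [|by meas|by move=> x y; rewrite mulr_ge0].
rewrite integral_energy_weight// ik -!EFinM lee_fin le_eqVlt; apply/orP; left; apply/eqP; ring.
Qed.

(* [P_e (f + c g) = P_e f], so that contraction gives
   [|P_e f|^2 <= |f|^2 + 2 c <f, g> + c^2 |g|^2] for all [c]; then [e] tends to 0. *)
Lemma heatop0_orth g f (C : R) : (forall e x, 0 < e -> heatop e g x = 0) -> L2 g -> L2 f -> 0 <= C ->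
  (forall t, 0 < t -> (\int[mu]_x \int[mu]_y (heat t (x - y) * (f x - f y) ^+ 2)%:E <= (C * t)%:E)%E) ->
  \int[mu]_x (f x * g x) = 0.
Proof.
move=> g0 gL fL C0 fC; have [mg _] := gL; have [mf _] := fL; set I := \int[mu]_x _.
have S0 := sqnorm_ge0 g; set S := sqnorm g in S0 *.
have key (c e : R) : 0 < e -> 0 <= C * e + (2 * c * I + c ^+ 2 * S).
  move=> e0; have e20 : 0 < 2 * e by exact: mulr_gt0.
  have i1 := L2_integrable_sqr fL; have i2 := L2_integrable_mul fL gL; have i3 := L2_integrable_sqr gL.
  have hL : L2 (fun x => f x + c * g x).
    split; first by meas.
    have : mu.-integrable setT (EFin \o (fun x => f x ^+ 2 + (2 * c * (f x * g x) + c ^+ 2 * g x ^+ 2))).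
      by apply: integrable_add => //; apply: integrable_add; exact: integrable_mull.
    move=> /integrableP[_]; apply: le_lt_trans; apply: ge0_le_integral => //.
    - by move=> x _; rewrite lee_fin sqr_ge0.
    - by apply/measurable_EFinP; meas.
    - by apply/measurable_EFinP; apply: measurable_fun_normr; meas.
    - by move=> x _; rewrite lee_fin (le_trans _ (ler_norm _))// le_eqVlt; apply/orP; left; apply/eqP; ring.
  have hh : sqnorm (heatop e (fun x => f x + c * g x)) = sqnorm (heatop e f).
    congr sqnorm; apply/funext => x.
    have j1 := heatop_integrable x e0 fL; have j2 := heatop_integrable x e0 gL.
    transitivity (\int[mu]_y (heat e (x - y) * f y + c * (heat e (x - y) * g y))).
      by apply: eq_Rintegral => y _; ring.
    rewrite (RintegralD measurableT j1 (integrable_mull c j2)) (RintegralZl c measurableT j2).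
    by rewrite -/(heatop e g x) g0// mulr0 addr0.
  have eh : sqnorm (fun x => f x + c * g x) = sqnorm f + (2 * c * I + c ^+ 2 * S).
    transitivity (\int[mu]_x (f x ^+ 2 + (2 * c * (f x * g x) + c ^+ 2 * g x ^+ 2))).
      by apply: eq_Rintegral => x _; ring.
    rewrite (RintegralD measurableT i1 (integrable_add (integrable_mull (2 * c) i2) (integrable_mull (c ^+ 2) i3))).
    rewrite (RintegralD measurableT (integrable_mull (2 * c) i2) (integrable_mull (c ^+ 2) i3)).
    by rewrite (RintegralZl _ measurableT i2) (RintegralZl _ measurableT i3).
  have := heatop_contract e0 hL; rewrite hh eh.
  have := fC _ e20; rewrite heat_energyE// lee_fin (_ : 2 * e / 2 = e); last by field.
  move: (sqnorm f) (sqnorm (heatop e f)) => a b; clear -C0 e0; move: (2 * c * I + _) => z; nra.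
apply/eqP; apply: contraT => I0.
(* [c = - I / (S + 1)] is close to the minimiser of the quadratic and avoids a division by 0. The
   quadratic is then below [- q], and the choice of [e] keeps [C * e] below [q / 2]. *)
pose q := I ^+ 2 / (S + 1); have S1 : 0 < S + 1 by rewrite ltr_wpDl.
have C1 : 0 < C + 1 by rewrite ltr_wpDl.
have q0 : 0 < q by rewrite divr_gt0// exprn_even_gt0.
have qC : 0 < q / (2 * (C + 1)) by rewrite divr_gt0// mulr_gt0.
have := key (- I / (S + 1)) _ qC.
have -> : 2 * (- I / (S + 1)) * I = - (2 * q) by rewrite /q; field; exact: lt0r_neq0.
have -> : (- I / (S + 1)) ^+ 2 * S = q - q / (S + 1) by rewrite /q; field; exact: lt0r_neq0.
have -> : C * (q / (2 * (C + 1))) = q / 2 - q / (2 * (C + 1)) by field; exact: lt0r_neq0.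
have h1 : 0 < q / (S + 1) by exact: divr_gt0.
lra.
Qed.

End borel_rV.

Section density.
Context d (T : measurableType d) (R : realType) (mu : {measure set T -> \bar R}).
Variable f : T -> \bar R.
Hypothesis mf : measurable_fun setT f.
Hypothesis f0 : forall x, (0 <= f x)%E.

(** Packaged as a measure so that uniqueness of measures on a generating class applies to the
    positive and negative parts of a function. *)
Definition density (A : set T) : \bar R := (\int[mu]_(x in A) f x)%E.

Let density0 : density set0 = 0%E.
Proof. by rewrite /density integral_set0. Qed.

Let density_ge0 A : (0 <= density A)%E.
Proof. by apply: integral_ge0 => x _. Qed.

Let density_sigma_additive : semi_sigma_additive density.
Proof.
move=> F mF tF mUF; rewrite /density ge0_integral_bigcup//.
  by apply: is_cvg_nneseries => k _ _; exact: density_ge0.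
exact: measurable_funTS.
Qed.

HB.instance Definition _ := isMeasure.Build _ _ _ density density0 density_ge0 density_sigma_additive.

Definition density_measure : {measure set T -> \bar R} := density.

End density.

(** * Uniqueness for the heat semigroup *)

Section tents.
Context (R : realType) (n : nat).
Local Notation mu := (@lebesgue_rV R n).
Implicit Types d : 'rV[R]_n -> R.

Lemma measurable_norm_rV : measurable_fun setT (fun x : 'rV[R]_n => `|x|).
Proof. by apply: continuous_measurable_rV; exact: norm_continuous. Qed.

Lemma measurable_norm_lt (N : R) : measurable [set x : 'rV[R]_n | `|x| < N].
Proof.
have := measurable_norm_rV measurableT (measurable_itv `]-oo, N[); rewrite setTI.
by congr measurable; apply/seteqP; split => x /=; rewrite in_itv.
Qed.

Definition lipschitz_ge0 d := [/\ measurable_fun setT d, forall x, 0 <= d x &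
  exists2 L : R, 0 <= L & forall x y, `|d x - d y| <= L * `|x - y|].

(** Tents take the place of test functions in the uniqueness proof: they are stable under minima,
    their heat energy is of order [t], and their positivity sets generate the sigma-algebra. *)
Definition tent d := lipschitz_ge0 d /\ exists2 N : R, 0 <= N & forall x, N <= `|x| -> d x = 0.

Lemma lipschitz_ge0_cst (c : R) : 0 <= c -> lipschitz_ge0 (fun=> c).
Proof.
by move=> c0; split => //; exists 0 => // x y; rewrite subrr normr0 mul0r.
Qed.

Lemma lipschitz_ge0_scale (c : R) d : 0 <= c -> lipschitz_ge0 d -> lipschitz_ge0 (fun x => c * d x).
Proof.
move=> c0 [md d0 [L L0 dL]]; split; [by meas|by move=> x; exact: mulr_ge0|].
exists (c * L); first exact: mulr_ge0.
by move=> x y; rewrite -mulrBr normrM (ger0_norm c0) -mulrA ler_wpM2l.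
Qed.

Lemma lipschitz_ge0_max (f : 'rV[R]_n -> R) : measurable_fun setT f ->
  (forall x y, `|f x - f y| <= `|x - y|) -> lipschitz_ge0 (fun x => Num.max 0 (f x)).
Proof.
move=> mf fL; split; first by apply: measurable_maxr.
- by move=> x; rewrite le_max lexx.
- exists 1 => // x y; rewrite mul1r; apply: le_trans (fL x y).
  have := ler_norm (f x - f y); have := ler_norm (- (f x - f y)); rewrite normrN ler_norml.
  by rewrite /Num.max; case: ltP => hx; case: ltP => hy h1 h2; apply/andP; split; lra.
Qed.

Lemma lipschitz_ge0_min d d' : lipschitz_ge0 d -> lipschitz_ge0 d' ->
  lipschitz_ge0 (fun x => Num.min (d x) (d' x)).
Proof.
move=> [md d0 [L L0 dL]] [md' d0' [L' L0' dL']]; split; first exact: measurable_minr.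
- by move=> x; rewrite le_min d0 d0'.
- exists (L + L'); first exact: addr_ge0.
  move=> x y; have := dL x y; have := dL' x y; rewrite mulrDl.
  have := mulr_ge0 L0 (normr_ge0 (x - y)); have := mulr_ge0 L0' (normr_ge0 (x - y)).
  move: (L * _) (L' * _) => a b; rewrite !ler_norml /Num.min.
  by case: ltP => hx; case: ltP => hy; move=> ? ? /andP[? ?] /andP[? ?]; lra.
Qed.

Lemma tent_min d d' : lipschitz_ge0 d -> tent d' -> tent (fun x => Num.min (d x) (d' x)).
Proof.
move=> dl [dl' [N N0 dN]]; split; first exact: lipschitz_ge0_min.
exists N => // x /dN ->; apply/min_idPr; by case: dl.
Qed.

Lemma tent_cut (N : R) : 0 <= N -> tent (fun x => Num.max 0 (N - `|x|)).
Proof.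
move=> N0; split; last by exists N => // x xN; apply/max_idPl; rewrite subr_le0.
apply: lipschitz_ge0_max.
  by have := measurable_norm_rV => ?; meas.
by move=> x y; rewrite (_ : N - `|x| - _ = `|y| - `|x|); [rewrite [leRHS]distrC ler_dist_dist|ring].
Qed.

Lemma lipschitz_ge0_coord i (a : R) : lipschitz_ge0 (fun x => Num.max 0 (x ord0 i - a)).
Proof.
apply: lipschitz_ge0_max; first by meas.
move=> x y; rewrite (_ : _ - _ = x ord0 i - y ord0 i); last by ring.
by have := coord_le_norm (x - y) i; rewrite !mxE.
Qed.

(** An integrable function that is at least 1 where [|x| <= N]; a Gaussian serves because its
    integral is known. *)
Definition cube_weight (N : R) (x : 'rV[R]_n) : R := expR (n%:R * N ^+ 2) * expR (- 1 * dotp x x).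

Lemma cube_weight_ge0 N x : 0 <= cube_weight N x.
Proof. by rewrite mulr_ge0 ?expR_ge0. Qed.

Lemma cube_weight_ge1 N x : `|x| <= N -> 1 <= cube_weight N x.
Proof.
move=> xN; rewrite /cube_weight -expRD -[leLHS]expR0 ler_expR mulN1r subr_ge0.
rewrite (le_trans (dotp_le_norm x))// ler_wpM2l// lerXn2r ?nnegrE//.
exact: le_trans xN.
Qed.

Lemma measurable_cube_weight N : measurable_fun setT (cube_weight N).
Proof. by rewrite /cube_weight; meas. Qed.

Lemma integral_cube_weight N : (\int[mu]_x (cube_weight N x)%:E < +oo)%E.
Proof.
rewrite /cube_weight intZl; [|by meas|by move=> x; exact: expR_ge0|exact: expR_ge0].
by rewrite integral_gauss_rV// -EFinM ltry.
Qed.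

Lemma tent_bounded d : tent d -> exists2 M : R, 0 <= M & forall x, d x <= M.
Proof.
move=> [[_ d0 [L L0 dL]] [N N0 dN]]; exists (d 0 + L * N); first by rewrite addr_ge0// mulr_ge0.
move=> x; have [xN|xN] := ltP `|x| N; last by rewrite dN// addr_ge0// mulr_ge0.
rewrite -lerBlDl (le_trans (ler_norm _))// (le_trans (dL _ _))// subr0 ler_wpM2l//.
exact: ltW.
Qed.

Lemma tent_L2 d : tent d -> L2 d.
Proof.
move=> td; have [[md d0 _] [N N0 dN]] := td; have [M M0 dM] := tent_bounded td.
split => //; apply: (@le_lt_trans _ _ (\int[mu]_x (M ^+ 2 * cube_weight N x)%:E)%E).
  have := measurable_cube_weight N => ?.
  apply: le_int; [by meas|by meas|by move=> x; exact: sqr_ge0|] => x.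
  have w0 := cube_weight_ge0 N x.
  have [xN|xN] := ltP N `|x|; first by rewrite dN ?(ltW xN)// expr0n mulr_ge0// sqr_ge0.
  rewrite (@le_trans _ _ (M ^+ 2))//; first by rewrite lerXn2r ?nnegrE.
  by rewrite ler_peMr ?sqr_ge0// cube_weight_ge1.
have := measurable_cube_weight N => ?.
rewrite intZl; [|by []|exact: cube_weight_ge0|exact: sqr_ge0].
by rewrite lte_mul_pinfty ?lee_fin ?sqr_ge0// integral_cube_weight.
Qed.

(** The Lipschitz bound matters only if one of the two points has norm at most [N], and there the
    weight is at least 1; otherwise both values vanish. *)
Lemma tent_energy d : tent d -> exists2 C : R, 0 <= C & forall t, 0 < t ->
  (\int[mu]_x \int[mu]_y (heat t (x - y) * (d x - d y) ^+ 2)%:E <= (C * t)%:E)%E.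
Proof.
move=> [[md d0 [L L0 dL]] [N N0 dN]]; have := measurable_cube_weight N => ?.
apply: (@heat_energy_lipschitz _ _ d (fun x => L ^+ 2 * cube_weight N x)) => //; [by meas| | |].
- by move=> x; rewrite mulr_ge0 ?sqr_ge0 ?cube_weight_ge0.
- rewrite intZl; [|by []|exact: cube_weight_ge0|exact: sqr_ge0].
  by rewrite lte_mul_pinfty ?lee_fin ?sqr_ge0// integral_cube_weight.
- move=> x y; rewrite -mulrDr mulrA (mulrC (dotp _ _)).
  have wx := cube_weight_ge0 N x; have wy := cube_weight_ge0 N y.
  have d20 := dotp_ge0 (x - y); have L20 := sqr_ge0 L.
  have main : (d x - d y) ^+ 2 <= L ^+ 2 * dotp (x - y) (x - y).
    rewrite -(real_normK (num_real _)); apply: (@le_trans _ _ ((L * `|x - y|) ^+ 2)).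
      by rewrite lerXn2r ?nnegrE ?mulr_ge0.
    by rewrite exprMn ler_wpM2l// norm_sqr_le_dotp.
  have [xN|xN] := leP `|x| N.
    by rewrite (le_trans main)// ler_peMr ?mulr_ge0// ler_wpDr// cube_weight_ge1.
  have [yN|yN] := leP `|y| N.
    by rewrite (le_trans main)// ler_peMr ?mulr_ge0// ler_wpDl// cube_weight_ge1.
  rewrite (dN _ (ltW xN)) (dN _ (ltW yN)) subrr expr0n /=.
  by apply: mulr_ge0; [exact: mulr_ge0|exact: addr_ge0].
Qed.

Definition tent_sets := [set A : set 'rV[R]_n | exists2 d, tent d & A = [set x | 0 < d x]].

Lemma tent_sets_setI : setI_closed tent_sets.
Proof.
move=> _ _ [d [dl _] ->] [d' td' ->]; exists (fun x => Num.min (d x) (d' x)); first exact: tent_min.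
by apply/seteqP; split => x /=; rewrite lt_min; [case=> -> ->|move=> /andP[]].
Qed.

Lemma tent_sets_cut (k : nat) : tent_sets [set x | `|x| < k%:R].
Proof.
exists (fun x => Num.max 0 (k%:R - `|x|)); first exact: tent_cut.
by apply/seteqP; split => x /=; rewrite lt_max ltxx subr_gt0.
Qed.

(** The half-space where coordinate [i] exceeds [a] is a countable union of positivity sets of
    tents: cut the positive part of the coordinate minus [a] off at radius [k]. *)
Lemma measurable_tent_sets : @measurable _ 'rV[R]_n = <<s tent_sets >>.
Proof.
apply/seteqP; split => [A mA|]; last first.
  apply: smallest_sub; first exact: sigma_algebra_measurable.
  move=> _ [d [[md _ _] _] ->].
  have := md measurableT _ (measurable_itv `]0, +oo[); rewrite setTI.
  by congr measurable; apply/seteqP; split => x /=; rewrite in_itv/= andbT.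
have mid : measurable_fun setT (id : g_sigma_algebraType tent_sets -> 'rV[R]_n).
  apply: measurable_fun_rVP => i; apply: (measurability _ (RGenOInfty.measurableE R)) => _ [_ [a ->] <-].
  rewrite setTI; pose F k := [set x : 'rV[R]_n | 0 < Num.min (Num.max 0 (x ord0 i - a)) (Num.max 0 (k%:R - `|x|))].
  rewrite [X in measurable X](_ : _ = \bigcup_k F k).
    apply: bigcupT_measurable => k; apply: sub_sigma_algebra.
    eexists; last by reflexivity.
    by apply: tent_min; [exact: lipschitz_ge0_coord|exact: tent_cut].
  apply/seteqP; split => x /=; rewrite in_itv/= andbT.
    move=> ax; exists (Num.truncn `|x|).+1 => //; rewrite /F /= lt_min !lt_max !ltxx !subr_gt0 ax/=.
    by rewrite truncnS_gt.
  by move=> [k _]; rewrite /F /= lt_min !lt_max !ltxx !subr_gt0 => /andP[].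
by have := mid measurableT A mA; rewrite setTI.
Qed.

End tents.

Section heatop_uniqueness.
Context (R : realType) (n : nat).
Local Notation mu := (@lebesgue_rV R n).
Variable g : 'rV[R]_n -> R.
Hypothesis gL : L2 g.
Hypothesis g0 : forall e x, 0 < e -> heatop e g x = 0.

Let mg : measurable_fun setT g := gL.1.

Let cube_integrable N : mu.-integrable [set x | `|x| < N] (EFin \o g).
Proof.
have mN : measurable [set x : 'rV[R]_n | `|x| < N].
  exact: measurable_norm_lt.
have mw := @measurable_cube_weight R n N.
have i1 : mu.-integrable setT (EFin \o (fun x => g x ^+ 2 + cube_weight N x)).
  apply: integrable_add; first exact: L2_integrable_sqr.
  apply: ge0_integral_Rintegral => //; first exact: cube_weight_ge0.
  exact: integral_cube_weight.
apply: (le_integrable mN _ _ (integrableS measurableT mN (@subsetT _ _) i1)).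
  by apply/measurable_EFinP; exact: measurable_funTS.
move=> x /= xN; rewrite lee_fin (le_trans _ (ler_norm _))//.
have := cube_weight_ge1 (ltW xN); rewrite -(real_normK (num_real (g x))).
have := sqr_ge0 (`|g x| - 1); nra.
Qed.

(** The tents [min(1, k * d)] converge to the indicator of the set where [d > 0]. Each is orthogonal
    to [g] by [heatop0_orth], and dominated convergence, with [|g|] integrable on the bounded set
    [A], gives the limit. *)
Let tent_integral A : tent_sets A -> mu.-integrable A (EFin \o g) /\ (\int[mu]_(x in A) (g x)%:E = 0)%E.
Proof.
move=> tA; have mA : measurable A by rewrite measurable_tent_sets; exact: sub_sigma_algebra.
have [d td AE] := tA; have [dl [N N0 dN]] := td; have [md d0 _] := dl.
have Ai : mu.-integrable A (EFin \o g).
  apply: integrableS (cube_integrable N) => //.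
    exact: measurable_norm_lt.
  by rewrite AE => x /= dx; rewrite ltNge; apply/negP => /dN dx0; rewrite dx0 ltxx in dx.
split => //.
pose psi (k : nat) x := Num.min 1 (k%:R * d x).
have tpsi k : tent (psi k).
  apply: tent_min; first exact: lipschitz_ge0_cst.
  split; first exact: lipschitz_ge0_scale.
  by exists N => // x /dN ->; rewrite mulr0.
have psi0 k : (\int[mu]_(x in A) (psi k x * g x)%:E = 0)%E.
  have [C C0 HC] := tent_energy (tpsi k).
  have := heatop0_orth g0 gL (tent_L2 (tpsi k)) C0 HC => h.
  have ip := L2_integrable_mul (tent_L2 (tpsi k)) gL.
  rewrite integral_mkcond -[RHS]/(0%:E) -h EFin_Rintegral//; apply: eq_integral => x _.
  rewrite patchE; case: ifPn => // /negP xA; have : d x = 0.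
    apply/eqP; rewrite eq_le d0 andbT leNgt; apply/negP => dx; apply: xA.
    by rewrite inE AE.
  by move=> dx; rewrite /psi dx mulr0 /Num.min ltr10 mul0r.
have mp k : measurable_fun A (fun x => (psi k x * g x)%:E).
  by apply: measurable_funTS; apply/measurable_EFinP; have [[? _ _] _] := tpsi k; meas.
have gabs : mu.-integrable A (fun x => `|(g x)%:E|%E) by exact: integrable_abse.
have := @dominated_cvg _ _ _ mu A mA (fun k x => (psi k x * g x)%:E) (EFin \o g) (fun x => `|(g x)%:E|%E) mp _ _ gabs _.
have h1 x : A x -> (fun k => (psi k x * g x)%:E) @ \oo --> (g x)%:E.
  rewrite AE => /= dx; apply: cvg_near_cst; exists (Num.truncn (d x)^-1).+1 => // k /= hk.
  suff -> : psi k x = 1 by rewrite mul1r.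
  apply/min_idPl; rewrite -ler_pdivrMr// mul1r (le_trans (ltW (truncnS_gt _)))//.
  by rewrite ler_nat.
have h2 x : A x -> `|(g x)%:E|%E \is a fin_num by [].
have h3 k x : A x -> (`|(psi k x * g x)%:E| <= `|(g x)%:E|)%E.
  move=> _; rewrite lee_fin normrM ler_piMl//; have [[_ p0 _] _] := tpsi k.
  by rewrite ger0_norm// ge_min lexx.
move=> /(_ h1 h2 h3); under eq_cvg do rewrite psi0.
by move=> /cvg_lim <-//; rewrite lim_cst.
Qed.

(** The positive and negative parts of [g] are densities of two measures that agree on the tent
    sets, which are stable under intersection, hence on all measurable sets. Evaluation where
    [g > 0] and where [g < 0] shows that both parts have integral 0. *)
Lemma heatop0_ae0 : \forall x \ae mu, g x = 0.
Proof.
pose p x := (Num.max (g x) 0)%:E; pose m x := (Num.max (- g x) 0)%:E.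
have mp : measurable_fun setT p.
  by apply/measurable_EFinP; apply: measurable_maxr.
have mm : measurable_fun setT m.
  by apply/measurable_EFinP; apply: measurable_maxr => //; meas.
have p0 x : (0 <= p x)%E by rewrite lee_fin le_max lexx orbT.
have m0 x : (0 <= m x)%E by rewrite lee_fin le_max lexx orbT.
have pE : ((EFin \o g)^\+ = p)%E by apply/funext => x; rewrite funepos.unlock /p EFin_max.
have mE : ((EFin \o g)^\- = m)%E by apply/funext => x; rewrite funeneg.unlock /m EFin_max.
pose P := density_measure mu mp p0; pose M := density_measure mu mm m0.
have PM A : measurable A -> P A = M A.
  apply: (measure_unique (@tent_sets R n) (fun k => [set x | `|x| < k%:R])).
  - exact: measurable_tent_sets.
  - exact: tent_sets_setI.
  - exact: tent_sets_cut.
  - apply/seteqP; split => // x _; exists (Num.truncn `|x|).+1 => //=.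
    exact: truncnS_gt.
  - move=> B tB; have [Bi B0] := tent_integral tB.
    have mB : measurable B by rewrite measurable_tent_sets; exact: sub_sigma_algebra.
    have fp := integrable_pos_fin_num mB Bi; have fn := integrable_neg_fin_num mB Bi.
    have := integralE mu B (EFin \o g); rewrite [LHS]B0; rewrite pE mE in fp fn *.
    rewrite -[P B]/(\int[mu]_(x in B) p x)%E -[M B]/(\int[mu]_(x in B) m x)%E.
    rewrite -(fineK fp) -(fineK fn) -EFinB => -[] /esym/eqP; rewrite subr_eq0 => /eqP ->.
    by [].
  - move=> k; have := integrable_pos_fin_num (@measurable_norm_lt R n k%:R) (cube_integrable k%:R).
    rewrite pE => fk; rewrite -[P _]/(\int[mu]_(x in _) p x)%E ltey_eq fk//.
have mA (b : R) : measurable [set x : 'rV[R]_n | 0 < b * g x].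
  have mb : measurable_fun setT (fun x => b * g x) by meas.
  have := mb measurableT _ (measurable_itv `]0, +oo[); rewrite setTI.
  by congr measurable; apply/seteqP; split => x /=; rewrite in_itv/= andbT.
have p_ae : \forall x \ae mu, p x = 0%E.
  have : (\int[mu]_x p x = 0)%E.
    transitivity (P [set x | 0 < 1 * g x]).
      rewrite -[RHS]/(\int[mu]_(x in _) p x)%E [RHS]integral_mkcond; apply: eq_integral => x _.
      rewrite patchE; case: ifPn => // h; have gx : g x <= 0.
        by rewrite leNgt; apply: contra h => h; rewrite inE /= mul1r.
      by rewrite /p; congr EFin; apply/max_idPr.
    rewrite PM//; apply: integral0_eq => x /=; rewrite mul1r => gx.
    by rewrite /m; congr EFin; apply/max_idPr; rewrite oppr_le0 ltW.
  move=> h; have /(ae_eq_integral_abs mu measurableT mp) : (\int[mu]_x `|p x| = 0)%E.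
    by rewrite -h; apply: eq_integral => x _; rewrite gee0_abs.
  by apply: filterS => x /(_ I).
have m_ae : \forall x \ae mu, m x = 0%E.
  have : (\int[mu]_x m x = 0)%E.
    transitivity (M [set x | 0 < -1 * g x]).
      rewrite -[RHS]/(\int[mu]_(x in _) m x)%E [RHS]integral_mkcond; apply: eq_integral => x _.
      rewrite patchE; case: ifPn => // h; have gx : - g x <= 0.
        by rewrite leNgt; apply: contra h => h; rewrite inE /= mulN1r.
      by rewrite /m; congr EFin; apply/max_idPr.
    rewrite -PM//; apply: integral0_eq => x /=; rewrite mulN1r oppr_gt0 => gx.
    by rewrite /p; congr EFin; apply/max_idPr; rewrite ltW.
  move=> h; have /(ae_eq_integral_abs mu measurableT mm) : (\int[mu]_x `|m x| = 0)%E.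
    by rewrite -h; apply: eq_integral => x _; rewrite gee0_abs.
  by apply: filterS => x /(_ I).
apply: filterS2 p_ae m_ae => x [] /max_idPr gx [] /max_idPr; rewrite oppr_le0 => g'x.
by apply/eqP; rewrite eq_le gx.
Qed.

End heatop_uniqueness.

(** * Representation of Bessel potentials *)

Section bessel_representation.
Context (R : realType) (n : nat) (s : R).
Hypothesis s0 : 0 < s.
Local Notation mu := (@lebesgue_rV R n).

(** [heatop_bessel] and [heatop_Jop] give both sides the same heat evolution at all positive times,
    so [heatop0_ae0] applies to the difference. *)
Lemma bessel_potential_Jop u v : L2 u -> L2 v -> bessel_potential s u v ->
  \forall x \ae mu, u x = Jop s v x.
Proof.
move=> uL vL uv; have JL := Jop_L2 s0 vL; have [mu' uy] := uL; have [mJ Jy] := JL.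
pose g x := u x - Jop s v x.
have gL : L2 g.
  split; first by rewrite /g; meas.
  apply: (@le_lt_trans _ _ (\int[mu]_x (2 * u x ^+ 2 + 2 * Jop s v x ^+ 2)%:E)%E).
    apply: le_int; [by rewrite /g; meas|by meas|by move=> x; exact: sqr_ge0|] => x.
    by rewrite /g; have := sqr_ge0 (u x + Jop s v x); nra.
  rewrite intD; [|by meas|by meas|by move=> x; rewrite mulr_ge0 ?sqr_ge0..].
  rewrite !intZl//; [|by meas|by move=> x; exact: sqr_ge0|by meas|by move=> x; exact: sqr_ge0].
  by apply: lte_add_pinfty; rewrite lte_mul_pinfty.
have g0 e x : 0 < e -> heatop e g x = 0.
  move=> e0; have i1 := heatop_integrable x e0 uL; have i2 := heatop_integrable x e0 JL.
  transitivity (\int[mu]_y (heat e (x - y) * u y - heat e (x - y) * Jop s v y)).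
    by apply: eq_Rintegral => y _; rewrite /g mulrBr.
  rewrite (RintegralB measurableT i1 i2) -/(heatop e u x) -/(heatop e (Jop s v) x).
  by rewrite (heatop_bessel s0 x e0 uL vL uv) (heatop_Jop s0 x e0 vL) subrr.
by apply: filterS (heatop0_ae0 gL g0) => x /eqP; rewrite subr_eq0 => /eqP.
Qed.

End bessel_representation.

(** * Scale-invariant integrals *)

Section frullani.
Context (R : realType).
Local Notation leb := (@lebesgue_measure R).

Lemma integral_indic_itv (a b : R) : a < b ->
  (\int[leb]_t (\1_(`[a, b]%classic) t)%:E = (b - a)%:E)%E.
Proof.
move=> ab; rewrite integral_indic// setIT.
by have := lebesgue_measure_itv `[a, b]; rewrite /= lte_fin ab -EFinB => <-.
Qed.

(* [(c `^ eps - 1) / eps] replaces [ln c]: it is used with [eps = 1] for small [c - 1]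
   and with a small [eps] for large [c]. *)
Lemma frullani_le (M : R -> R) (M0 c eps : R) : measurable_fun setT M ->
  (forall t, 0 < t -> 0 <= M t <= M0) -> (forall t t', 0 < t -> t <= t' -> M t' <= M t) ->
  1 < c -> 0 < eps ->
  (\int[leb]_t (pw (- 1) t * (M t - M (c * t)))%:E <= (M0 * ((c `^ eps - 1) / eps))%:E)%E.
Proof.
move=> mM bM dM c1 e0; have c0 : 0 < c by exact: lt_trans c1.
have mcM : measurable_fun setT (fun t => M (c * t)) by apply: measurableT_comp => //; meas.
have D0 t : 0 <= pw (- 1) t * (M t - M (c * t)).
  have [t0|t0] := ltP 0 t; last by rewrite pw_le0// mul0r.
  by rewrite mulr_ge0 ?pw_ge0// subr_ge0 dM// ler_peMl// ltW.
have M00 : 0 <= M0 by have /andP[h1 h2] := bM 1 ltr01; exact: le_trans h2.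
pose J (N : nat) := `[(N.+2%:R : R)^-1, N.+2%:R]%classic.
have J0 N t : J N t -> 0 < t.
  by rewrite /J /= in_itv /= => /andP[+ _]; apply: lt_le_trans; rewrite invr_gt0.
apply: (@integral_le_cvg _ _ R leb _ J); [by meas|exact: D0| | | |].
- move=> m k mk; apply/subsetPset => x; rewrite /J /= !in_itv /= => /andP[h1 h2].
  rewrite (le_trans _ h1) ?(le_trans h2)//; first by rewrite ler_nat.
  by rewrite lef_pV2 ?posrE// ler_nat.
- by move=> N; exact: measurable_itv.
- move=> t Dt; have t0 : 0 < t by rewrite ltNge; apply/negP => t0; rewrite pw_le0// mul0r ltxx in Dt.
  exists (Num.truncn (t + t^-1)); rewrite /J /= in_itv /=.
  have h := truncnS_gt (t + t^-1); have ti0 : 0 < t^-1 by rewrite invr_gt0.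
  have hN : t + t^-1 <= (Num.truncn (t + t^-1)).+2%:R by rewrite (le_trans (ltW h))// ler_nat.
  apply/andP; split; last by rewrite (le_trans _ hN)// lerDl ltW.
  by rewrite -[leRHS]invrK lef_pV2 ?posrE// (le_trans _ hN)// lerDr ltW.
move=> N; pose a : R := N.+2%:R^-1; pose b : R := N.+2%:R.
have a0 : 0 < a by rewrite invr_gt0.
have ab : a < b by rewrite (@lt_trans _ _ 1)// ?invf_lt1// ltr1n.
pose i1 t : R := \1_(`[a, b]%classic) t; pose i2 t : R := \1_(`[(c * a), (c * b)]%classic) t.
pose i3 t : R := \1_(`[a, (c * a)]%classic) t.
have mi (x y : R) : measurable_fun setT (fun t : R => \1_(`[x, y]%classic) t : R) by exact: measurable_indic.
have m1 : measurable_fun setT i1 by exact: mi.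
have m2 : measurable_fun setT i2 by exact: mi.
have m3 : measurable_fun setT i3 by exact: mi.
have ind0 (A : set R) t : 0 <= (\1_A t : R) by rewrite indicE ler0n.
have M1 t (A : set R) : (forall t, A t -> 0 < t) -> 0 <= \1_A t * (pw (- 1) t * M t).
  move=> hA; rewrite indicE; case: (boolP (t \in A)) => [|_]; last by rewrite mul0r.
  rewrite inE mul1r => /hA t0; rewrite mulr_ge0 ?pw_ge0//; by have /andP[] := bM _ t0.
have P1 (x y : R) : 0 < x -> forall t, `[x, y]%classic t -> 0 < t.
  by move=> x0 t /=; rewrite in_itv/= => /andP[+ _]; exact: lt_le_trans.
have ca0 : 0 < c * a by exact: mulr_gt0.
(* [X] is the truncated integral to be bounded. By invariance of [dt / t], [Y] is the integral of
   [M] over [[c * a, c * b]]; comparing it with the integral over [[a, b]] leaves only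
   [[a, c * a]]. *)
pose X := (\int[leb]_t (i1 t * (pw (- 1) t * (M t - M (c * t))))%:E)%E.
pose Y := (\int[leb]_t (i1 t * (pw (- 1) t * M (c * t)))%:E)%E.
have cM t : 0 <= i1 t * (pw (- 1) t * M (c * t)).
  rewrite /i1 indicE; case: (boolP (t \in _)) => [|_]; last by rewrite mul0r.
  rewrite inE mul1r => /(P1 _ _ a0) t0; rewrite mulr_ge0 ?pw_ge0//.
  by have /andP[] := bM _ (mulr_gt0 c0 t0).
have -> : (\int[leb]_(t in J N) (pw (- 1) t * (M t - M (c * t)))%:E = X)%E.
  rewrite integral_mkcond; apply: eq_integral => t _; rewrite patchE /i1 indicE.
  by case: ifP => _; rewrite ?mul1r ?mul0r.
have XY : (X + Y = \int[leb]_t (i1 t * (pw (- 1) t * M t))%:E)%E.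
  rewrite -intD; [|by meas|by meas|by move=> t; rewrite mulr_ge0// ind0|exact: cM].
  by apply: eq_integral => t _; congr EFin; ring.
have YE : (Y = \int[leb]_t (i2 t * (pw (- 1) t * M t))%:E)%E.
  pose F t := (i2 t * (pw (- 1) t * M t))%:E.
  have F0 t : (0 <= F t)%E by rewrite lee_fin /F M1//; exact: P1.
  have mF : measurable_fun setT F by apply/measurable_EFinP; meas.
  have cE : (c%:E * (c^-1%:E * \int[leb]_t F t) = \int[leb]_t F t)%E.
    by rewrite muleA -EFinM divff ?lt0r_neq0// mul1e.
  rewrite -[RHS]cE -(ge0_integral_affine 0 c0 mF F0) -ge0_integralZl_EFin ?(ltW c0)//; last first.
    by apply: measurableT_comp => //; meas.
  apply: eq_integral => t _; rewrite /F addr0 -EFinM; congr EFin.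
  have -> : i2 (c * t) = i1 t.
    by rewrite /i1 /i2 !indicE !mem_setE !in_itv /= !ler_pM2l.
  have [t0|t0] := ltP 0 t; last by rewrite pw_le0// pw_le0 ?mul0r ?mulr0// pmulr_rle0.
  by rewrite pwM// powRN powRr1 ?(ltW c0)//; field; exact: lt0r_neq0.
have Z : (X + Y <= Y + (M0 * ((c `^ eps - 1) / eps))%:E)%E.
  rewrite XY [in leRHS]YE.
  have i3le : (\int[leb]_t (i3 t * (pw (- 1) t * M t))%:E <= (M0 * ((c `^ eps - 1) / eps))%:E)%E.
    (* For [t >= a] one has [t^(-1) <= a^(-eps) t^(eps-1)], and the integral of the right-hand side
       over [[a, c * a]] is [(c^eps - 1) / eps], independently of [a]. *)
    pose K := M0 * a `^ (- eps).
    have K0 : 0 <= K by rewrite mulr_ge0// powR_ge0.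
    apply: (@le_trans _ _ (\int[leb]_t (K * (i3 t * pw (eps - 1) t))%:E)%E).
      apply: le_int; [by meas|by meas|by move=> t; apply: M1; exact: P1|] => t.
      rewrite /i3 indicE; case: (boolP (t \in _)) => [|_]; last by rewrite !mul0r mulr0.
      rewrite inE !mul1r => ta; have t0 := P1 _ _ a0 _ ta.
      move: ta; rewrite /= in_itv /= => /andP[ta _]; have /andP[_ tM] := bM _ t0.
      rewrite pwD mulrA mulrC ler_wpM2r ?pw_ge0//.
      rewrite /K -mulrA (le_trans tM)// ler_peMr// pwE// powRN mulrC.
      rewrite ler_pdivlMr ?powR_gt0// mul1r ge0_ler_powR ?nnegrE ?(ltW e0)//.
      exact: ltW.
      exact: ltW.
    rewrite intZl//; [|by meas|by move=> t; rewrite mulr_ge0 ?pw_ge0// ind0].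
    have -> : (\int[leb]_t (i3 t * pw (eps - 1) t)%:E = \int[leb]_(t in `[a, (c * a)%R]) (t `^ (eps - 1))%:E)%E.
      rewrite [RHS]integral_mkcond; apply: eq_integral => t _; rewrite patchE /i3 indicE.
      case: ifPn => [|_]; last by rewrite mul0r.
      by rewrite inE => /(P1 _ _ a0) t0; rewrite mul1r pwE.
    rewrite integral_powR_itv ?gt_eqF//; last by rewrite ltr_pMl.
    rewrite -EFinM lee_fin /K powRM ?(ltW c0) ?(ltW a0)// powRN.
    have ae : a `^ eps != 0 by rewrite gt_eqF// powR_gt0.
    by rewrite le_eqVlt; apply/orP; left; apply/eqP; field; rewrite ae lt0r_neq0.
  apply: (le_trans _ (leeD2l _ i3le)); rewrite -intD; [|by meas|by meas| |]; last 2 first.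
  - by move=> t; apply: M1; exact: P1.
  - by move=> t; apply: M1; exact: P1.
  apply: le_int; [by meas|by meas|by move=> t; apply: M1; exact: P1|] => t.
  have h1 := M1 t _ (P1 _ (c * b) ca0); have h2 := M1 t _ (P1 _ (c * a) a0).
  rewrite -/(i2 t) in h1; rewrite -/(i3 t) in h2.
  rewrite {1}/i1 indicE; case: (boolP (t \in _)) => [|_]; last by rewrite mul0r addr_ge0.
  rewrite inE /= in_itv /= => /andP[ta tb]; rewrite mul1r.
  have [tc|/ltW tc] := leP t (c * a).
    by rewrite [i3 t]indicE mem_set /= ?in_itv/= ?ta// mul1r lerDr.
  rewrite [i2 t]indicE mem_set /= ?in_itv/= ?tc ?mul1r ?lerDl//.
  by rewrite (le_trans tb)// ler_peMl// ltW// (lt_trans a0).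
(* Finiteness is what allows [Y] to be cancelled among extended reals. *)
have Yf : Y \is a fin_num.
  rewrite ge0_fin_numE; last by apply: int_ge0.
  apply: (@le_lt_trans _ _ (\int[leb]_t (M0 * (i1 t * pw (- 1) t))%:E)%E).
    apply: le_int; [by meas|by meas|exact: cM|] => t.
    rewrite /i1 indicE; case: (boolP (t \in _)) => [|_]; last by rewrite !mul0r mulr0.
    rewrite inE !mul1r => /(P1 _ _ a0) t0; rewrite mulrC ler_wpM2r ?pw_ge0//.
    by have /andP[] := bM _ (mulr_gt0 c0 t0).
  rewrite intZl//; [|by meas|by move=> t; rewrite mulr_ge0 ?pw_ge0// ind0].
  rewrite lte_mul_pinfty ?lee_fin//.
  apply: (@le_lt_trans _ _ (\int[leb]_t (a^-1 * i1 t)%:E)%E).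
    apply: le_int; [by meas|by meas|by move=> t; rewrite mulr_ge0 ?pw_ge0// ind0|] => t.
    rewrite /i1 indicE; case: (boolP (t \in _)) => [|_]; last by rewrite mul0r mulr0.
    rewrite inE mul1r mulr1 => ta; have t0 := P1 _ _ a0 _ ta.
    move: ta; rewrite /= in_itv /= => /andP[ta _].
    by rewrite pwE// powRN powRr1 ?(ltW t0)// lef_pV2 ?posrE.
  rewrite intZl; [|by meas|by move=> t; exact: ind0|by rewrite invr_ge0 (ltW a0)].
  by rewrite integral_indic_itv// -EFinM ltry.
by move: Z; rewrite [leRHS]addeC leeD2rE.
Qed.

End frullani.

Section weights.
Context (R : realType).
Local Notation leb := (@lebesgue_measure R).

(** Grows like a small power both at 0 and at infinity (for [d > 0]), so that dividing by it makes
    [dx / x] integrable. *)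
Definition two_sided (d x : R) : R := pw d x + pw (- d) x.

Lemma two_sided_gt0 d x : 0 < x -> 0 < two_sided d x.
Proof. by move=> x0; rewrite /two_sided addr_gt0// pw_gt0. Qed.

Lemma two_sided_ge0 d x : 0 <= two_sided d x.
Proof. by rewrite /two_sided addr_ge0// pw_ge0. Qed.

Lemma two_sidedV d x : two_sided d x^-1 = two_sided d x.
Proof.
have [x0|x0] := ltP 0 x; last by rewrite /two_sided !pw_le0// invr_le0.
by rewrite /two_sided !pwE ?invr_gt0// -powR_inv1 ?(ltW x0)// -!powRrM !mulN1r opprK addrC.
Qed.

Lemma measurable_two_sided d dT (T : measurableType dT) (f : T -> R) :
  measurable_fun setT f -> measurable_fun setT (fun x => two_sided d (f x)).
Proof. by move=> mf; rewrite /two_sided; meas. Qed.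

(** [dx / x] is invariant under dilations, so the value does not depend on [t]. *)
Lemma integral_two_sidedV d : 0 < d -> exists2 C : R, 0 <= C & forall t, 0 < t ->
  (\int[leb]_x (pw (- 1) x / two_sided d (x / t))%:E = C%:E)%E.
Proof.
move=> d0; pose f (x : R) := pw (- 1) x / two_sided d x.
have mf : measurable_fun setT f by have := @measurable_two_sided d _ R id => /(_ (@measurable_id _ _ _)) ?; rewrite /f; meas.
have f0 x : 0 <= f x by rewrite divr_ge0 ?pw_ge0 ?two_sided_ge0.
have fy : (\int[leb]_x (f x)%:E < +oo)%E.
  apply: (@integral_pw_lty _ f d d 1 mf d0 d0 ler01 f0) => t.
  - by move=> t0; rewrite /f pw_le0// mul0r.
  - move=> t0 t1; rewrite mul1r /f ler_pdivrMr ?two_sided_gt0// /two_sided !pwE// mulrDr -!powRD ?(lt0r_neq0 t0) ?implybT//.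
    by rewrite (_ : d - 1 - d = - 1); [rewrite ler_wpDl ?powR_ge0|ring].
  - move=> t1; have t0 : 0 < t by exact: lt_le_trans t1.
    rewrite mul1r /f ler_pdivrMr ?two_sided_gt0// /two_sided !pwE// mulrDr -!powRD ?(lt0r_neq0 t0) ?implybT//.
    by rewrite (_ : - d - 1 + d = - 1); [rewrite ler_wpDr ?powR_ge0|ring].
exists (fine (\int[leb]_x (f x)%:E)); first by apply: fine_ge0; exact: int_ge0.
move=> t t0; rewrite fineK; last by rewrite ge0_fin_numE// int_ge0.
have ti0 : 0 < t^-1 by rewrite invr_gt0.
have mF : measurable_fun setT (EFin \o f) by exact/measurable_EFinP.
have F0 x : (0 <= (EFin \o f) x)%E by rewrite lee_fin.
have := ge0_integral_affine 0 ti0 mF F0; rewrite invrK => h.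
rewrite -[RHS]mul1e -[in RHS](mulVf (lt0r_neq0 t0)) EFinM -muleA -h.
rewrite -ge0_integralZl_EFin//; [|by apply: measurableT_comp => //; meas|exact: ltW].
apply: eq_integral => x _; rewrite /= addr0 (mulrC t^-1) -EFinM /f mulrA; congr EFin; congr (_ / _).
rewrite (mulrC x) pwM// powRN powRr1 ?invrK ?(ltW ti0)//.
by rewrite mulrA mulVf ?mul1r// lt0r_neq0.
Qed.

End weights.

(** * The Riesz kernel *)

Section product_sigma_finite.
Context d1 d2 (T1 : measurableType d1) (T2 : measurableType d2) (R : realType).
Variable m1 : {sigma_finite_measure set T1 -> \bar R}.
Variable m2 : {sigma_finite_measure set T2 -> \bar R}.

(* [m1 \x m2] itself is not inferred to be sigma-finite. *)
Definition sigma_finite_product : set (T1 * T2)%type -> \bar R := (m1 \x m2)%E.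

HB.instance Definition _ := Measure.copy sigma_finite_product (m1 \x m2)%E.

Let sigma_finite_productP : sigma_finite setT sigma_finite_product.
Proof.
have /sigma_finiteP[F [FT ndF Foo]] := sigma_finiteT m1.
have /sigma_finiteP[G [GT ndG Goo]] := sigma_finiteT m2.
exists (fun k => F k `*` G k).
  rewrite -setXTT FT GT predeqE => -[x y]; split.
    move=> [/= [i _ Fix] [j _ Gjy]]; exists (maxn i j) => //; split.
    - by move: x Fix; exact/subsetPset/ndF/leq_maxl.
    - by move: y Gjy; exact/subsetPset/ndG/leq_maxr.
  by move=> [i _ []/= ? ?]; split; exists i.
move=> k; have [mF Fk] := Foo k; have [mG Gk] := Goo k; split; first exact: measurableX.
by rewrite /sigma_finite_product product_measure1E// lte_mul_pinfty// ge0_fin_numE.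
Qed.

HB.instance Definition _ := @Measure_isSigmaFinite.Build _ _ _
  sigma_finite_product sigma_finite_productP.

End product_sigma_finite.

Section kernel.
Context (R : realType) (n : nat) (s : R).
Hypothesis s0 : 0 < s.
Hypothesis s1 : s < 1.
Local Notation mu := (@lebesgue_rV R n).
Local Notation leb := (@lebesgue_measure R).

Definition riesz (h : 'rV[R]_n) : R := (enorm h `^ (n%:R + 2 * s))^-1.

Lemma riesz_ge0 h : 0 <= riesz h.
Proof. by rewrite invr_ge0 powR_ge0. Qed.

Lemma measurable_riesz d (T : measurableType d) (f : T -> 'rV[R]_n) :
  measurable_fun setT f -> measurable_fun setT (fun x => riesz (f x)).
Proof. by move=> mf; rewrite /riesz; meas. Qed.

Let p0 : 0 < n%:R + 2 * s.
Proof. by rewrite ltr_wpDl// mulr_gt0. Qed.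

(** Only the times in [[q, 2 * q]] with [q = dotp h h] are kept. There the integrand is at least
    [B], and by homogeneity [B * q] is [K] times the Riesz kernel. *)
Lemma riesz_le_heat : exists2 C : R, 0 <= C & forall h,
  ((riesz h)%:E <= C%:E * \int[leb]_t (pw (- 1 - s) t * heat t h)%:E)%E.
Proof.
have pi0 := @pi_gt0 R.
pose K : R := 2 `^ (- 1 - s) * (8 * pi) `^ (- (n%:R / 2)) * expR (- 4^-1).
have K0 : 0 < K by rewrite !mulr_gt0 ?powR_gt0 ?expR_gt0// mulr_gt0.
exists K^-1; first by rewrite invr_ge0 ltW.
move=> h; have mh : measurable_fun setT (fun t : R => heat t h) by apply: measurable_fun_heat; meas.
have g0 t : 0 <= pw (- 1 - s) t * heat t h by rewrite mulr_ge0 ?pw_ge0 ?heat_ge0.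
have [h0|h0] := ltP 0 (dotp h h); last first.
  (* At the origin the kernel is 0 by the convention on the inverse of 0. *)
  have : enorm h = 0 by apply/eqP; rewrite /enorm sqrtr_eq0.
  move=> e0; rewrite /riesz e0 powR0 ?gt_eqF// invr0 mule_ge0//; first by rewrite lee_fin invr_ge0 ltW.
  exact: int_ge0.
set q := dotp h h in h0 *.
pose B := (2 * q) `^ (- 1 - s) * (8 * pi * q) `^ (- (n%:R / 2)) * expR (- 4^-1).
have B0 : 0 <= B by rewrite !mulr_ge0 ?powR_ge0 ?expR_ge0.
have hB : riesz h = K^-1 * (B * q).
  have e1 : enorm h = q `^ 2^-1 by rewrite /enorm -powR12_sqrt// ltW.
  rewrite /riesz e1 -powRrM -powRN /B powRM ?(ltW h0)// (powRM _ _ (ltW h0)); last by rewrite mulr_ge0 ?(ltW pi0).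
  have -> : - (2^-1 * (n%:R + 2 * s)) = (- 1 - s) + (- (n%:R / 2)) + 1 by field.
  have pD a b : q `^ (a + b) = q `^ a * q `^ b by rewrite powRD// (lt0r_neq0 h0) implybT.
  rewrite !pD powRr1 ?(ltW h0)//.
  by rewrite /K; field; rewrite !gt_eqF ?powR_gt0 ?expR_gt0// mulr_gt0.
have q2 : q < 2 * q by rewrite mulrDl mul1r ltrDl.
rewrite hB EFinM lee_wpmul2l ?lee_fin ?invr_ge0 ?(ltW K0)//.
apply: (@le_trans _ _ (\int[leb]_t (B * \1_(`[q, (2 * q)%R]%classic) t)%:E)%E).
  rewrite intZl; [|exact: measurable_indic|by move=> t; rewrite indicE ler0n|exact: B0].
  rewrite integral_indic_itv// -EFinM lee_fin.
  by rewrite (_ : 2 * q - q = q)//; ring.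
apply: le_int; [by apply: measurable_funM => //; exact: measurable_indic|by meas|by move=> t; rewrite mulr_ge0|] => t.
rewrite indicE; case: (boolP (t \in _)) => [|_]; last by rewrite mulr0.
rewrite inE /= in_itv /= mulr1 => /andP[qt tq]; have t0 : 0 < t by exact: lt_le_trans qt.
rewrite pwE// heat.unlock /B -mulrA ler_pM ?mulr_ge0 ?powR_ge0 ?expR_ge0//.
  rewrite -opprD !powRN lef_pV2 ?posrE ?powR_gt0 ?mulr_gt0// ge0_ler_powR ?nnegrE ?(ltW t0) ?mulr_ge0 ?(ltW h0)//.
  by rewrite addr_ge0// ltW.
rewrite ler_pM ?powR_ge0 ?expR_ge0//.
  rewrite !powRN lef_pV2 ?posrE ?powR_gt0// ?mulr_gt0// ge0_ler_powR ?nnegrE ?divr_ge0// ?mulr_ge0 ?(ltW t0) ?(ltW pi0) ?(ltW h0)//.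
  by have := ler_wpM2l (ltW pi0) tq; lra.
rewrite ler_expR mulNr lerN2 -/q ler_pdivrMr; last by rewrite mulr_gt0.
by rewrite mulrA mulVf ?mul1r.
Qed.

Local Notation mm := (mu \x mu)%E.
Local Notation mm' := (sigma_finite_product mu mu).

Let mheat t : measurable_fun setT (fun z : 'rV[R]_n * 'rV[R]_n => heat t (z.1 - z.2)).
Proof. by apply: measurable_fun_heat; meas. Qed.

Let mriesz : measurable_fun setT (fun z : 'rV[R]_n * 'rV[R]_n => riesz (z.1 - z.2)).
Proof. by apply: measurable_riesz; meas. Qed.

Lemma integral_riesz_le : exists2 C : R, 0 <= C & forall F : 'rV[R]_n * 'rV[R]_n -> R,
  measurable_fun setT F -> (forall z, 0 <= F z) ->
  (\int[mm]_z (riesz (z.1 - z.2) * F z)%:E <=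
   C%:E * \int[leb]_t \int[mm]_z (pw (- 1 - s) t * (heat t (z.1 - z.2) * F z))%:E)%E.
Proof.
have [C C0 HC] := riesz_le_heat; exists C => // F mF F0.
pose G (z : 'rV[R]_n * 'rV[R]_n) t := pw (- 1 - s) t * (heat t (z.1 - z.2) * F z).
have mG : measurable_fun setT (fun w : ('rV[R]_n * 'rV[R]_n) * R => G w.1 w.2).
  apply: measurable_funM; first by meas.
  by apply: measurable_funM; [apply: measurable_fun_heat; meas|exact: measurableT_comp].
have G0 z t : 0 <= G z t by rewrite !mulr_ge0 ?pw_ge0 ?heat_ge0.
rewrite -(@tonelli _ _ _ _ _ mm' leb G)// -ge0_integralZl_EFin//; last 2 first.
- by move=> z _; exact: int_ge0.
- exact: (@measurable_int2 _ _ _ _ _ leb G).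
apply: ge0_le_integral => //.
- by move=> z _; rewrite lee_fin mulr_ge0 ?riesz_ge0.
- by apply/measurable_EFinP; meas.
- by apply: measurable_funeM; exact: (@measurable_int2 _ _ _ _ _ leb G).
move=> z _; have := HC (z.1 - z.2); rewrite EFinM => h.
have mh : measurable_fun setT (fun t : R => heat t (z.1 - z.2)) by apply: measurable_fun_heat; meas.
rewrite (_ : \int[leb]_t _ = (F z)%:E * \int[leb]_t (pw (- 1 - s) t * heat t (z.1 - z.2))%:E)%E; last first.
  rewrite -intZl; [|by meas|by move=> t; rewrite mulr_ge0 ?pw_ge0 ?heat_ge0|exact: F0].
  by apply: eq_integral => t _; congr EFin; rewrite /G; ring.
by rewrite muleCA muleC lee_wpmul2l// lee_fin.
Qed.

(** [t^(-1-s) * min(1, t)] is integrable as [0 < s < 1]: the bound [A] serves for [t >= 1] and the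
    bound [B * t] below. *)
Lemma integral_riesz_bound : exists2 C : R, 0 <= C & forall (F : 'rV[R]_n * 'rV[R]_n -> R) (A B : R),
  measurable_fun setT F -> (forall z, 0 <= F z) -> 0 <= A -> 0 <= B ->
  (forall t, 0 < t -> (\int[mm]_z (heat t (z.1 - z.2) * F z)%:E <= A%:E)%E) ->
  (forall t, 0 < t -> (\int[mm]_z (heat t (z.1 - z.2) * F z)%:E <= (B * t)%:E)%E) ->
  (\int[mm]_z (riesz (z.1 - z.2) * F z)%:E <= (C * (A + B))%:E)%E.
Proof.
have [C C0 HC] := integral_riesz_le.
pose f (t : R) := pw (- 1 - s) t * Num.min 1 t.
have mf : measurable_fun setT f by apply: measurable_funM; [meas|apply: measurable_minr].
have f0 t : 0 <= f t.
  have [t0|t0] := ltP 0 t; last by rewrite /f pw_le0// mul0r.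
  by rewrite mulr_ge0 ?pw_ge0// le_min ler01 ltW.
have fy : (\int[leb]_t (f t)%:E < +oo)%E.
  have s10 : 0 < 1 - s by rewrite subr_gt0.
  apply: (@integral_pw_lty _ f (1 - s) s 1 mf s10 s0 ler01 f0) => t.
  - by move=> t0; rewrite /f pw_le0// mul0r.
  - move=> t0 t1; rewrite mul1r /f (min_idPr t1) pwE// -{2}(powRr1 (ltW t0)) -powRD ?(lt0r_neq0 t0) ?implybT//.
    by rewrite (_ : - 1 - s + 1 = 1 - s - 1)//; ring.
  - move=> t1; have t0 : 0 < t by exact: lt_le_trans t1.
    by rewrite mul1r /f (min_idPl t1) pwE// mulr1 addrC.
exists (C * fine (\int[leb]_t (f t)%:E)).
  by rewrite mulr_ge0// fine_ge0// int_ge0.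
move=> F A B mF F0 A0 B0 FA FB; apply: (le_trans (HC F mF F0)).
rewrite -mulrA EFinM lee_wpmul2l ?lee_fin// EFinM fineK ?ge0_fin_numE ?int_ge0//.
have AB0 : 0 <= A + B by rewrite addr_ge0.
rewrite muleC -intZl//; apply: ge0_le_integral => //.
- by move=> t _; apply: int_ge0 => z; rewrite !mulr_ge0 ?pw_ge0 ?heat_ge0.
- apply: (@measurable_int1 _ _ _ _ _ mm' (fun z t => pw (- 1 - s) t * (heat t (z.1 - z.2) * F z))).
    apply: measurable_funM; first by meas.
    by apply: measurable_funM; [apply: measurable_fun_heat; meas|exact: measurableT_comp].
  by move=> z t; rewrite !mulr_ge0 ?pw_ge0 ?heat_ge0.
- by apply/measurable_EFinP; meas.
move=> t _; have := mheat t => mt.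
rewrite intZl; [|by meas|by move=> z; rewrite mulr_ge0 ?heat_ge0|exact: pw_ge0].
have [t0|t0] := ltP 0 t; last by rewrite /f !pw_le0// mul0r mulr0 mul0e.
rewrite /f mulrCA EFinM lee_wpmul2l ?lee_fin ?pw_ge0//.
have [t1|t1] := leP 1 t.
  by rewrite (le_trans (FA t t0))// lee_fin mulr1 lerDl.
by rewrite (le_trans (FB t t0))// lee_fin ler_wpM2r ?(ltW t0)// lerDr.
Qed.

Definition energy (u : 'rV[R]_n -> R) : \bar R :=
  \int[mm]_z (riesz (z.1 - z.2) * (u z.1 - u z.2) ^+ 2)%:E.

Lemma energy_lty f (C : R) : L2 f -> 0 <= C ->
  (forall t, 0 < t -> (\int[mu]_x \int[mu]_y (heat t (x - y) * (f x - f y) ^+ 2)%:E <= (C * t)%:E)%E) ->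
  (energy f < +oo)%E.
Proof.
move=> fL C0 fC; have [mf _] := fL; have [K K0 HK] := integral_riesz_bound.
pose F (z : 'rV[R]_n * 'rV[R]_n) := (f z.1 - f z.2) ^+ 2.
have tE t : (\int[mm]_z (heat t (z.1 - z.2) * F z)%:E = \int[mu]_x \int[mu]_y (heat t (x - y) * (f x - f y) ^+ 2)%:E)%E.
  have := mheat t => mt; rewrite -(@tonelli_prod _ _ _ _ _ mu mu (fun x y => heat t (x - y) * (f x - f y) ^+ 2))//; first by meas.
  by move=> x y; rewrite mulr_ge0 ?heat_ge0 ?sqr_ge0.
have A0 := sqnorm_ge0 f.
apply: (@le_lt_trans _ _ (K * (2 * sqnorm f + C))%:E); last exact: ltry.
apply: (HK F) => //; [by rewrite /F; meas|by move=> z; exact: sqr_ge0|exact: mulr_ge0| |].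
- move=> t t0; rewrite tE heat_energyE// lee_fin ler_wpM2l// lerBlDr lerDl; exact: sqnorm_ge0.
- by move=> t t0; rewrite tE; exact: fC.
Qed.

End kernel.

(** * Energy of Bessel potentials *)

Lemma ae_prod (R : realType) d (T : measurableType d)
    (m : {sigma_finite_measure set T -> \bar R}) (P : T -> Prop) :
  (\forall x \ae m, P x) -> \forall z \ae (m \x m)%E, P z.1 /\ P z.2.
Proof.
move=> [B [mB B0 PB]]; exists ((B `*` setT) `|` (setT `*` B)); split.
- by apply: measurableU; exact: measurableX.
- apply/eqP; rewrite eq_le measure_ge0 andbT.
  have BT := measurableX mB (@measurableT _ T); have TB := measurableX (@measurableT _ T) mB.
  apply: (le_trans (@measureU2 _ _ _ (m \x m)%E _ _ BT TB)).
  have e1 : ((m \x m)%E (B `*` setT) <= 0)%E by rewrite product_measure1E// (B0 : (m : {measure set T -> \bar R}) B = 0%E) mul0e.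
  have e2 : ((m \x m)%E (setT `*` B) <= 0)%E by rewrite product_measure1E// (B0 : (m : {measure set T -> \bar R}) B = 0%E) mule0.
  by apply: (le_trans (leeD e1 e2)); rewrite adde0.
- move=> z /= nP; apply: contrapT => /not_orP[h1 h2]; apply: nP; split.
    by apply: contrapT => nP; apply: h1; split => //; exact: PB.
  by apply: contrapT => nP; apply: h2; split => //; exact: PB.
Qed.

Section weighted_average.
Context (R : realType) (s del : R).
Hypothesis s0 : 0 < s.
Hypothesis del0 : 0 < del.
Local Notation leb := (@lebesgue_measure R).

(** The exponent [s - 1] is such that [rho s tau ^+ 2] over the weight is at most a multiple of
    [1 / (tau * two_sided del (tau / t))], whose integral does not depend on [t]. *)
Definition scale_weight (t tau : R) : R := pw (s - 1) tau * two_sided del (tau / t).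

Lemma scale_weight_ge0 t tau : 0 <= scale_weight t tau.
Proof. by rewrite mulr_ge0 ?pw_ge0 ?two_sided_ge0. Qed.

Lemma measurable_scale_weight d (T : measurableType d) (f g : T -> R) :
  measurable_fun setT f -> measurable_fun setT g ->
  measurable_fun setT (fun x => scale_weight (f x) (g x)).
Proof.
move=> mf mg; apply: measurable_funM; first by meas.
by apply: measurable_two_sided; meas.
Qed.

(* Cauchy-Schwarz with a weight depending on the ratio of the two times, such
   that the first factor does not depend on [t]. *)
Lemma rho_average_sqr_le : exists2 K : R, 0 <= K & forall (D : R -> R) (t : R), 0 < t ->
  measurable_fun setT D -> leb.-integrable setT (EFin \o (fun x => rho s x * D x)) ->
  (((\int[leb]_x (rho s x * D x)) ^+ 2)%:E <= K%:E * \int[leb]_x (scale_weight t x * D x ^+ 2)%:E)%E.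
Proof.
have [H H0 HH] := integral_two_sidedV del0.
pose c : R := (euler_integral (s / 2))^-1.
have c0 : 0 <= c by rewrite invr_ge0 ltW// euler_integral_gt0// divr_gt0.
exists (c ^+ 2 * H); first by rewrite mulr_ge0 ?sqr_ge0.
move=> D t t0 mD iD.
have mw : measurable_fun setT (scale_weight t) by apply: measurable_scale_weight; meas.
have mr : measurable_fun setT (rho s) by apply: measurable_fun_rho; meas.
have mh : measurable_fun setT (fun x : R => two_sided del (x / t)) by apply: measurable_two_sided; meas.
pose f x := rho s x / Num.sqrt (scale_weight t x).
pose g x := Num.sqrt (scale_weight t x) * `|D x|.
have r0 := rho_ge0 s0.
have f0 x : 0 <= f x by rewrite divr_ge0 ?sqrtr_ge0.
have g0 x : 0 <= g x by rewrite mulr_ge0 ?sqrtr_ge0.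
have w0 x : 0 < x -> 0 < scale_weight t x.
  by move=> x0; rewrite mulr_gt0 ?pw_gt0// two_sided_gt0// divr_gt0.
have mf : measurable_fun setT f by rewrite /f; meas.
have mg : measurable_fun setT g by rewrite /g; meas.
have fg x : f x * g x = `|rho s x * D x|.
  rewrite normrM (ger0_norm (r0 x)) /f /g; have [x0|x0] := ltP 0 x; last by rewrite rho_le0// !mul0r.
  by field; rewrite gt_eqF// sqrtr_gt0 w0.
have cs := cauchy_schwarz leb mf mg f0 g0.
rewrite -(real_normK (num_real _)).
apply: (@le_trans _ _ ((\int[leb]_x (f x * g x)%:E) * (\int[leb]_x (f x * g x)%:E))%E).
  have h : (`|\int[leb]_x (rho s x * D x)|%:E <= \int[leb]_x (f x * g x)%:E)%E.
    by apply: (le_trans (abs_Rintegral_le iD)); under [leRHS]eq_integral do rewrite fg.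
  by rewrite expr2 EFinM; apply: lee_pmul.
apply: (le_trans cs); apply: lee_pmul.
- by apply: int_ge0 => x; exact: sqr_ge0.
- by apply: int_ge0 => x; exact: sqr_ge0.
- apply: (@le_trans _ _ (\int[leb]_x (c ^+ 2 * (pw (- 1) x / two_sided del (x / t)))%:E)%E).
    apply: le_int; [by meas|by meas|by move=> x; exact: sqr_ge0|] => x.
    have [x0|x0] := ltP 0 x; last by rewrite /f rho_le0// mul0r expr0n pw_le0// mul0r mulr0.
    rewrite /f exprMn exprVn sqr_sqrtr ?(ltW (w0 x x0))// rho.unlock -/c.
    have h0 : 0 < two_sided del (x / t) by rewrite two_sided_gt0// divr_gt0.
    have E : pw (s / 2 - 1) x ^+ 2 = pw (- 1) x * pw (s - 1) x.
      by rewrite expr2 -!pwD; congr pw; field.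
    rewrite !exprMn E /scale_weight.
    have p1 : pw (s - 1) x != 0 by rewrite gt_eqF ?pw_gt0.
    rewrite [leLHS](_ : _ = c ^+ 2 * (pw (- 1) x / two_sided del (x / t)) * expR (- x) ^+ 2); last first.
      by field; rewrite p1 lt0r_neq0.
    apply: ler_piMr; first by rewrite mulr_ge0 ?sqr_ge0// divr_ge0 ?pw_ge0 ?(ltW h0).
    by apply: exprn_ile1; [exact: expR_ge0|rewrite -expR0 ler_expR oppr_le0 ltW].
  rewrite intZl; [|by meas|by move=> x; rewrite divr_ge0 ?pw_ge0 ?two_sided_ge0|exact: sqr_ge0].
  by rewrite HH// EFinM.
- apply: le_int; [by meas|by meas|by move=> x; exact: sqr_ge0|] => x.
  rewrite /g exprMn real_normK ?num_real//.
  by rewrite sqr_sqrtr// scale_weight_ge0.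
Qed.

End weighted_average.

Section bessel_energy.
Context (R : realType) (n : nat) (s : R).
Hypothesis s0 : 0 < s.
Hypothesis s1 : s < 1.
Local Notation mu := (@lebesgue_rV R n).
Local Notation leb := (@lebesgue_measure R).
Local Notation mm := (mu \x mu)%E.
Local Notation mm' := (sigma_finite_product mu mu).
Variable v : 'rV[R]_n -> R.
Hypothesis vL : L2 v.

Let mv : measurable_fun setT v := vL.1.

(** Small enough that [del < 1 - s] and [2 * del < s], the convergence conditions at 0 and at
    infinity in [Q_lty]. *)
Let del : R := Num.min s (1 - s) / 4.

Let del0 : 0 < del.
Proof. by rewrite divr_gt0// lt_min s0 subr_gt0. Qed.

Let del_le1 : del <= 1.
Proof. by move: s0 s1; rewrite /del /Num.min; case: ifP => ? ? ?; lra. Qed.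

Let M (tau : R) : R := sqnorm (heatop tau v).

Let mM : measurable_fun setT M.
Proof.
rewrite /M /sqnorm; apply: (@measurable_Rintegral _ _ _ _ _ mu (fun tau x => heatop tau v x ^+ 2)).
by apply: measurable_funX; apply: measurable_heatop2; meas.
Qed.

Let M_bound t : 0 < t -> 0 <= M t <= sqnorm v.
Proof. by move=> t0; rewrite sqnorm_ge0 heatop_contract. Qed.

Let M_add t r : 0 < t -> 0 < r -> sqnorm (heatop r (heatop t v)) = M (t + r).
Proof.
move=> t0 r0; rewrite /M; congr sqnorm; apply/funext => x.
by rewrite heatop_semigroup// addrC.
Qed.

Let M_dec t t' : 0 < t -> t <= t' -> M t' <= M t.
Proof.
move=> t0; rewrite le_eqVlt => /predU1P[->//|tt'].
have r0 : 0 < t' - t by rewrite subr_gt0.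
rewrite (_ : t' = t + (t' - t)); last by ring.
by rewrite -(M_add t0 r0); apply: heatop_contract r0 _; exact: heatop_L2 t0 vL.
Qed.

Let D (tau : R) (z : 'rV[R]_n * 'rV[R]_n) : R := heatop tau v z.1 - heatop tau v z.2.

Let mD d (T : measurableType d) (f : T -> R) (g : T -> 'rV[R]_n * 'rV[R]_n) :
  measurable_fun setT f -> measurable_fun setT g -> measurable_fun setT (fun x => D (f x) (g x)).
Proof.
move=> mf mg; apply: measurable_funB; apply: measurable_heatop2 => //.
  exact: (measurableT_comp measurable_fst).
exact: (measurableT_comp measurable_snd).
Qed.

Let heat_D t tau : 0 < t -> 0 < tau ->
  (\int[mm]_z (heat t (z.1 - z.2) * D tau z ^+ 2)%:E = (2 * (M tau - M (tau + t / 2)))%:E)%E.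
Proof.
move=> t0 tau0; have t20 : 0 < t / 2 by rewrite divr_gt0.
have mh : measurable_fun setT (fun z : 'rV[R]_n * 'rV[R]_n => heat t (z.1 - z.2)).
  by apply: measurable_fun_heat; meas.
have mDt : measurable_fun setT (D tau) by exact: (@mD _ _ (fun=> tau) id (measurable_cst tau) (@measurable_id _ _ _)).
rewrite (@tonelli_prod _ _ _ _ _ mu mu (fun x y => heat t (x - y) * (heatop tau v x - heatop tau v y) ^+ 2)).
- by rewrite (heat_energyE t0 (heatop_L2 tau0 vL)) (M_add tau0 t20).
- by apply: measurable_funM => //; apply: measurable_funX.
- by move=> x y; rewrite mulr_ge0 ?heat_ge0 ?sqr_ge0.
Qed.

(** What remains of the energy after integration in space: [t] is the time in the bound for the
    Riesz kernel, [tau] the time in the average [Jop]. *)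
Let Q (t tau : R) : R := pw (- 1 - s) t * (scale_weight s del t tau * (M tau - M (tau + t / 2))).

Let mQ d (T : measurableType d) (f g : T -> R) :
  measurable_fun setT f -> measurable_fun setT g -> measurable_fun setT (fun x => Q (f x) (g x)).
Proof.
move=> mf mg; apply: measurable_funM; first by meas.
apply: measurable_funM; first exact: measurable_scale_weight.
by have := mM => ?; meas.
Qed.

Let Q_ge0 t tau : 0 <= Q t tau.
Proof.
rewrite /Q; have [t0|t0] := ltP 0 t; last by rewrite pw_le0// mul0r.
have [tau0|tau0] := ltP 0 tau; last by rewrite /scale_weight (pw_le0 _ tau0) !mul0r mulr0.
rewrite mulr_ge0 ?pw_ge0// mulr_ge0 ?scale_weight_ge0// subr_ge0 M_dec//.
by rewrite lerDl divr_ge0// ltW.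
Qed.

Let u := Jop s v.

Let mu' : measurable_fun setT u := (Jop_L2 s0 vL).1.

(** The Riesz kernel is bounded by an integral in [t], the square of the average is bounded through
    [rho_average_sqr_le] in [tau], and the spatial integral is then exactly [heat_D]. *)
Let energy_le_Q : exists2 K : R, 0 <= K &
  (energy s u <= K%:E * \int[leb]_t \int[leb]_tau (Q t tau)%:E)%E.
Proof.
have [C C0 HC] := @integral_riesz_le R n s s0.
have [K K0 HK] := @rho_average_sqr_le R s del s0 del0.
exists (C * (2 * K)); first by rewrite !mulr_ge0.
pose F (z : 'rV[R]_n * 'rV[R]_n) := (u z.1 - u z.2) ^+ 2.
have mF : measurable_fun setT F by rewrite /F; have := mu' => ?; meas.
have F0 z : 0 <= F z by exact: sqr_ge0.
have hF t z : 0 <= heat t (z.1 - z.2) * F z by apply: mulr_ge0; [exact: heat_ge0|exact: F0].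
have pF t z : 0 <= pw (- 1 - s) t * (heat t (z.1 - z.2) * F z) by apply: mulr_ge0; [exact: pw_ge0|exact: hF].
apply: (le_trans (HC F mF F0)); rewrite EFinM -muleA lee_wpmul2l ?lee_fin//.
have mheat t : measurable_fun setT (fun z : 'rV[R]_n * 'rV[R]_n => heat t (z.1 - z.2)).
  by apply: measurable_fun_heat; meas.
rewrite -ge0_integralZl_EFin ?mulr_ge0//; last 2 first.
- by move=> t _; apply: int_ge0.
- by apply: (@measurable_int1 _ _ _ _ _ leb (fun tau t => Q t tau)); [exact: (@mQ _ _ snd fst measurable_snd measurable_fst)|move=> ? ?; exact: Q_ge0].
apply: ge0_le_integral => //.
- by move=> t _; apply: int_ge0 => z; exact: pF.
- apply: (@measurable_int1 _ _ _ _ _ mm' (fun z t => pw (- 1 - s) t * (heat t (z.1 - z.2) * F z))).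
    apply: measurable_funM; first by meas.
    by apply: measurable_funM; [apply: measurable_fun_heat; meas|exact: measurableT_comp].
  by move=> z t; exact: pF.
- apply: measurable_funeM.
  by apply: (@measurable_int1 _ _ _ _ _ leb (fun tau t => Q t tau)); [exact: (@mQ _ _ snd fst measurable_snd measurable_fst)|move=> ? ?; exact: Q_ge0].
move=> t _; have mht := mheat t.
have [t0|t0] := ltP 0 t; last first.
  rewrite integral0_eq; last by move=> z _; rewrite pw_le0// mul0r.
  by rewrite mule_ge0 ?lee_fin ?mulr_ge0//; exact: int_ge0.
rewrite intZl; [|by meas|by move=> z; exact: hF|exact: pw_ge0].
rewrite intZl; [|by apply: measurable_funM; [apply: measurable_scale_weight; meas|have := mM => ?; meas]| |exact: pw_ge0]; last first.
  by move=> tau; have := Q_ge0 t tau; rewrite /Q pmulr_rge0// pw_gt0.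
rewrite muleCA lee_wpmul2l ?lee_fin ?pw_ge0//.
pose G (z : 'rV[R]_n * 'rV[R]_n) tau := heat t (z.1 - z.2) * (scale_weight s del t tau * D tau z ^+ 2).
have mG : measurable_fun setT (fun w : ('rV[R]_n * 'rV[R]_n) * R => G w.1 w.2).
  apply: measurable_funM; first by apply: measurable_fun_heat; meas.
  apply: measurable_funM; first by apply: measurable_scale_weight; meas.
  by apply: measurable_funX; exact: (@mD _ _ snd fst measurable_snd measurable_fst).
have wD z tau : 0 <= scale_weight s del t tau * D tau z ^+ 2.
  by apply: mulr_ge0; [exact: scale_weight_ge0|exact: sqr_ge0].
have G0 z tau : 0 <= G z tau by apply: mulr_ge0; [exact: heat_ge0|exact: wD].
apply: (@le_trans _ _ (\int[mm]_z (K%:E * \int[leb]_tau (G z tau)%:E))%E).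
  apply: ae_ge0_le_integral => //.
  - by move=> z _; rewrite lee_fin; exact: hF.
  - by apply/measurable_EFinP; meas.
  - by move=> z _; rewrite mule_ge0 ?lee_fin//; exact: int_ge0.
  - by apply: measurable_funeM; exact: (@measurable_int2 _ _ _ _ _ leb G).
  (* For almost every pair both averages converge, and the difference of [u] is the average of the
     differences. *)
  apply: filterS (ae_prod (Jop_ae s0 vL)) => -[x y] /= [hx hy] _.
  have mDz : measurable_fun setT (fun tau => D tau (x, y)) by exact: (@mD _ _ id (fun=> (x, y)) (@measurable_id _ _ _) (measurable_cst _)).
  have mw : measurable_fun setT (scale_weight s del t) by apply: measurable_scale_weight; meas.
  have iD := integrable_sub (Jop_integrable s0 mv hx) (Jop_integrable s0 mv hy).
  have E : u x - u y = \int[leb]_tau (rho s tau * D tau (x, y)).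
    rewrite /u /Jop -(RintegralB measurableT (Jop_integrable s0 mv hx) (Jop_integrable s0 mv hy)).
    by apply: eq_Rintegral => tau _; rewrite /D /= mulrBr.
  have iD' : leb.-integrable setT (EFin \o (fun tau => rho s tau * D tau (x, y))).
    by rewrite (_ : EFin \o _ = EFin \o (fun tau => rho s tau * heatop tau v x - rho s tau * heatop tau v y))//; apply/funext => tau /=; rewrite /D /= mulrBr.
  rewrite /G /= intZl; [|by meas|by move=> tau; exact: wD|exact: heat_ge0].
  rewrite muleCA EFinM lee_wpmul2l ?lee_fin ?heat_ge0// /F /= E.
  exact: HK.
rewrite ge0_integralZl_EFin//; last 2 first.
- by move=> z _; exact: int_ge0.
- exact: (@measurable_int2 _ _ _ _ _ leb G).
rewrite (@tonelli _ _ _ _ _ mm' leb G)// (mulrC 2) EFinM -muleA lee_wpmul2l ?lee_fin//.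
rewrite -intZl//; last first.
- by move=> tau; have := Q_ge0 t tau; rewrite /Q pmulr_rge0// pw_gt0.
- by apply: measurable_funM; [apply: measurable_scale_weight; meas|have := mM => ?; meas].
apply: ge0_le_integral => //.
- by move=> tau _; exact: int_ge0.
- exact: (@measurable_int1 _ _ _ _ _ mm' G).
- apply/measurable_EFinP; apply: measurable_funM => //.
  by apply: measurable_funM; [apply: measurable_scale_weight; meas|have := mM => ?; meas].
move=> tau _; have [tau0|tau0] := ltP 0 tau; last first.
  rewrite integral0_eq; first by rewrite /scale_weight (pw_le0 _ tau0) !mul0r mulr0.
  by move=> z _; rewrite /G /scale_weight (pw_le0 _ tau0) !mul0r mulr0.
have mDt : measurable_fun setT (D tau) by exact: (@mD _ _ (fun=> tau) id (measurable_cst tau) (@measurable_id _ _ _)).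
rewrite (_ : \int[mm']_z _ = \int[mm]_z (scale_weight s del t tau * (heat t (z.1 - z.2) * D tau z ^+ 2))%:E)%E; last first.
  by apply: eq_integral => z _; congr EFin; rewrite /G; ring.
rewrite intZl; [|by meas|by move=> z; apply: mulr_ge0; [exact: heat_ge0|exact: sqr_ge0]|exact: scale_weight_ge0].
rewrite (heat_D t0 tau0) -EFinM lee_fin le_eqVlt; apply/orP; left; apply/eqP.
by move: (M tau) (M _) => a b; ring.
Qed.

(* Substitute [t = tau * th] and integrate in [tau] first: the integral in [tau]
   is of Frullani type as [M] is monotone. *)
Let Q_lty : (\int[leb]_t \int[leb]_tau (Q t tau)%:E < +oo)%E.
Proof.
rewrite (@tonelli _ _ _ _ _ leb leb Q); [|exact: (@mQ _ _ fst snd measurable_fst measurable_snd)|exact: Q_ge0].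
pose ph th := pw (- 1 - s) th * two_sided del th.
pose Q' (th tau : R) : R := ph th * (pw (- 1) tau * (M tau - M ((1 + th / 2) * tau))).
have ph0 th : 0 <= ph th by rewrite mulr_ge0 ?pw_ge0 ?two_sided_ge0.
have mph : measurable_fun setT ph by apply: measurable_funM; [meas|apply: measurable_two_sided; meas].
have in0 th tau : 0 < th -> 0 <= pw (- 1) tau * (M tau - M ((1 + th / 2) * tau)).
  move=> th0; have [tau0|tau0] := ltP 0 tau; last by rewrite pw_le0// mul0r.
  by rewrite mulr_ge0 ?pw_ge0// subr_ge0 M_dec// mulrDl mul1r lerDl ltW// mulr_gt0// divr_gt0.
have Q'0 th tau : 0 <= Q' th tau.
  have [th0|th0] := ltP 0 th; last by rewrite /Q' /ph pw_le0// !mul0r.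
  by rewrite mulr_ge0// in0.
have mQ' : measurable_fun setT (fun w : R * R => Q' w.1 w.2).
  by have := mM => ?; rewrite /Q'; meas.
have -> : (\int[leb]_tau \int[leb]_t (Q t tau)%:E = \int[leb]_tau \int[leb]_th (Q' th tau)%:E)%E.
  apply: eq_integral => tau _; have [tau0|tau0] := ltP 0 tau; last first.
    rewrite integral0_eq; last by move=> t _; rewrite /Q /scale_weight (pw_le0 _ tau0) !mul0r mulr0.
    by rewrite integral0_eq//; move=> th _; rewrite /Q' (pw_le0 _ tau0) mul0r mulr0.
  have mf : measurable_fun setT (fun t => (Q t tau)%:E) by apply/measurable_EFinP; exact: (@mQ _ _ id (fun=> tau) (@measurable_id _ _ _) (measurable_cst _)).
  have h := ge0_integral_affine 0 tau0 mf (fun t => _ : (0 <= (Q t tau)%:E)%E).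
  rewrite -[LHS]mul1e -(divff (lt0r_neq0 tau0)) EFinM -muleA -h; last by move=> t; rewrite lee_fin.
  rewrite -intZl; [|by apply: (@mQ _ _ (fun t => tau * t + 0) (fun=> tau)); meas|by move=> th; exact: Q_ge0|exact: ltW tau0].
  apply: eq_integral => th _; rewrite addr0; congr EFin.
  have [th0|th0] := ltP 0 th; last first.
    have tt0 : tau * th <= 0 by rewrite pmulr_rle0.
    by rewrite /Q /Q' /ph (pw_le0 _ tt0) (pw_le0 _ th0) !mul0r mulr0.
  have e1 : tau / (tau * th) = th^-1 by field; rewrite !lt0r_neq0.
  have e2 : tau + tau * th / 2 = (1 + th / 2) * tau by field.
  rewrite /Q /Q' /scale_weight e1 e2 two_sidedV pwM// !(pwE _ tau0) /ph.
  have e3 : tau * tau `^ (- 1 - s) * tau `^ (s - 1) = tau `^ (- 1).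
    rewrite -{1}(powRr1 (ltW tau0)) -!powRD ?(lt0r_neq0 tau0) ?implybT//.
    by congr (_ `^ _); ring.
  by rewrite -e3; move: (M tau) (M _) => a b; ring.
rewrite -(@tonelli _ _ _ _ _ leb leb Q')//.
(* [M0 * m th] bounds the integral in [tau]: [frullani_le] with exponent 1 for [th <= 1], and with
   exponent [del] beyond. *)
pose m th := if th <= 1 then th else 2 / del * pw del th.
pose M0 := sqnorm v; have M00 : 0 <= M0 by exact: sqnorm_ge0.
have d0 := del0.
have m0 th : 0 < th -> 0 <= m th.
  move=> th0; rewrite /m; case: ifP => _; first exact: ltW.
  by rewrite mulr_ge0 ?pw_ge0// divr_ge0// ltW.
pose f th := M0 * (ph th * m th).
have mf : measurable_fun setT f by rewrite /f /m; meas.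
have f0 th : 0 <= f th.
  have [th0|th0] := ltP 0 th; last by rewrite /f /ph pw_le0// !mul0r mulr0.
  by rewrite mulr_ge0// mulr_ge0// m0.
apply: (@le_lt_trans _ _ (\int[leb]_th (f th)%:E)%E).
  apply: ge0_le_integral => //.
  - by move=> th _; apply: int_ge0 => tau; exact: Q'0.
  - exact: (@measurable_int2 _ _ _ _ _ leb Q').
  - by apply/measurable_EFinP.
  move=> th _; have [th0|th0] := ltP 0 th; last first.
    by rewrite integral0_eq ?lee_fin// => tau _; rewrite /Q' /ph (pw_le0 _ th0) !mul0r.
  rewrite intZl//; [|by have := mM => ?; meas|by move=> tau; exact: in0].
  rewrite [f th](mulrCA M0) (EFinM (ph th)); apply: lee_wpmul2l; first by rewrite lee_fin; exact: ph0.
  have c1 : 1 < 1 + th / 2 by rewrite ltrDl divr_gt0.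
  rewrite /m; case: ifP => th1.
    apply: (le_trans (frullani_le mM M_bound M_dec c1 ltr01)); rewrite lee_fin ler_wpM2l//.
    by rewrite powRr1 ?(ltW (lt_trans ltr01 c1))// divr1; lra.
  have {}th1 : 1 < th by rewrite ltNge th1.
  apply: (le_trans (frullani_le mM M_bound M_dec c1 d0)); rewrite lee_fin ler_wpM2l//.
  have th2 : 1 + th / 2 <= 2 * th by lra.
  have h2 : (2 : R) `^ del <= 2.
    by rewrite -[leRHS](powRr1 (ler0n _ 2)) ler_powR// ?ler1n// del_le1.
  have h3 : (1 + th / 2) `^ del <= 2 `^ del * th `^ del.
    rewrite -powRM ?(ltW th0)// ge0_ler_powR ?(ltW d0)// nnegrE.
      exact: ltW (lt_trans ltr01 c1).
    by rewrite mulr_ge0// ltW.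
  have h4 := ler_wpM2r (powR_ge0 th del) h2.
  by rewrite (mulrAC 2) ler_wpM2r ?invr_ge0 ?(ltW d0)// pwE// lerBlDr; lra.
(* The integrand in [th] is of order [th^((1-s-del)-1)] at 0 and [th^(-(s-2*del)-1)] at infinity. *)
have a0 : 0 < 1 - s - del by move: s0 s1; rewrite /del /Num.min; case: ifP => ? ? ?; lra.
have b0 : 0 < s - 2 * del by move: s0 s1; rewrite /del /Num.min; case: ifP => ? ? ?; lra.
pose C := M0 * (2 + 4 / del).
have C0 : 0 <= C by rewrite mulr_ge0// addr_ge0// divr_ge0// ltW.
have hC1 : M0 * 2 <= C by rewrite ler_wpM2l// lerDl divr_ge0// ltW.
have hC2 : M0 * (4 / del) <= C by rewrite ler_wpM2l// lerDr.
apply: (@integral_pw_lty _ f _ _ C mf a0 b0 C0 f0) => th.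
- by move=> th0; rewrite /f /ph pw_le0// !mul0r mulr0.
- move=> th0 th1; have pD a b : th `^ (a + b) = th `^ a * th `^ b by rewrite powRD// (lt0r_neq0 th0) implybT.
  apply: (@le_trans _ _ (M0 * (2 * th `^ (1 - s - del - 1)))); last first.
    by rewrite mulrA; apply: ler_wpM2r hC1; exact: powR_ge0.
  rewrite /f; apply: ler_wpM2l => //; rewrite /m th1.
  rewrite (_ : 1 - s - del - 1 = (- 1 - s) + (- del) + 1); last by ring.
  rewrite !pD powRr1 ?(ltW th0)// /ph /two_sided !pwE// !mulrA ler_wpM2r ?(ltW th0)//.
  rewrite [leRHS](_ : _ = th `^ (- 1 - s) * (2 * th `^ (- del))); last by rewrite pD; ring.
  apply: ler_wpM2l; first exact: powR_ge0.
  have h1 : th `^ del <= 1.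
    have h : th `^ del <= 1 `^ del.
      by apply: ge0_ler_powR => //; [exact: ltW|rewrite nnegrE ltW|rewrite nnegrE].
    by rewrite powR1 in h.
  have h2 : 1 <= th `^ (- del) by rewrite powRN invf_ge1 ?powR_gt0.
  lra.
- move=> th1; have th0 : 0 < th by exact: lt_le_trans th1.
  have pD a b : th `^ (a + b) = th `^ a * th `^ b by rewrite powRD// (lt0r_neq0 th0) implybT.
  apply: (@le_trans _ _ (M0 * ((4 / del) * th `^ (- (s - 2 * del) - 1)))); last first.
    by rewrite mulrA; apply: ler_wpM2r hC2; exact: powR_ge0.
  rewrite /f; apply: ler_wpM2l => //.
  rewrite (_ : - (s - 2 * del) - 1 = (- 1 - s) + del + del); last by ring.
  have h1 : m th <= 2 / del * th `^ del.
    rewrite /m; case: ifP => [th1'|_]; last by rewrite pwE.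
    have -> : th = 1 by apply/le_anti; rewrite th1 th1'.
    rewrite powR1 mulr1 ler_pdivlMr// mul1r.
    by rewrite (le_trans del_le1)// ler1n.
  have h2 : ph th <= th `^ (- 1 - s) * (2 * th `^ del).
    rewrite /ph /two_sided !pwE// ler_wpM2l ?powR_ge0// mulr2n mulrDl mul1r lerD2l ler_powR//.
    by rewrite (le_trans (_ : - del <= 0)) ?oppr_le0 ?(ltW d0).
  apply: (le_trans (ler_pM (ph0 th) (m0 th th0) h2 h1)); rewrite !pD le_eqVlt; apply/orP; left; apply/eqP.
  by field; exact: lt0r_neq0.
Qed.

Lemma Jop_energy : (energy s (Jop s v) < +oo)%E.
Proof.
have [K K0 HK] := energy_le_Q; apply: (le_lt_trans HK).
by rewrite lte_mul_pinfty ?lee_fin// Q_lty.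
Qed.

End bessel_energy.

(** * Smooth bumps *)

(* [x^-k exp(- 1/x)] for [x > 0], extended by 0; the span is closed under derivation. *)
HB.lock Definition flat (R : realType) (k : nat) (x : R) : R :=
  pw (- k%:R) x * expR (- pw (- 1) x).

Section flat_functions.
Context (R : realType).
Implicit Types x y : R.
Local Notation flat := (@flat R).

Lemma flat_ge0 k x : 0 <= flat k x.
Proof. by rewrite flat.unlock mulr_ge0 ?pw_ge0 ?expR_ge0. Qed.

Lemma flat_le0 k x : x <= 0 -> flat k x = 0.
Proof. by move=> x0; rewrite flat.unlock pw_le0// mul0r. Qed.

Lemma flat_gt0 k x : 0 < x -> 0 < flat k x.
Proof. by move=> x0; rewrite flat.unlock mulr_gt0 ?pw_gt0 ?expR_gt0. Qed.

(** One term of the exponential series at [1 / x]. *)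
Lemma flat_le k m x : 0 < x -> flat k x <= (k + m)`!%:R * x ^+ m.
Proof.
move=> x0; rewrite flat.unlock !pwE// powRN powR_inv1 ?(ltW x0)// powR_mulrn ?(ltW x0)//.
have y0 : 0 <= x^-1 by rewrite invr_ge0 ltW.
have h : x^-1 ^+ (k + m) / (k + m)`!%:R <= expR x^-1.
  case: (k + m)%N => [|N]; first by rewrite expr0 divr1 (le_trans _ (expR_ge1Dx _))// lerDl.
  by apply: le_trans (expR_ge1Dxn N y0); rewrite lerDr.
have f0 : 0 < (k + m)`!%:R :> R by rewrite ltr0n fact_gt0.
rewrite expRN ler_pdivrMr ?expR_gt0//; move: h; rewrite ler_pdivrMr// exprD !exprVn => h.
have xm : x ^+ m != 0 by rewrite expf_neq0 ?gt_eqF.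
have := ler_wpM2r (exprn_ge0 m (ltW x0)) h; rewrite divfK// => /le_trans; apply.
by rewrite le_eqVlt; apply/orP; left; apply/eqP; ring.
Qed.

Lemma flat0_le1 x : flat 0 x <= 1.
Proof.
have [x0|x0] := ltP 0 x; last by rewrite flat_le0.
by have := flat_le 0 0 x0; rewrite expr0 mulr1.
Qed.

Lemma is_derive_flat k (x : R) :
  is_derive x 1 (flat k) (- k%:R * flat k.+1 x + flat k.+2 x).
Proof.
have [x0|x0|<-] := ltgtP 0 x.
- have d1 : is_derive x 1 (fun y : R => y `^ (- k%:R) * expR (- y `^ (- 1)))
      (- k%:R * flat k.+1 x + flat k.+2 x).
    have e1 := is_derive1_powR (- k%:R) x0; have e2 := is_derive1_powR (- 1) x0.
    have e3 : is_derive x 1 (fun y : R => expR (- y `^ (- 1))) (expR (- x `^ (- 1)) * (- (- 1 * x `^ (- 1 - 1)))).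
      exact: is_derive1_comp (is_derive_expR _) (is_deriveN e2).
    apply: (is_derive_eq (is_deriveM e1 e3)); rewrite /GRing.scale /= flat.unlock !pwE//.
    have pD a b : x `^ (a + b) = x `^ a * x `^ b by rewrite powRD// (lt0r_neq0 x0) implybT.
    rewrite (_ : - k.+1%:R = - k%:R - 1 :> R); last by rewrite -natr1; ring.
    rewrite (_ : - k.+2%:R = - k%:R + (- 1 - 1) :> R); last by rewrite -!natr1; ring.
    by rewrite !pD; ring.
  apply: near_eq_is_derive d1; near=> y.
  have y0 : 0 < y by near: y; exact: lt_nbhsr.
  by rewrite flat.unlock !pwE.
- rewrite !flat_le0 ?(ltW x0)// mulr0 addr0.
  apply: near_eq_is_derive (is_derive_cst 0 x 1); near=> y.
  by rewrite flat_le0//; apply: ltW; near: y; exact: lt_nbhsl.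
- rewrite !flat_le0// mulr0 addr0.
  (* At 0 the difference quotient is at most [C * h], by [flat_le] with [m = 2]. *)
  suff h : h^-1 *: ((flat k \o shift 0) (h *: 1) - flat k 0) @[h --> (0 : R)^'] --> (0 : R).
    apply: DeriveDef; first by apply/cvg_ex; exists 0.
    exact/cvg_lim.
  pose C : R := (k + 2)`!%:R.
  have C0 : 0 < C by rewrite ltr0n fact_gt0.
  apply/cvgrPdist_le => e e0; near=> h.
  rewrite sub0r normrN /= addr0 [h *: 1]mulr1 (flat_le0 k (lexx 0)) subr0.
  rewrite normrM (ger0_norm (flat_ge0 _ _)).
  have [h0|h0] := ltP 0 h; last by rewrite flat_le0// mulr0 ltW.
  rewrite gtr0_norm ?invr_gt0// ler_pdivrMl// (le_trans (flat_le k 2 h0))//.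
  rewrite expr2 mulrCA ler_pM2l// -/C -ler_pdivlMl//.
  have : `|h| <= C^-1 * e.
    near: h; apply: dnbhs0_le; rewrite mulr_gt0// invr_gt0//.
  by rewrite gtr0_norm.
Unshelve. all: by end_near. Qed.

Lemma continuous_flat k : continuous (flat k).
Proof.
move=> x; apply: differentiable_continuous; apply/derivable1_diffP.
by have [] := is_derive_flat k x.
Qed.

(** Mean value theorem: the derivative is [flat 2], bounded by 2 according to [flat_le] with
    [m = 0]. *)
Lemma flat0_lipschitz x y : `|flat 0 x - flat 0 y| <= 2 * `|x - y|.
Proof.
wlog yx : x y / y <= x.
  move=> H; have [/H//|/ltW/H] := leP y x.
  by rewrite distrC (distrC y).
have d (z : R) : is_derive z 1 (flat 0) (flat 2 z).
  by apply: is_derive_eq (is_derive_flat 0 z) _; rewrite mulNr mul0r oppr0 add0r.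
have [|c _ ->] := @MVT_segment R (flat 0) (flat 2) y x yx (fun z _ => d z).
  by apply: continuous_subspaceT; exact: continuous_flat.
rewrite normrM ler_wpM2r// ger0_norm ?flat_ge0//.
have [c0|c0] := ltP 0 c; last by rewrite flat_le0.
by have := flat_le 2 0 c0; rewrite expr0 mulr1.
Qed.

End flat_functions.

(** The factors are exchanged one at a time, the other factors being at most 1. *)
Lemma prod_dist_le (R : realType) I (r : seq I) (a b : I -> R) :
  (forall i, 0 <= a i <= 1) -> (forall i, 0 <= b i <= 1) ->
  `|\prod_(i <- r) a i - \prod_(i <- r) b i| <= \sum_(i <- r) `|a i - b i|.
Proof.
move=> ha hb; elim: r => [|i r IH]; first by rewrite !big_nil subrr normr0.
rewrite !big_cons; set A := \prod_(j <- r) a j in IH *; set B := \prod_(j <- r) b j in IH *.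
have A1 : `|A| <= 1.
  have : 0 <= A <= 1.
    rewrite /A; elim: (r) => [|j q /andP[q0 q1]]; first by rewrite big_nil ler01 lexx.
    by rewrite big_cons; have /andP[? ?] := ha j; rewrite mulr_ge0// mulr_ile1.
  by move=> /andP[? ?]; rewrite ger0_norm.
have B1 : `|b i| <= 1 by have /andP[? ?] := hb i; rewrite ger0_norm.
rewrite (_ : _ - _ = (a i - b i) * A + b i * (A - B)); last by ring.
apply: (le_trans (ler_normD _ _)); rewrite !normrM lerD//.
  by rewrite ler_piMr.
by apply: le_trans IH; rewrite ler_piMl.
Qed.

Section bumps.
Context (R : realType) (n : nat).
Implicit Types x : 'rV[R]_n.
Local Notation flat := (@flat R).

(** As for [expr]: a syntactic class closed under partial derivatives turns smoothness into an
    induction. *)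
Inductive bexpr :=
  | BConst of R | BAdd of bexpr & bexpr | BMul of bexpr & bexpr
  | BFlat of nat & R & R & 'I_n.

Fixpoint beval (t : bexpr) x : R :=
  match t with
  | BConst c => c
  | BAdd a b => beval a x + beval b x
  | BMul a b => beval a x * beval b x
  | BFlat k c a i => flat k (c + a * x ord0 i)
  end.

Fixpoint bdiff (j : 'I_n) (t : bexpr) : bexpr :=
  match t with
  | BConst _ => BConst 0
  | BAdd a b => BAdd (bdiff j a) (bdiff j b)
  | BMul a b => BAdd (BMul a (bdiff j b)) (BMul b (bdiff j a))
  | BFlat k c a i => BMul (BConst (a * (i == j)%:R))
      (BAdd (BMul (BConst (- k%:R)) (BFlat k.+1 c a i)) (BFlat k.+2 c a i))
  end.

Lemma is_derive_beval j t x : is_derive x (delta_mx ord0 j) (beval t) (beval (bdiff j t) x).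
Proof.
elim: t => [c|a IHa b IHb|a IHa b IHb|k c a i] /=.
- exact: is_derive_cst.
- exact: (is_deriveD IHa IHb).
- exact: (is_derive_eq (is_deriveM IHa IHb)).
- have d1 : is_derive x (delta_mx ord0 j) (fun y : 'rV[R]_n => c + a * y ord0 i) (a * (i == j)%:R).
    apply: is_derive_eq; first by apply: is_deriveD; apply: is_deriveM; exact: is_derive_coord.
    by rewrite /GRing.scale /= mulr0 addr0 add0r mxE eqxx.
  apply: is_derive_eq; first exact: is_derive_comp (is_derive_flat _ _) d1.
  by rewrite mulrC.
Qed.

Lemma smooth_beval t : smooth (beval t).
Proof.
have ct t' : continuous (beval t').
  elim: t' => [c|a IHa b IHb|a IHa b IHb|k c a i] /=.
  - exact: continuous_cst.
  - exact: continuous_add.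
  - exact: continuous_mul.
  - apply: continuous_compo (@continuous_flat R k).
    apply: continuous_add; first exact: continuous_cst.
    by apply: continuous_mul; [exact: continuous_cst|exact: continuous_coord].
move=> l; have [t' ->] : exists t', pderiv l (beval t) = beval t'.
  elim: l => [|i l [t' IH]]; first by exists t.
  exists (bdiff i t'); rewrite /= IH; apply/funext => x.
  by have H := is_derive_beval i t' x; rewrite derive_val.
by split=> // i x; have [] := is_derive_beval i t' x.
Qed.

(** With the sup norm as the norm of row vectors, this product is positive exactly on the open unit
    ball. *)
Definition bump x : R := \prod_i (flat 0 (1 + x ord0 i) * flat 0 (1 - x ord0 i)).

Let factor (t : R) := flat 0 (1 + t) * flat 0 (1 - t).

Let factor_01 t : 0 <= factor t <= 1.
Proof. by rewrite mulr_ge0 ?flat_ge0// mulr_ile1 ?flat_ge0 ?flat0_le1. Qed.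

Lemma bump_gt0 x : (0 < bump x) = (`|x| < 1).
Proof.
apply/idP/idP => [|x1].
  rewrite ltNge => /negP b0; rewrite ltNge; apply/negP => x1; apply: b0.
  have [i xi] := mx_norm_neq0 (lt0r_neq0 (lt_le_trans ltr01 x1) : mx_norm x != 0).
  rewrite /bump (bigD1 i.2)//=; move: x1; rewrite (xi : `|x| = _) (ord1 i.1) => x1.
  suff -> : flat 0 (1 + x ord0 i.2) * flat 0 (1 - x ord0 i.2) = 0 by rewrite mul0r.
  have [h|h] := leP 0 (x ord0 i.2).
    by rewrite [X in _ * X]flat_le0 ?mulr0// subr_le0 -(ger0_norm h).
  by rewrite flat_le0 ?mul0r//; move: x1; rewrite ltr0_norm// => x1; lra.
apply: prodr_gt0 => i _; have := le_lt_trans (coord_le_norm x i) x1.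
rewrite ltr_norml => /andP[h1 h2].
by rewrite mulr_gt0// flat_gt0; lra.
Qed.

Lemma bump_ge0 x : 0 <= bump x.
Proof. by apply: prodr_ge0 => i _; have /andP[] := factor_01 (x ord0 i). Qed.

Lemma bump_lipschitz x y : `|bump x - bump y| <= (n%:R * 4) * `|x - y|.
Proof.
apply: (le_trans (@prod_dist_le R _ _ (fun i => factor (x ord0 i)) (fun i => factor (y ord0 i)) (fun i => factor_01 _) (fun i => factor_01 _))).
apply: (@le_trans _ _ (\sum_(i < n) 4 * `|x - y|)); last first.
  by rewrite sumr_const card_ord -[leLHS]mulr_natl mulrA.
apply: ler_sum => i _; have xy := coord_le_norm (x - y) i; rewrite !mxE in xy.
apply: (@le_trans _ _ (4 * `|x ord0 i - y ord0 i|)); last by rewrite ler_wpM2l.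
move: (x ord0 i) (y ord0 i) => {xy} a b; rewrite /factor.
have h1 : `|flat 0 (1 + a) - flat 0 (1 + b)| <= 2 * `|a - b|.
  by have := flat0_lipschitz (1 + a) (1 + b); rewrite (_ : 1 + a - (1 + b) = a - b)//; ring.
have h2 : `|flat 0 (1 - a) - flat 0 (1 - b)| <= 2 * `|a - b|.
  have := flat0_lipschitz (1 - a) (1 - b); rewrite (_ : 1 - a - (1 - b) = - (a - b)); last by ring.
  by rewrite normrN.
rewrite (_ : _ - _ = (flat 0 (1 + a) - flat 0 (1 + b)) * flat 0 (1 - a) + flat 0 (1 + b) * (flat 0 (1 - a) - flat 0 (1 - b))); last by ring.
rewrite (_ : 4 * _ = 2 * `|a - b| + 2 * `|a - b|); last by ring.
apply: (le_trans (ler_normD _ _)); rewrite !normrM lerD//.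
  by rewrite (le_trans _ h1)// ler_piMr// ger0_norm ?flat_ge0// flat0_le1.
by rewrite (le_trans _ h2)// ler_piMl// ger0_norm ?flat_ge0// flat0_le1.
Qed.

Lemma bump_beval (a : R) x0 : exists t, (fun x => bump (a *: (x - x0))) = beval t.
Proof.
suff [t H] : exists t, forall x, \prod_(i < n) (flat 0 (1 + (a *: (x - x0)) ord0 i) * flat 0 (1 - (a *: (x - x0)) ord0 i)) = beval t x.
  by exists t; apply/funext => x; exact: H.
elim: (index_enum _) => [|i r [t IH]]; first by exists (BConst 1) => x; rewrite big_nil.
exists (BMul (BMul (BFlat 0 (1 - a * x0 ord0 i) a i) (BFlat 0 (1 + a * x0 ord0 i) (- a) i)) t) => x.
rewrite big_cons IH /= !mxE.
have -> : 1 + a * (x ord0 i - x0 ord0 i) = 1 - a * x0 ord0 i + a * x ord0 i by ring.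
by have -> : 1 - a * (x ord0 i - x0 ord0 i) = 1 + a * x0 ord0 i + - a * x ord0 i by ring.
Qed.

Lemma measurable_bump : measurable_fun setT bump.
Proof.
have [t E] := bump_beval 1 0; rewrite (_ : bump = beval t); last first.
  by rewrite -E; apply/funext => x; rewrite subr0 scale1r.
by apply: continuous_measurable_rV; have [] := smooth_beval t [::].
Qed.

Lemma tent_bump : tent bump.
Proof.
split; last first.
  by exists 1 => // x x1; apply/eqP; rewrite eq_le bump_ge0 andbT leNgt bump_gt0 -leNgt.
split; [exact: measurable_bump|exact: bump_ge0|].
by exists (n%:R * 4); [rewrite mulr_ge0|exact: bump_lipschitz].
Qed.

Lemma bump_Cc_infty (W : set 'rV[R]_n) (a : R) x0 : 0 < a ->
  [set x | `|x - x0| <= a^-1] `<=` W -> Cc_infty W (fun x => bump (a *: (x - x0))).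
Proof.
move=> a0 aW; set f := fun x => _.
have cl : closed [set x : 'rV[R]_n | `|x - x0| <= a^-1].
  have c : continuous (fun x : 'rV[R]_n => `|x - x0|).
    move=> x; apply: continuous_comp; last exact: norm_continuous.
    by apply: continuousB; [exact: cvg_id|exact: cst_continuous].
  have := (continuous_closedP _).1 c [set t : R | t <= a^-1]; apply.
  exact: closed_le.
have sub : supp f `<=` [set x : 'rV[R]_n | `|x - x0| <= a^-1].
  rewrite (closure_id [set x : 'rV[R]_n | _]).1//; apply: closure_subset => x /= fx.
  have : 0 < f x by rewrite lt_neqAle eq_sym fx bump_ge0.
  by rewrite /f bump_gt0 normrZ gtr0_norm// mulrC -ltr_pdivlMr// div1r => /ltW.
split; last exact: subset_trans aW.
  by have [t E] := bump_beval a x0; rewrite /f E; exact: smooth_beval.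
apply: (subclosed_compact _ _ sub); first exact: closed_closure.
apply: bounded_closed_compact => //; exists (a^-1 + `|x0|); split; first exact: num_real.
move=> M hM x /= hx; apply: le_trans (ltW hM).
by have := lerB_dist x x0; lra.
Qed.

End bumps.

(** * Sobolev functions *)

Section cubes.
Context (R : realType) (n : nat).
Local Notation mu := (@lebesgue_rV R n).

Lemma measurable_ball_rV (c : 'rV[R]_n) (r : R) : measurable [set x : 'rV[R]_n | `|x - c| < r].
Proof.
have m : measurable_fun setT (fun x : 'rV[R]_n => `|x - c|).
  by have := @measurable_norm_rV R n => ?; meas.
have := m measurableT _ (measurable_itv `]-oo, r[); rewrite setTI.
by congr measurable; apply/seteqP; split => x /=; rewrite in_itv.
Qed.

(** If one cube were null, all centred cubes would be, by translation and dilation, and the heat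
    kernel would have integral 0 instead of 1. *)
Lemma lebesgue_cube_gt0 (c : 'rV[R]_n) (r : R) : 0 < r -> (0 < mu [set x : 'rV[R]_n | (`|x - c| < r)%R])%E.
Proof.
move=> r0; rewrite lt0e measure_ge0 andbT; apply/eqP => A0; have mA := measurable_ball_rV c r.
set A := [set x | _] in A0 mA.
have cube0 (k : nat) : mu [set x : 'rV[R]_n | (`|x| < k%:R)%R] = 0%E.
  case: k => [|k].
    by rewrite [X in mu X](_ : _ = set0) ?measure0//; apply/seteqP; split => x //=; rewrite ltNge normr_ge0.
  pose a := r / k.+1%:R; have a0 : 0 < a by rewrite divr_gt0.
  have mk := @measurable_norm_lt R n k.+1%:R.
  rewrite -(setIT [set x | _]) -integral_indic//.
  have mi : measurable_fun setT (fun x : 'rV[R]_n => (\1_A x : R)%:E) by apply/measurable_EFinP; exact: measurable_indic.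
  have := ge0_integral_rV_affine c a0 mi (fun x => _ : (0 <= (\1_A x : R)%:E)%E).
  have iA : (\int[mu]_x (\1_A x : R)%:E = 0)%E by rewrite integral_indic// setIT; exact: A0.
  rewrite iA mule0 => <-; last by move=> x; rewrite lee_fin indicE ler0n.
  apply: eq_integral => x _; rewrite !indicE; congr (_%:R)%:E; congr nat_of_bool.
  apply/idP/idP; rewrite !inE /A /= addrK normrZ gtr0_norm// /a.
    by move=> h; rewrite mulrAC ltr_pdivrMr// ltr_pM2l.
  by rewrite mulrAC ltr_pdivrMr// ltr_pM2l.
have m1 : measurable_fun setT (fun x : 'rV[R]_n => heat 1 x) by apply: measurable_fun_heat; meas.
have : (\int[mu]_x (heat 1 x)%:E <= 0)%E.
  apply: (@integral_le_cvg _ _ R mu (heat 1) (fun k => [set x : 'rV[R]_n | `|x| < k%:R])) => //.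
  - by move=> x; exact: heat_ge0.
  - by move=> i j ij; apply/subsetPset => x /= /lt_le_trans; apply; rewrite ler_nat.
  - by move=> k; exact: measurable_norm_lt.
  - by move=> x _; exists (Num.truncn `|x|).+1; exact: truncnS_gt.
  - move=> k; rewrite null_set_integral//; last exact: cube0; first exact: measurable_norm_lt.
    by apply/measurable_EFinP; exact: measurable_funTS.
by rewrite integral_heat// lee_fin ler10.
Qed.

Lemma lebesgue_setT_gt0 : (0 < mu setT)%E.
Proof.
apply: lt_le_trans (lebesgue_cube_gt0 0 ltr01) _; apply: le_measure => //.
- by rewrite inE; exact: measurable_ball_rV.
- by rewrite inE.
Qed.

End cubes.

Section function_spaces.
Context (R : realType) (n : nat).
Local Notation mu := (@lebesgue_rV R n).
Implicit Types (u v f : 'rV[R]_n -> R).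

Lemma Lfun2_L2 u : u \in Lfun mu 2%:E -> L2 u.
Proof.
move=> uL; have /integrableP[m i] := Lfun2_integrable_sqr uL; split.
  by have := sub_Lfun_mfun uL; rewrite inE.
apply: le_lt_trans i; apply: ge0_le_integral => //.
- by move=> x _; rewrite lee_fin sqr_ge0.
- by apply: measurableT_comp => //.
- by move=> x _; rewrite /= lee_fin ler_norm.
Qed.

Lemma Lnorm2E v : L2 v -> 'N[mu]_2%:E [EFin \o v]%E = (Num.sqrt (sqnorm v))%:E.
Proof.
move=> vL; rewrite Lnorm.unlock.
rewrite (_ : \int[mu]_x _ = (sqnorm v)%:E)%E; last first.
  rewrite -sqnormE//; apply: eq_integral => x _.
  by rewrite poweRD_2//= -EFinM -expr2 real_normK ?num_real.
by rewrite poweR_EFin powR12_sqrt// sqnorm_ge0.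
Qed.

Lemma Lfun_oo_bounded (g : 'rV[R]_n -> R) : g \in Lfun mu +oo%E ->
  measurable_fun setT g /\ exists2 M : R, 0 <= M & \forall x \ae mu, `|g x| <= M.
Proof.
move=> gL; split; first by have := sub_Lfun_mfun gL; rewrite inE.
have := sub_Lfun_finLfun gL; rewrite inE /= /finite_norm Lnorm.unlock lebesgue_setT_gt0.
move=> h; have := ess_sup_inf.ess_sup_ge mu (abse \o (EFin \o g)).
case: (ess_sup_inf.ess_sup _ _) h => [M _ H|//|_ H].
  exists (Num.max 0 M); first by rewrite le_max lexx.
  by apply: filterS H => x /=; rewrite lee_fin le_max => ->; rewrite orbT.
by exists 0 => //; apply: filterS H.
Qed.

Lemma Cc_infty_L2 (A : set 'rV[R]_n) f : Cc_infty A f -> L2 f.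
Proof.
move=> [sf cf _]; have [cont _] := sf [::]; rewrite /= in cont.
have mf : measurable_fun setT f by exact: continuous_measurable_rV.
have bnd (V : normedModType R) (B : set V) : bounded_set B -> exists2 N : R, 0 <= N & forall x, B x -> `|x| <= N.
  move=> [M [_ HM]]; exists (Num.max 0 (M + 1)); first by rewrite le_max lexx.
  move=> x Bx; have M1 : M < M + 1 by rewrite ltrDl.
  by have := HM _ M1 x Bx => /= h; rewrite le_max h orbT.
have [M M0 HM] := bnd _ _ (compact_bounded (continuous_compact (continuous_subspaceT cont) cf)).
have [N N0 HN] := bnd _ _ (compact_bounded cf).
split=> //; have mw := @measurable_cube_weight R n N.
have le x : f x ^+ 2 <= M ^+ 2 * cube_weight N x.
  have w0 := cube_weight_ge0 N x.
  have [->|fx] := eqVneq (f x) 0; first by rewrite expr0n mulr_ge0// sqr_ge0.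
  have sx : supp f x by apply: subset_closure.
  have xN := HN _ sx; have w1 := cube_weight_ge1 xN.
  have fM : `|f x| <= M by apply: HM; exists x.
  rewrite -(real_normK (num_real _)) (@le_trans _ _ (M ^+ 2))//.
    by rewrite lerXn2r ?nnegrE.
  by rewrite ler_peMr ?sqr_ge0.
apply: (@le_lt_trans _ _ (\int[mu]_x (M ^+ 2 * cube_weight N x)%:E)%E).
  by apply: le_int; [meas|meas|move=> x; exact: sqr_ge0|].
rewrite intZl; [|by []|exact: cube_weight_ge0|exact: sqr_ge0].
by rewrite lte_mul_pinfty ?lee_fin ?sqr_ge0// integral_cube_weight.
Qed.

End function_spaces.

Section sobolev_functions.
Context (R : realType) (n : nat) (s : R).
Hypothesis s0 : 0 < s.
Hypothesis s1 : s < 1.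
Local Notation mu := (@lebesgue_rV R n).
Local Notation mm := (mu \x mu)%E.
Implicit Types (u v f : 'rV[R]_n -> R).

Let mriesz : measurable_fun setT (fun z : 'rV[R]_n * 'rV[R]_n => riesz s (z.1 - z.2)).
Proof. by apply: measurable_riesz; meas. Qed.

Lemma energy_ae u v : measurable_fun setT u -> measurable_fun setT v ->
  (\forall x \ae mu, u x = v x) -> energy s u = energy s v.
Proof.
move=> mu' mv uv; have mr := mriesz; apply: ge0_ae_eq_integral => //.
- by meas.
- by meas.
- by move=> z _; rewrite lee_fin mulr_ge0 ?riesz_ge0 ?sqr_ge0.
- by move=> z _; rewrite lee_fin mulr_ge0 ?riesz_ge0 ?sqr_ge0.
by apply: filterS (ae_prod uv) => z [-> ->].
Qed.

(** [u] is [Jop s v] almost everywhere, and [Jop] does not increase the norm. This is the only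
    comparison of the Sobolev norm with the square norm that is used. *)
Lemma bessel_potential_sqnorm u v : L2 u -> bessel_potential s u v -> sqnorm u <= sqnorm v.
Proof.
move=> uL uv; have vL : L2 v by apply: Lfun2_L2; case: uv.
have [mu' _] := uL; have JL := Jop_L2 s0 vL; have [mJ _] := JL.
rewrite -lee_fin -sqnormE//; apply: le_trans (Jop_sqnorm s0 vL).
rewrite le_eqVlt; apply/orP; left; apply/eqP; apply: ge0_ae_eq_integral => //.
- by apply/measurable_EFinP; meas.
- by apply/measurable_EFinP; meas.
- by move=> x _; rewrite lee_fin sqr_ge0.
- by move=> x _; rewrite lee_fin sqr_ge0.
by apply: filterS (bessel_potential_Jop s0 uL vL uv) => x ->.
Qed.

Lemma sobolev_L2 u : sobolev s u -> L2 u.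
Proof. by move=> [uL _]; exact: Lfun2_L2. Qed.

Lemma sobolev_energy u : sobolev s u -> (energy s u < +oo)%E.
Proof.
move=> su; have uL := sobolev_L2 su; have [_ [v uv]] := su.
have vL : L2 v by apply: Lfun2_L2; case: uv.
rewrite (energy_ae uL.1 (Jop_L2 s0 vL).1 (bessel_potential_Jop s0 uL vL uv)).
exact: Jop_energy.
Qed.

(** The approximants are supported in [Omega], so on [W] the difference is [u] itself; its square
    integral over [W] is bounded by the squared Sobolev norm of the difference. *)
Lemma sobolev_tilde_ae0 (Omega W : set 'rV[R]_n) u : open W -> W `<=` exterior Omega ->
  sobolev_tilde s Omega u -> \forall x \ae mu, W x -> u x = 0.
Proof.
move=> oW WO [su Hu]; have uL := sobolev_L2 su; have [mu' _] := uL.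
have mW := open_measurable_rV oW.
have m2 : measurable_fun W (fun x => (u x ^+ 2)%:E).
  by apply: measurable_funTS; apply/measurable_EFinP; meas.
have small (e : R) : 0 < e -> (\int[mu]_(x in W) (u x ^+ 2)%:E <= (e ^+ 2)%:E)%E.
  move=> e0; have [phi pO] := Hu e e0.
  move=> /ereal_inf_lt[_ [v uv <-]]; have vL : L2 v by apply: Lfun2_L2; case: uv.
  rewrite Lnorm2E// lte_fin => ve.
  have pL := Cc_infty_L2 pO; have [mp _] := pL.
  have dL : L2 (u \- phi)%R.
    split; first by apply: measurable_funB.
    have := integrable_add (integrable_mull 2 (L2_integrable_sqr uL)) (integrable_mull 2 (L2_integrable_sqr pL)).
    move=> /integrableP[_]; apply: le_lt_trans; apply: ge0_le_integral => //.
    - by move=> x _; rewrite lee_fin sqr_ge0.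
    - by apply/measurable_EFinP; apply: measurable_funX; exact: measurable_funB.
    - by apply/measurable_EFinP; apply: measurable_fun_normr; meas.
    - move=> x _; rewrite lee_fin (le_trans _ (ler_norm _))//.
      by have := sqr_ge0 (u x + phi x); rewrite /=; nra.
  have [md _] := dL.
  apply: (@le_trans _ _ (sqnorm (u \- phi)%R)%:E); last first.
    rewrite lee_fin (le_trans (bessel_potential_sqnorm dL uv))//.
    by rewrite -(sqr_sqrtr (sqnorm_ge0 v)) lerXn2r ?nnegrE ?sqrtr_ge0 ?(ltW e0)// ltW.
  rewrite -sqnormE// integral_mkcond; apply: ge0_le_integral => //.
  - by move=> x _; rewrite patchE; case: ifP => // _; rewrite lee_fin sqr_ge0.
  - by apply/(measurable_restrictT _ mW).
  - by apply/measurable_EFinP; meas.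
  move=> x _; rewrite patchE; case: ifPn => [|_]; last by rewrite lee_fin sqr_ge0.
  rewrite inE => /WO xO /=; rewrite lee_fin.
  have [_ _ sO] := pO; suff -> : phi x = 0 by rewrite subr0.
  apply: contrapT => /eqP px; apply: xO; apply: subset_closure; apply: sO.
  exact: subset_closure.
have zero : (\int[mu]_(x in W) (u x ^+ 2)%:E = 0)%E.
  apply/eqP; rewrite eq_le integral_ge0 ?andbT; last by move=> x _; rewrite lee_fin sqr_ge0.
  apply/lee_addgt0Pr => e e0; rewrite add0e.
  have q0 : 0 < Num.sqrt e by rewrite sqrtr_gt0.
  by have := small _ q0; rewrite sqr_sqrtr// ltW.
have /(ae_eq_integral_abs mu mW m2) : (\int[mu]_(x in W) `|(u x ^+ 2)%:E| = 0)%E.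
  by rewrite -zero; apply: eq_integral => x _; rewrite gee0_abs// lee_fin sqr_ge0.
by apply: filterS => x h /h [] /eqP; rewrite sqrf_eq0 => /eqP.
Qed.

Lemma sqnorm_affine f (a : R) (x0 : 'rV[R]_n) : 0 < a -> L2 f ->
  L2 (fun x => f (a *: (x - x0))) /\ sqnorm (fun x => f (a *: (x - x0))) = a ^- n * sqnorm f.
Proof.
move=> a0 fL; have [mf fy] := fL.
have E : (\int[mu]_x (f (a *: (x - x0)) ^+ 2)%:E = (a ^- n * sqnorm f)%:E)%E.
  have mg : measurable_fun setT (fun x => (f x ^+ 2)%:E) by apply/measurable_EFinP; meas.
  have := ge0_integral_rV_affine (- (a *: x0)) a0 mg (fun x => _ : (0 <= (f x ^+ 2)%:E)%E).
  rewrite (sqnormE fL) -EFinM => <-; last by move=> x; rewrite lee_fin sqr_ge0.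
  by apply: eq_integral => x _; rewrite scalerBr.
have L : L2 (fun x => f (a *: (x - x0))) by split; [meas|rewrite E ltry].
by split=> //; apply/EFin_inj; rewrite -sqnormE.
Qed.

Lemma riesz_scale (a : R) (h : 'rV[R]_n) : 0 < a ->
  riesz s h = a `^ (n%:R + 2 * s) * riesz s (a *: h).
Proof.
move=> a0; rewrite /riesz (enormZ _ (ltW a0)) powRM ?(ltW a0) ?enorm_ge0//.
by rewrite invfM mulrA divff ?mul1r// gt_eqF// powR_gt0.
Qed.

(** Homogeneity of the kernel gives [a^(n+2*s)] and each of the two variables a Jacobian [a^(-n)].
    Relative to the squared norm, which scales by [a^(-n)], the gain is [a^(2*s)]. *)
Lemma energy_affine f (a : R) (x0 : 'rV[R]_n) : 0 < a -> measurable_fun setT f ->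
  energy s (fun x => f (a *: (x - x0))) =
  ((a `^ (n%:R + 2 * s))%:E * ((a ^- n)%:E * ((a ^- n)%:E * energy s f)))%E.
Proof.
move=> a0 mf; have mr := mriesz.
pose G x y := riesz s (x - y) * (f x - f y) ^+ 2.
have G0 x y : 0 <= G x y by rewrite mulr_ge0 ?riesz_ge0 ?sqr_ge0.
have mG : measurable_fun setT (fun z : 'rV[R]_n * 'rV[R]_n => G z.1 z.2) by rewrite /G; meas.
have mG2 x : measurable_fun setT (G x).
  exact: (measurableT_comp mG (@pair1_measurable _ _ _ _ x)).
pose b := - (a *: x0).
have Ef : (energy s f = \int[mu]_x \int[mu]_y (G x y)%:E)%E.
  by rewrite -(@tonelli_prod _ _ _ _ _ mu mu G).
pose K := a `^ (n%:R + 2 * s).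
have K0 : 0 <= K by exact: powR_ge0.
have mG' : measurable_fun setT (fun z : 'rV[R]_n * 'rV[R]_n => G (a *: z.1 + b) (a *: z.2 + b)).
  apply: (measurableT_comp mG (_ : measurable_fun setT (fun z : 'rV[R]_n * 'rV[R]_n => (a *: z.1 + b, a *: z.2 + b)))).
  by meas.
rewrite (_ : energy s _ = \int[mm]_z (K * G (a *: z.1 + b) (a *: z.2 + b))%:E)%E; last first.
  apply: eq_integral => z _; rewrite /G (riesz_scale _ a0) -/K.
  have e1 (y : 'rV[R]_n) : a *: y + b = a *: (y - x0) by rewrite scalerBr.
  rewrite !e1 -scalerBr (_ : z.1 - x0 - (z.2 - x0) = z.1 - z.2) ?mulrA//.
  by rewrite opprB addrA subrK.
rewrite intZl//; congr (_ * _)%E.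
rewrite (@tonelli_prod _ _ _ _ _ mu mu (fun x y => G (a *: x + b) (a *: y + b)))//.
have inner x : (\int[mu]_y (G x (a *: y + b))%:E = (a ^- n)%:E * \int[mu]_y (G x y)%:E)%E.
  have m1 : measurable_fun setT (fun y => (G x y)%:E) by apply/measurable_EFinP.
  by rewrite -(ge0_integral_rV_affine b a0 m1)// => y; rewrite lee_fin.
under eq_integral do rewrite inner.
have an0 : (0 <= a ^- n) by rewrite invr_ge0 exprn_ge0// ltW.
have mI : measurable_fun setT (fun x => \int[mu]_y (G x y)%:E)%E by exact: (@measurable_int2 _ _ _ _ _ mu G).
have I0 x : (0 <= \int[mu]_y (G x y)%:E)%E by exact: int_ge0.
rewrite ge0_integralZl_EFin//; last first.
  by apply: (measurableT_comp mI); meas.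
congr (_ * _)%E; rewrite Ef.
exact: (ge0_integral_rV_affine b a0 mI I0).
Qed.

(** With zero energy the integrand would vanish almost everywhere, but it is positive on a product
    of two unit balls, one around 0 and one away from the support of the bump. The second ball
    exists because [n >= 1]. *)
Lemma energy_bump_gt0 : (1 <= n)%N -> (0 < energy s (@bump R n))%E.
Proof.
move=> n1; have mr := mriesz; have mb := @measurable_bump R n.
rewrite lt0e; apply/andP; split; last first.
  by apply: integral_ge0 => z _; rewrite lee_fin mulr_ge0 ?riesz_ge0 ?sqr_ge0.
apply/eqP => e0.
pose H (z : 'rV[R]_n * 'rV[R]_n) := (riesz s (z.1 - z.2) * (bump z.1 - bump z.2) ^+ 2)%:E.
have mH : measurable_fun setT H by rewrite /H; meas.
have /(ae_eq_integral_abs mm measurableT mH) : (\int[mm]_z `|H z| = 0)%E.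
  rewrite -e0; apply: eq_integral => z _; rewrite gee0_abs//.
  by rewrite lee_fin mulr_ge0 ?riesz_ge0 ?sqr_ge0.
(* At sup distance 3 from the origin, so that every point of the unit ball around [c] has norm at
   least 2. *)
pose c : 'rV[R]_n := const_mx 3.
pose A := [set x : 'rV[R]_n | `|x - 0| < 1]; pose C := [set x : 'rV[R]_n | `|x - c| < 1].
have mA : measurable A by exact: measurable_ball_rV.
have mC : measurable C by exact: measurable_ball_rV.
have c3 : 3 <= `|c|.
  by have := coord_le_norm c (Ordinal n1); rewrite mxE ger0_norm.
move=> [N [mN N0 HN]].
have sub : A `*` C `<=` N.
  move=> [x y] [/= Ax Cy]; apply: HN => /= h; have := h I; rewrite /H /=.
  have bx : 0 < bump x by rewrite bump_gt0; move: Ax; rewrite /A /= subr0.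
  have yc : 2 <= `|y|.
    by have := lerB_dist c y; move: Cy; rewrite /C /= distrC; lra.
  have by0 : bump y = 0.
    by apply/eqP; rewrite eq_le bump_ge0 andbT leNgt bump_gt0 -leNgt (le_trans _ yc)// ler1n.
  rewrite by0 subr0 => -[] /eqP; rewrite mulf_eq0 sqrf_eq0 (gt_eqF bx) orbF.
  rewrite /riesz invr_eq0 powR_eq0 => /andP[/eqP exy _].
  have : x - y = 0.
    by apply: dotp_eq0; rewrite -enorm_sqr exy expr0n.
  by move=> /eqP; rewrite subr_eq0 => /eqP xy; move: bx; rewrite xy by0 ltxx.
have AC : mm (A `*` C) = 0%E.
  by apply: (subset_measure0 _ _ sub) => //; exact: measurableX.
have := AC; rewrite product_measure1E// => /eqP; rewrite mule_eq0.
by move=> /orP[] /eqP h; [have := @lebesgue_cube_gt0 R n 0 1 ltr01|have := @lebesgue_cube_gt0 R n c 1 ltr01]; rewrite [X in (_ < X)%E]h ltxx.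
Qed.

End sobolev_functions.

(** * The conductivity form *)

Lemma frac_const_gt0 (R : realType) (n : nat) (s : R) : 0 < s -> s < 1 -> 0 < frac_const n s.
Proof.
move=> s0 s1; rewrite /frac_const divr_gt0//.
  rewrite mulr_gt0 ?powR_gt0// /Gamma.
  have h : 0 < n%:R / 2 + s by rewrite ltr_wpDl// divr_ge0.
  by rewrite h euler_integral_gt0.
rewrite mulr_gt0 ?powR_gt0 ?pi_gt0// normr_gt0 /Gamma oppr_gt0 ltNge (ltW s0)/= opprK.
(* As [0 < s < 1], one step of the recurrence suffices: [Gamma (- s) = euler_integral (1 - s) / (-
   s)]. *)
have -> : Num.truncn s = 0%N by apply/eqP; rewrite truncn_eq ?(ltW s0)//= (ltW s0) s1.
rewrite big_ord_recr big_ord0 /= mul1r addr0 mulf_neq0//.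
  by rewrite gt_eqF// euler_integral_gt0// addrC subr_gt0.
by rewrite invr_eq0 oppr_eq0 gt_eqF.
Qed.

HB.lock Definition sqw (R : realType) (n : nat) (gamma : 'rV[R]_n -> R)
    (z : 'rV[R]_n * 'rV[R]_n) : R :=
  Num.sqrt (gamma z.1) * Num.sqrt (gamma z.2).

Section conductivity_form.
Context (R : realType) (n : nat) (s : R).
Hypothesis s0 : 0 < s.
Hypothesis s1 : s < 1.
Local Notation mu := (@lebesgue_rV R n).
Local Notation mm := (mu \x mu)%E.
Implicit Types (u v w f : 'rV[R]_n -> R).

Definition form gamma u v : R :=
  \int[mm]_z (sqw gamma z * riesz s (z.1 - z.2) * (u z.1 - u z.2) * (v z.1 - v z.2)).

Lemma bilinear_formE gamma u v : bilinear_form s gamma u v = frac_const n s / 2 * form gamma u v.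
Proof. by rewrite /form sqw.unlock. Qed.

Definition finite_energy u := measurable_fun setT u /\ (energy s u < +oo)%E.

Let mriesz : measurable_fun setT (fun z : 'rV[R]_n * 'rV[R]_n => riesz s (z.1 - z.2)).
Proof. by apply: measurable_riesz; meas. Qed.

Lemma bilinear_form_ae gamma gamma' u v : measurable_fun setT gamma -> measurable_fun setT gamma' ->
  measurable_fun setT u -> measurable_fun setT v ->
  (\forall x \ae mu, gamma x = gamma' x) -> bilinear_form s gamma u v = bilinear_form s gamma' u v.
Proof.
move=> mg mg' mu' mv gg; rewrite !bilinear_formE /form /Rintegral; congr (_ * fine _).
have mr := mriesz; apply: ae_eq_integral => //.
- by rewrite sqw.unlock; meas.
- by rewrite sqw.unlock; meas.
by apply: filterS (ae_prod gg) => z [e1 e2] _; rewrite sqw.unlock e1 e2.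
Qed.

Section bounded_conductivity.
Variables (gamma : 'rV[R]_n -> R) (G : R).
Hypothesis mg : measurable_fun setT gamma.
Hypothesis g0 : forall x, 0 <= gamma x.
Hypothesis gG : forall x, gamma x <= G.

Lemma sqw_ge0 z : 0 <= sqw gamma z.
Proof. by rewrite sqw.unlock mulr_ge0 ?sqrtr_ge0. Qed.

Let G0 : 0 <= G. Proof. exact: le_trans (g0 0) (gG 0). Qed.

Lemma sqw_le z : sqw gamma z <= G.
Proof.
rewrite sqw.unlock -[leRHS](sqr_sqrtr G0) expr2 ler_pM ?sqrtr_ge0//; exact: ler_wsqrtr.
Qed.

Let msqw : measurable_fun setT (sqw gamma).
Proof. by rewrite sqw.unlock; meas. Qed.

Let e2 u z := riesz s (z.1 - z.2) * (u z.1 - u z.2) ^+ 2.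

Let e2_ge0 u z : 0 <= e2 u z.
Proof. by rewrite mulr_ge0 ?riesz_ge0 ?sqr_ge0. Qed.

(** Every bilinear expansion of the form rests on this, as [Rintegral] is additive only on
    integrable functions; Young's inequality gives the majorant. *)
Lemma form_integrable u v : finite_energy u -> finite_energy v ->
  mm.-integrable setT (EFin \o (fun z =>
    sqw gamma z * riesz s (z.1 - z.2) * (u z.1 - u z.2) * (v z.1 - v z.2))).
Proof.
move=> [mu' uy] [mv vy]; have mr := mriesz; have ms := msqw.
apply: (@integrable_dom _ _ R mm _ (fun z => G * (e2 u z + e2 v z))); [by meas|by rewrite /e2; meas| |].
  move=> z; rewrite /e2 -mulrDr !normrM (ger0_norm (sqw_ge0 z)) (ger0_norm (riesz_ge0 _ _)).
  rewrite -!mulrA ler_pM ?sqw_ge0 ?sqw_le//.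
    by rewrite mulr_ge0 ?riesz_ge0// mulr_ge0.
  rewrite ler_wpM2l ?riesz_ge0// -[in leRHS](real_normK (num_real (u z.1 - u z.2))).
  rewrite -[in leRHS](real_normK (num_real (v z.1 - v z.2))).
  move: (normr_ge0 (u z.1 - u z.2)) (normr_ge0 (v z.1 - v z.2)).
  by move: `|u z.1 - u z.2| `|v z.1 - v z.2| => a b a0 b0; have := sqr_ge0 (a - b); nra.
have m1 : measurable_fun setT (e2 u) by rewrite /e2; meas.
have m2 : measurable_fun setT (e2 v) by rewrite /e2; meas.
rewrite intZl//; [|by meas|by move=> z; rewrite addr_ge0].
by rewrite intD// lte_mul_pinfty ?lee_fin//; exact: lte_add_pinfty.
Qed.

Lemma formDl u v w : finite_energy u -> finite_energy v -> finite_energy w ->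
  form gamma (fun x => u x + v x) w = form gamma u w + form gamma v w.
Proof.
move=> fu fv fw; rewrite /form -(RintegralD measurableT (form_integrable fu fw) (form_integrable fv fw)).
by apply: eq_Rintegral => z _; ring.
Qed.

Lemma formC u v : form gamma u v = form gamma v u.
Proof. by apply: eq_Rintegral => z _; ring. Qed.

Lemma formE u : finite_energy u ->
  (form gamma u u)%:E = (\int[mm]_z (sqw gamma z * e2 u z)%:E)%E.
Proof.
move=> fu; rewrite /form EFin_Rintegral; last exact: form_integrable.
by apply: eq_integral => z _; congr EFin; rewrite /e2; ring.
Qed.

Lemma form_ge0 u : finite_energy u -> 0 <= form gamma u u.
Proof.
by move=> fu; rewrite -lee_fin formE//; apply: int_ge0 => z; rewrite mulr_ge0 ?sqw_ge0.
Qed.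

End bounded_conductivity.

(* The part of the energy of [f] carried by pairs of points at distance at least [r]. *)
Definition far (r : R) f (z : 'rV[R]_n * 'rV[R]_n) : R :=
  if r <= `|z.1 - z.2| then f z.1 ^+ 2 + f z.2 ^+ 2 else 0.

Lemma far_ge0 r f z : 0 <= far r f z.
Proof. by rewrite /far; case: ifP => // _; rewrite addr_ge0 ?sqr_ge0. Qed.

Lemma measurable_far r f : measurable_fun setT f -> measurable_fun setT (far r f).
Proof. by move=> mf; rewrite /far; have := @measurable_norm_rV R n => ?; meas. Qed.

(** In [integral_riesz_bound], the bound uniform in [t] comes from the mass 1 of the heat kernel,
    and the bound linear in [t] from [heat_far_le]. *)
Lemma far_bound r : 0 < r -> exists2 C : R, 0 <= C & forall f, L2 f ->
  (\int[mm]_z (riesz s (z.1 - z.2) * far r f z)%:E <= (C * sqnorm f)%:E)%E.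
Proof.
move=> r0; have [C C0 HC] := @integral_riesz_bound R n s s0 s1.
pose K : R := 2 `^ (n%:R / 2) * 8 / r ^+ 2.
have K0 : 0 <= K by rewrite divr_ge0 ?sqr_ge0// mulr_ge0 ?powR_ge0.
exists (C * (2 + 2 * K)); first by rewrite mulr_ge0// addr_ge0// mulr_ge0.
move=> f fL; have [mf _] := fL; have S0 := sqnorm_ge0 f.
have mF := @measurable_far r f mf.
pose k x := f x ^+ 2.
have mk : measurable_fun setT k by rewrite /k; meas.
have k0 x : 0 <= k x by exact: sqr_ge0.
have mh t : measurable_fun setT (fun z : 'rV[R]_n * 'rV[R]_n => heat t (z.1 - z.2)).
  by apply: measurable_fun_heat; meas.
have hk t z : 0 <= heat t (z.1 - z.2) * (k z.1 + k z.2).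
  by apply: mulr_ge0; [exact: heat_ge0|exact: addr_ge0].
have tot t : 0 < t -> (\int[mm]_z (heat t (z.1 - z.2) * (k z.1 + k z.2))%:E = (2 * sqnorm f)%:E)%E.
  move=> t0; have mht := mh t.
  rewrite (@tonelli_prod _ _ _ _ _ mu mu (fun x y => heat t (x - y) * (k x + k y))); [|by meas|by move=> x y; exact: (hk t (x, y))].
  by rewrite integral_energy_weight// EFinM; congr (_ * _)%E; rewrite -sqnormE.
rewrite (_ : C * _ * _ = C * (2 * sqnorm f + 2 * K * sqnorm f)); last by ring.
have hF t z : 0 <= heat t (z.1 - z.2) * far r f z.
  by apply: mulr_ge0; [exact: heat_ge0|exact: far_ge0].
apply: HC; [exact: mF|exact: far_ge0|exact: mulr_ge0|by apply: mulr_ge0 => //; exact: mulr_ge0| |].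
- move=> t t0; have mht := mh t; rewrite -(tot t t0); apply: le_int; [by meas|by meas|exact: hF|] => z.
  rewrite ler_wpM2l ?heat_ge0// /far; case: ifP => // _; exact: addr_ge0.
- move=> t t0; have t20 : 0 < 2 * t by exact: mulr_gt0.
  have mht := mh t; have mh2 := mh (2 * t).
  apply: (@le_trans _ _ (\int[mm]_z (K * t * (heat (2 * t) (z.1 - z.2) * (k z.1 + k z.2)))%:E)%E).
    apply: le_int; [by meas|by meas|exact: hF|] => z.
    rewrite /far; case: ifP => [rz|_]; last by rewrite mulr0 mulr_ge0 ?hk// mulr_ge0// ltW.
    rewrite [leRHS]mulrA; apply: (ler_wpM2r (addr_ge0 (k0 z.1) (k0 z.2))).
    apply: heat_far_le => //; apply: le_trans (norm_sqr_le_dotp _).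
    by rewrite lerXn2r ?nnegrE// ltW.
  rewrite intZl; [|by meas|exact: hk|by rewrite mulr_ge0// ltW].
  rewrite tot// -EFinM lee_fin le_eqVlt; apply/orP; left; apply/eqP; ring.
Qed.

(** If one point lies outside the ball of radius [2 * r], then [f] vanishes there; the other point
    is either outside the ball of radius [r], where [f] vanishes too, or at distance at least [r]
    from the first. *)
Lemma near_or_far (r : R) (x0 : 'rV[R]_n) f z : 0 < r -> (forall x, r <= `|x - x0| -> f x = 0) ->
  (`|z.1 - x0| < 2 * r /\ `|z.2 - x0| < 2 * r) \/ (f z.1 - f z.2) ^+ 2 <= far r f z.
Proof.
case: z => x1 y1 /= r0 f0; have far0 := far_ge0 r f (x1, y1).
have main (x y : 'rV[R]_n) : 2 * r <= `|x - x0| -> (f x - f y) ^+ 2 <= far r f (x, y).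
  move=> hx; have fx : f x = 0 by apply: f0; lra.
  have [hy|hy] := leP r `|y - x0|.
    by rewrite fx f0// subrr expr0n far_ge0.
  rewrite /far /=; have -> : r <= `|x - y|.
    have := ler_normD (x - y) (y - x0); rewrite subrKA; lra.
  by rewrite fx sub0r sqrrN expr0n add0r.
have [hx|hx] := ltP `|x1 - x0| (2 * r); last by right; exact: main.
have [hy|hy] := ltP `|y1 - x0| (2 * r); first by left.
right; have := main y1 x1 hy; rewrite /far /= distrC (addrC (f y1 ^+ 2)).
by rewrite -[in X in X -> _](sqrrN (f y1 - f x1)) opprB.
Qed.

(** Testing the equation for the solution with [w] itself makes the energy of [w] an interaction
    with [f], to which only far pairs contribute. *)
Lemma far_interaction_le (gamma : 'rV[R]_n -> R) (G B : R) (W : set 'rV[R]_n) (r : R) (x0 : 'rV[R]_n) f w :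
  measurable_fun setT gamma -> (forall x, 0 <= gamma x) -> (forall x, gamma x <= G) ->
  0 < r -> (forall x, `|x - x0| < 2 * r -> W x) ->
  (forall x, r <= `|x - x0| -> f x = 0) -> finite_energy f -> finite_energy w ->
  (\forall x \ae mu, W x -> w x = 0) -> form gamma f w = - form gamma w w ->
  (\int[mm]_z (riesz s (z.1 - z.2) * far r f z)%:E <= B%:E)%E ->
  form gamma w w <= G * B.
Proof.
move=> mg g0 gG r0 rW f0 fe we w0 fw; set X := (\int[mm]_z _)%E => XB; have mr := mriesz.
have [mf fy] := fe; have [mw wy] := we.
have G0 : 0 <= G by exact: le_trans (g0 0) (gG 0).
have mF := @measurable_far r f mf.
pose e2 (u : 'rV[R]_n -> R) z := riesz s (z.1 - z.2) * (u z.1 - u z.2) ^+ 2.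
have e20 u z : 0 <= e2 u z by rewrite mulr_ge0 ?riesz_ge0 ?sqr_ge0.
have mew : measurable_fun setT (e2 w) by rewrite /e2; meas.
have ms : measurable_fun setT (sqw gamma) by rewrite sqw.unlock; meas.
have rF z : 0 <= riesz s (z.1 - z.2) * far r f z by rewrite mulr_ge0 ?riesz_ge0 ?far_ge0.
have s0' := sqw_ge0 gamma; have sG := sqw_le g0 gG.
(* Young's inequality leaves half of the energy of [w] on the right, to be absorbed on the left;
   near pairs contribute nothing because [w] vanishes at both points. *)
have key : ((form gamma w w)%:E <= 2^-1%:E * ((form gamma w w)%:E + G%:E * X))%E.
  rewrite -{1}(opprK (form gamma w w)) -fw.
  apply: (@le_trans _ _ `|form gamma f w|%:E); first by rewrite lee_fin -normrN ler_norm.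
  apply: (le_trans (abs_Rintegral_le (form_integrable mg g0 gG fe we))).
  have t0 z : 0 <= sqw gamma z * e2 w z by exact: mulr_ge0.
  have t1 z : 0 <= G * (riesz s (z.1 - z.2) * far r f z) by exact: mulr_ge0.
  rewrite (formE mg g0 gG we) /X -intZl; [|by meas|exact: rF|exact: G0].
  rewrite -intD; [|by meas|by meas|exact: t0|exact: t1].
  have t2 z : 0 <= sqw gamma z * e2 w z + G * (riesz s (z.1 - z.2) * far r f z) by exact: addr_ge0.
  rewrite -intZl; [|by meas|exact: t2|by rewrite invr_ge0].
  apply: ae_ge0_le_integral => //.
  - by apply/measurable_EFinP; meas.
  - by move=> z _; rewrite lee_fin; apply: mulr_ge0; [rewrite invr_ge0|exact: t2].
  - by apply/measurable_EFinP; meas.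
  apply: filterS (ae_prod w0) => z [w1 w2] _; rewrite lee_fin.
  have [[z1 z2]|hF] := near_or_far z r0 f0.
    rewrite [leLHS](_ : _ = 0); last by rewrite w1 ?w2; [rewrite subrr mulr0 normr0|exact: rW..].
    by apply: mulr_ge0; [rewrite invr_ge0|exact: t2].
  rewrite !normrM (ger0_norm (s0' z)) (ger0_norm (riesz_ge0 _ _)) /e2.
  have k0 := riesz_ge0 s (z.1 - z.2).
  move: (s0' z) (sG z) k0 hF (far_ge0 r f z).
  rewrite -(real_normK (num_real (f z.1 - f z.2))) -(real_normK (num_real (w z.1 - w z.2))).
  move: (sqw gamma z) (riesz s _) `|f z.1 - f z.2| `|w z.1 - w z.2| (far r f z) => p k a b F p0 pG k0 hF F0.
  have h1 : 2 * (a * b) <= a ^+ 2 + b ^+ 2 by have := sqr_ge0 (a - b); nra.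
  have pk0 : 0 <= p * k by exact: mulr_ge0.
  have h2 := ler_wpM2l pk0 h1.
  have h3 : p * k * a ^+ 2 <= G * (k * F).
    rewrite -mulrA; apply: ler_pM => //; first by rewrite mulr_ge0 ?sqr_ge0.
    exact: ler_wpM2l.
  by nra.
have GX : (G%:E * X <= (G * B)%:E)%E by rewrite EFinM lee_wpmul2l ?lee_fin.
have := le_trans key (lee_wpmul2l (_ : (0 <= 2^-1%:E)%E) (leeD2l _ GX)).
by rewrite -EFinD -EFinM !lee_fin invr_ge0 => /(_ (ler0n _ 2)); lra.
Qed.

End conductivity_form.

(** * Boundary determination *)

Section boundary_determination.
Context (R : realType) (n : nat) (s : R).
Hypothesis s0 : 0 < s.
Hypothesis s1 : s < 1.
Local Notation mu := (@lebesgue_rV R n).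
Local Notation mm := (mu \x mu)%E.
Implicit Types (u v w f gamma : 'rV[R]_n -> R).

(** For near pairs the geometric means satisfy [sqw gamma1 >= a + eta] and [sqw gamma2 <= a]; far
    pairs are charged at most [G + eta]. *)
Lemma energy_gap gamma1 gamma2 (G B a eta r : R) (x0 : 'rV[R]_n) f :
  measurable_fun setT gamma1 -> (forall x, 0 <= gamma1 x) -> (forall x, gamma1 x <= G) ->
  measurable_fun setT gamma2 -> (forall x, 0 <= gamma2 x) -> (forall x, gamma2 x <= G) ->
  0 <= a -> 0 < eta -> 0 < r ->
  (\forall x \ae mu, `|x - x0| < 2 * r -> gamma2 x <= a /\ a + eta <= gamma1 x) ->
  (forall x, r <= `|x - x0| -> f x = 0) -> finite_energy s f ->
  (\int[mm]_z (riesz s (z.1 - z.2) * far r f z)%:E <= B%:E)%E ->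
  (eta%:E * energy s f <= (form s gamma1 f f - form s gamma2 f f + (G + eta) * B)%:E)%E.
Proof.
move=> m1 g10 g1G m2 g20 g2G a0 e0 r0 gap f0 fe XB; have [mf fy] := fe.
have mr : measurable_fun setT (fun z : 'rV[R]_n * 'rV[R]_n => riesz s (z.1 - z.2)).
  by apply: measurable_riesz; meas.
have mF := @measurable_far R n r f mf.
have G0 : 0 <= G by exact: le_trans (g10 0) (g1G 0).
have Ge0 : 0 <= G + eta by rewrite addr_ge0// ltW.
pose e2 (z : 'rV[R]_n * 'rV[R]_n) := riesz s (z.1 - z.2) * (f z.1 - f z.2) ^+ 2.
have e20 z : 0 <= e2 z by rewrite mulr_ge0 ?riesz_ge0 ?sqr_ge0.
have me : measurable_fun setT e2 by rewrite /e2; meas.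
have ms1 : measurable_fun setT (sqw gamma1) by rewrite sqw.unlock; meas.
have ms2 : measurable_fun setT (sqw gamma2) by rewrite sqw.unlock; meas.
have p10 := sqw_ge0 gamma1; have p1G := sqw_le g10 g1G.
have p20 := sqw_ge0 gamma2; have p2G := sqw_le g20 g2G.
have rF z : 0 <= riesz s (z.1 - z.2) * far r f z by rewrite mulr_ge0 ?riesz_ge0 ?far_ge0.
(* The form of [gamma2] is moved to the left so that only nonnegative integrands are compared. *)
have le : (eta%:E * energy s f + (form s gamma2 f f)%:E <=
    (form s gamma1 f f)%:E + (G + eta)%:E * \int[mm]_z (riesz s (z.1 - z.2) * far r f z)%:E)%E.
  rewrite (formE m1 g10 g1G fe) (formE m2 g20 g2G fe).
  have t1 z : 0 <= eta * e2 z by apply: mulr_ge0; [exact: ltW|exact: e20].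
  have t2 z : 0 <= sqw gamma2 z * e2 z by exact: mulr_ge0.
  have t3 z : 0 <= sqw gamma1 z * e2 z by exact: mulr_ge0.
  have t4 z : 0 <= (G + eta) * (riesz s (z.1 - z.2) * far r f z) by exact: mulr_ge0.
  rewrite -intZl; [|exact: me|exact: e20|exact: ltW].
  rewrite -intD; [|by meas|by meas|exact: t1|exact: t2].
  rewrite -intZl; [|by meas|exact: rF|exact: Ge0].
  rewrite -intD; [|by meas|by meas|exact: t3|exact: t4].
  apply: ae_ge0_le_integral.
  - exact: measurableT.
  - by move=> z _; rewrite lee_fin; exact: (addr_ge0 (t1 z) (t2 z)).
  - by apply/measurable_EFinP; meas.
  - by move=> z _; rewrite lee_fin; exact: (addr_ge0 (t3 z) (t4 z)).
  - by apply/measurable_EFinP; meas.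
  apply: filterS (ae_prod gap) => z [h1 h2] _; rewrite lee_fin.
  have k0 := riesz_ge0 s (z.1 - z.2).
  have [[z1 z2]|hF] := near_or_far z r0 f0.
    have [a1 b1] := h1 z1; have [a2 b2] := h2 z2.
    have lo : a + eta <= sqw gamma1 z.
      have ae0 : 0 <= a + eta by rewrite addr_ge0// ltW.
      by rewrite sqw.unlock -[leLHS](sqr_sqrtr ae0) expr2 ler_pM ?sqrtr_ge0//; exact: ler_wsqrtr.
    have hi : sqw gamma2 z <= a.
      by rewrite sqw.unlock -[leRHS](sqr_sqrtr a0) expr2 ler_pM ?sqrtr_ge0//; exact: ler_wsqrtr.
    have h : (eta + sqw gamma2 z) * e2 z <= sqw gamma1 z * e2 z.
      by apply: ler_wpM2r => //; lra.
    by rewrite -mulrDl (le_trans h)// lerDl.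
  have h : e2 z <= riesz s (z.1 - z.2) * far r f z by exact: ler_wpM2l.
  have h' : eta * e2 z + sqw gamma2 z * e2 z <= (G + eta) * e2 z.
    by rewrite -mulrDl; apply: ler_wpM2r => //; have := p2G z; lra.
  by rewrite (le_trans h')// (le_trans (ler_wpM2l Ge0 h))// lerDr.
rewrite -(leeD2rE _ _ (_ : (form s gamma2 f f)%:E \is a fin_num))//.
apply: (le_trans le); apply: (le_trans (leeD2l _ (lee_wpmul2l (_ : (0 <= (G + eta)%:E)%E) XB))).
  by rewrite lee_fin.
by rewrite -EFinM -!EFinD lee_fin; lra.
Qed.

(* Existence of the weak solution is not needed: the default value of [solution]
   is [f], which gives [w = 0]. *)
Lemma DN_map_formE gamma G (Omega W : set 'rV[R]_n) f :
  measurable_fun setT gamma -> (forall x, 0 <= gamma x) -> (forall x, gamma x <= G) ->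
  open W -> W `<=` exterior Omega -> finite_energy s f ->
  exists w, [/\ finite_energy s w, \forall x \ae mu, W x -> w x = 0,
    form s gamma f w = - form s gamma w w &
    DN_map s Omega gamma f f = frac_const n s / 2 * (form s gamma f f - form s gamma w w)].
Proof.
move=> mg g0 gG oW WO fe; rewrite /DN_map /solution; case: xgetP => [u _ [su tu Bu]|_].
  have tw := tu; set w := (u \- f)%R in tu tw.
  have [sw _] := tw.
  have we : finite_energy s w by split; [exact: (sobolev_L2 sw).1|exact: sobolev_energy].
  have uE : u = (fun x => f x + w x) by apply/funext => x; rewrite /w /= addrC subrK.
  have fw : form s gamma f w = - form s gamma w w.
    have c0 : (frac_const n s / 2 == 0) = false by apply: gt_eqF; rewrite divr_gt0// frac_const_gt0.
    have /eqP := Bu _ tw; rewrite bilinear_formE mulf_eq0 c0 /=.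
    by rewrite uE (formDl mg g0 gG)// addr_eq0 => /eqP.
  exists w; split => //; first exact: sobolev_tilde_ae0 oW WO tw.
  by rewrite bilinear_formE uE (formDl mg g0 gG)// (formC s gamma w f) fw.
have z0 u : form s gamma u (fun=> 0) = 0.
  by rewrite /form; under eq_Rintegral do rewrite subrr mulr0; rewrite /Rintegral integral0.
exists (fun=> 0); split.
- split => //; rewrite /energy integral0_eq// => z _.
  by rewrite subrr expr0n mulr0.
- exact: aeW.
- by rewrite !z0 oppr0.
- by rewrite bilinear_formE z0 subr0.
Qed.

Lemma DN_map_gap gamma1 gamma2 (G a eta r : R) (Omega W : set 'rV[R]_n) (x0 : 'rV[R]_n) :
  (1 <= n)%N ->
  measurable_fun setT gamma1 -> (forall x, 0 <= gamma1 x) -> (forall x, gamma1 x <= G) ->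
  measurable_fun setT gamma2 -> (forall x, 0 <= gamma2 x) -> (forall x, gamma2 x <= G) ->
  open W -> W `<=` exterior Omega -> 0 <= a -> 0 < eta -> 0 < r ->
  (forall x, `|x - x0| < 2 * r -> W x) ->
  (\forall x \ae mu, `|x - x0| < 2 * r -> gamma2 x <= a /\ a + eta <= gamma1 x) ->
  (forall f, Cc_infty W f -> DN_map s Omega gamma1 f f = DN_map s Omega gamma2 f f) -> False.
Proof.
move=> n1 m1 g10 g1G m2 g20 g2G oW WO a0 e0 r0 rW gap DN.
have [C C0 HC] := @far_bound R n s s0 s1 r r0.
have G0 : 0 <= G by exact: le_trans (g10 0) (g1G 0).
have BL := tent_L2 (tent_bump R n); have mb := @measurable_bump R n.
pose S := sqnorm (@bump R n); have S0 : 0 <= S by exact: sqnorm_ge0.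
have Ey : (energy s (@bump R n) < +oo)%E.
  by have [K K0 HK] := tent_energy (tent_bump R n); exact: energy_lty K0 HK.
have Egt := @energy_bump_gt0 R n s n1.
pose E := fine (energy s (@bump R n)).
have EE : energy s (@bump R n) = E%:E by rewrite fineK// ge0_fin_numE// ltW.
have E0 : 0 < E by rewrite -lte_fin -EE.
(* The first summand comes from [energy_gap], the second from the bound on the correction [w1] by
   [far_interaction_le]. *)
pose D := (G + eta) * C + G * C.
have D0 : 0 <= D by rewrite addr_ge0// mulr_ge0// addr_ge0// ltW.
have bound (N : R) : r^-1 <= N -> eta * (N `^ (2 * s) * E) <= D * S.
  move=> rN; have N0 : 0 < N by apply: lt_le_trans rN; rewrite invr_gt0.
  pose f x := bump (N *: (x - x0)).
  have [fL fS] := sqnorm_affine x0 N0 BL; rewrite -/f in fL fS.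
  have fE := energy_affine s x0 N0 mb; rewrite -/f EE in fE.
  have fe : finite_energy s f by split; [exact: fL.1|rewrite fE -!EFinM ltry].
  have Nr : N^-1 <= r by rewrite -[leRHS]invrK lef_pV2 ?posrE ?invr_gt0.
  have f0 x : r <= `|x - x0| -> f x = 0.
    move=> rx; apply/eqP; rewrite eq_le bump_ge0 andbT leNgt bump_gt0 -leNgt normrZ gtr0_norm//.
    by rewrite -ler_pdivrMl// mulr1 (le_trans Nr).
  have fC : Cc_infty W f.
    apply: bump_Cc_infty => // x /= xN; apply: rW; apply: (le_lt_trans (le_trans xN Nr)).
    by rewrite mulr2n mulrDl mul1r ltrDl.
  have XB := HC f fL.
  have [w1 [we1 w10 fw1 D1]] := DN_map_formE m1 g10 g1G oW WO fe.
  have [w2 [we2 w20 fw2 D2]] := DN_map_formE m2 g20 g2G oW WO fe.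
  (* For equal DN maps the difference of the forms at [f] is the energy of [w1] minus that of [w2]:
     an upper bound for the first and the sign of the second suffice. *)
  have L1 := far_interaction_le m1 g10 g1G r0 rW f0 fe we1 w10 fw1 XB.
  have L2 := form_ge0 m2 g20 g2G we2.
  have gap' := energy_gap m1 g10 g1G m2 g20 g2G a0 e0 r0 gap f0 fe XB.
  have := DN f fC; rewrite D1 D2 => /(mulfI _) eqD.
  have {}eqD : form s gamma1 f f - form s gamma1 w1 w1 = form s gamma2 f f - form s gamma2 w2 w2.
    by apply: eqD; rewrite gt_eqF// divr_gt0// frac_const_gt0.
  have NN : N ^- n * (N `^ (2 * s) * E) = N `^ (n%:R + 2 * s) * (N ^- n * (N ^- n * E)).
    have Nn : N ^+ n != 0 by rewrite expf_neq0// gt_eqF.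
    by rewrite powRD ?(gt_eqF N0) ?implybT// powR_mulrn ?(ltW N0)//; field.
  move: gap'; rewrite fE -!EFinM lee_fin -NN fS => gap'.
  have Nn0 : 0 < N ^- n by rewrite invr_gt0 exprn_gt0.
  rewrite -(ler_pM2l Nn0); rewrite -/S in L1 gap'.
  have -> : N ^- n * (eta * (N `^ (2 * s) * E)) = eta * (N ^- n * (N `^ (2 * s) * E)) by ring.
  rewrite fS -/S in L1; rewrite /D; move: eqD L1 L2 gap'.
  move: (form s gamma1 f f) (form s gamma1 w1 w1) (form s gamma2 f f) (form s gamma2 w2 w2) => A1 A2 A3 A4.
  by move: (eta * (N ^- n * (N `^ (2 * s) * E))) (N ^- n) => X p; clear; lra.
(* At [N = t^(1/(2*s))] the left side of [bound] is [eta * (t * E)], which exceeds [D * S] by the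
   first two summands of [t]; the last summand ensures [r^-1 <= N]. *)
pose t := D * S / (eta * E) + 1 + (r^-1 + 1) `^ (2 * s).
have DS0 : 0 <= D * S / (eta * E) by rewrite divr_ge0 ?mulr_ge0// ?(ltW e0) ?(ltW E0).
have p0 : 0 <= (r^-1 + 1) `^ (2 * s) by exact: powR_ge0.
have t0 : 0 <= t by rewrite /t; lra.
have s20 : 2 * s != 0 by rewrite gt_eqF// mulr_gt0.
have rt : r^-1 <= t `^ (2 * s)^-1.
  have rp : 0 <= r^-1 + 1 by rewrite addr_ge0// invr_ge0 ltW.
  apply: (@le_trans _ _ ((r^-1 + 1) `^ (2 * s) `^ (2 * s)^-1)).
    by rewrite -powRrM divff// powRr1// lerDl.
  by apply: ge0_ler_powR; rewrite ?nnegrE// ?invr_ge0 ?mulr_ge0 ?(ltW s0)// /t; lra.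
have := bound _ rt; rewrite -powRrM mulVf// powRr1// leNgt => /negP; apply.
have eE0 : 0 < eta * E by exact: mulr_gt0.
rewrite mulrCA -ltr_pdivrMr//; rewrite /t; lra.
Qed.

(** The bounds on the conductivities hold almost everywhere while the lemmas on the form ask for
    them at every point; clipping changes the conductivities on a null set only. *)
Definition clip (gamma0 G : R) gamma x := Num.min (Num.max (gamma x) gamma0) G.

Lemma measurable_clip (gamma0 G : R) gamma : measurable_fun setT gamma -> measurable_fun setT (clip gamma0 G gamma).
Proof. by move=> mg; rewrite /clip; meas. Qed.

Lemma clip_id (gamma0 G : R) gamma x : gamma0 <= gamma x -> gamma x <= G -> clip gamma0 G gamma x = gamma x.
Proof. by move=> h1 h2; rewrite /clip (max_idPl h1) (min_idPl h2). Qed.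

Lemma clip_le (gamma0 G : R) gamma x : clip gamma0 G gamma x <= G.
Proof. by rewrite /clip ge_min lexx orbT. Qed.

Lemma clip_ge0 (gamma0 G : R) gamma x : 0 <= gamma0 -> 0 <= G -> 0 <= clip gamma0 G gamma x.
Proof. by move=> h1 h2; rewrite /clip le_min h2 le_max h1 orbT. Qed.

(** Both conductivities have the same set of weak solutions, so [xget] selects the same function for
    both. *)
Lemma DN_map_ae gamma gamma' (Omega W : set 'rV[R]_n) f :
  measurable_fun setT gamma -> measurable_fun setT gamma' ->
  (\forall x \ae mu, gamma x = gamma' x) -> Cc_infty W f ->
  DN_map s Omega gamma f f = DN_map s Omega gamma' f f.
Proof.
move=> mg mg' gg fC; have mf := (Cc_infty_L2 fC).1.
have ws : weak_solution s Omega gamma f = weak_solution s Omega gamma' f.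
  apply/seteqP; split => u [su tu Bu]; split => // phi tphi.
    rewrite -(Bu phi tphi); apply/esym; apply: bilinear_form_ae => //.
      exact: (sobolev_L2 su).1.
    by case: tphi => sphi _; exact: (sobolev_L2 sphi).1.
  rewrite -(Bu phi tphi); apply: bilinear_form_ae => //.
    exact: (sobolev_L2 su).1.
  by case: tphi => sphi _; exact: (sobolev_L2 sphi).1.
rewrite /DN_map /solution ws; apply: bilinear_form_ae => //.
by case: xgetP => [u _ [su _ _]|_]; [exact: (sobolev_L2 su).1|].
Qed.

(** A strict reverse inequality at a common point of continuity would persist on a ball, which
    [DN_map_gap] excludes. One inequality is enough, as the two conductivities can be exchanged. *)
Lemma DN_map_le (gamma0 : R) gamma1 gamma2 gamma1' gamma2' (G : R) (Omega W : set 'rV[R]_n) (x0 : 'rV[R]_n) :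
  (1 <= n)%N -> 0 < gamma0 -> measurable_fun setT gamma1 -> measurable_fun setT gamma2 ->
  (\forall x \ae mu, gamma0 <= gamma1 x <= G) -> (\forall x \ae mu, gamma0 <= gamma2 x <= G) ->
  open W -> W `<=` exterior Omega -> W x0 ->
  (\forall x \ae mu, gamma1' x = gamma1 x) -> (\forall x \ae mu, gamma2' x = gamma2 x) ->
  {for x0, continuous gamma1'} -> {for x0, continuous gamma2'} -> 0 <= G -> 0 <= gamma2' x0 ->
  (forall f, Cc_infty W f -> DN_map s Omega gamma1 f f = DN_map s Omega gamma2 f f) ->
  gamma1' x0 <= gamma2' x0.
Proof.
move=> n1 p0 m1 m2 b1 b2 oW WO Wx0 e1 e2 c1 c2 G0 g20 DN; rewrite leNgt; apply/negP => lt21.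
(* Within [d] of their values at [x0] the representatives still differ by [2 * d]: this becomes
   [eta], with threshold [a = gamma2' x0 + d]. *)
pose d := (gamma1' x0 - gamma2' x0) / 4.
have d0 : 0 < d by rewrite divr_gt0// subr_gt0.
have near1 := (@cvgrPdist_lt _ _ _ (nbhs x0) _ gamma1' (gamma1' x0)).1 c1 d d0.
have near2 := (@cvgrPdist_lt _ _ _ (nbhs x0) _ gamma2' (gamma2' x0)).1 c2 d d0.
have [r /= r0 Hr] : exists2 r : R, 0 < r & forall x, `|x - x0| < r ->
    [/\ W x, `|gamma1' x - gamma1' x0| < d & `|gamma2' x - gamma2' x0| < d].
  have : \forall x \near x0, [/\ W x, `|gamma1' x - gamma1' x0| < d & `|gamma2' x - gamma2' x0| < d].
    near=> x; split.
    - by near: x; exact: open_nbhs_nbhs.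
    - by rewrite distrC; near: x; exact: near1.
    - by rewrite distrC; near: x; exact: near2.
  move=> /nbhs_ballP[r /= r0 H]; exists r => // x xr; apply: H.
  by rewrite -ball_normE /= distrC.
have mc1 := measurable_clip gamma0 G m1; have mc2 := measurable_clip gamma0 G m2.
have ae1 : \forall x \ae mu, gamma1 x = clip gamma0 G gamma1 x.
  by apply: filterS b1 => x /andP[h1 h2]; rewrite clip_id.
have ae2 : \forall x \ae mu, gamma2 x = clip gamma0 G gamma2 x.
  by apply: filterS b2 => x /andP[h1 h2]; rewrite clip_id.
have r20 : 0 < r / 2 by rewrite divr_gt0.
have rr : 2 * (r / 2) = r by field.
apply: (@DN_map_gap (clip gamma0 G gamma1) (clip gamma0 G gamma2) G (gamma2' x0 + d) (2 * d) (r / 2) Omega W x0 n1 mc1 _ _ mc2 _ _ oW WO _ _ r20).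
- by move=> x; exact: clip_ge0 (ltW p0) G0.
- by move=> x; exact: clip_le.
- by move=> x; exact: clip_ge0 (ltW p0) G0.
- by move=> x; exact: clip_le.
- by rewrite addr_ge0// ltW.
- by rewrite mulr_gt0.
- by move=> x; rewrite rr => /Hr[].
- have ae : \forall x \ae mu, clip gamma0 G gamma1 x = gamma1' x /\ clip gamma0 G gamma2 x = gamma2' x.
    have q1 : \forall x \ae mu, clip gamma0 G gamma1 x = gamma1' x by apply: filterS2 ae1 e1 => x <- <-.
    have q2 : \forall x \ae mu, clip gamma0 G gamma2 x = gamma2' x by apply: filterS2 ae2 e2 => x <- <-.
    by apply: filterS2 q1 q2 => x.
  apply: filterS ae => x [-> ->]; rewrite rr => /Hr[_].
  rewrite !ltr_norml => /andP[h1 h2] /andP[h3 h4].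
  have d4 : 4 * d = gamma1' x0 - gamma2' x0 by rewrite /d; field.
  by split; lra.
- move=> f fC; rewrite -(DN_map_ae Omega m1 mc1 ae1 fC) -(DN_map_ae Omega m2 mc2 ae2 fC).
  exact: DN.
Unshelve. all: by end_near. Qed.

End boundary_determination.

Theorem theorem3p2 (R : realType) (n : nat) (s gamma0 : R)
    (Omega W : set 'rV[R]_n) (gamma1 gamma2 : 'rV[R]_n -> R) :
  (1 <= n)%N ->
  open Omega -> bounded_in_one_direction Omega ->
  0 < s -> s < 1 ->
  gamma1 \in Lfun (@lebesgue_rV R n) +oo%E ->
  gamma2 \in Lfun (@lebesgue_rV R n) +oo%E ->
  0 < gamma0 ->
  (\forall x \ae (@lebesgue_rV R n), gamma0 <= gamma1 x) ->
  (\forall x \ae (@lebesgue_rV R n), gamma0 <= gamma2 x) ->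
  open W -> W !=set0 -> W `<=` exterior Omega ->
  continuous_ae W gamma1 -> continuous_ae W gamma2 ->
  (forall f, Cc_infty W f -> forall g, Cc_infty W g ->
    DN_map s Omega gamma1 f g = DN_map s Omega gamma2 f g) ->
  gamma1 = gamma2 %[ae (@lebesgue_rV R n) in W].
Proof.
move=> n1 _ _ s0 s1 L1 L2 p0 lo1 lo2 oW _ WO [g1 e1 c1] [g2 e2 c2] DN.
have [m1 [M1 M10 B1]] := Lfun_oo_bounded L1; have [m2 [M2 M20 B2]] := Lfun_oo_bounded L2.
pose G := M1 + M2; have G0 : 0 <= G by exact: addr_ge0.
have b1 : \forall x \ae @lebesgue_rV R n, gamma0 <= gamma1 x <= G.
  apply: filterS2 lo1 B1 => x -> /= h; rewrite (le_trans (ler_norm _))// (le_trans h)//.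
  by rewrite lerDl.
have b2 : \forall x \ae @lebesgue_rV R n, gamma0 <= gamma2 x <= G.
  apply: filterS2 lo2 B2 => x -> /= h; rewrite (le_trans (ler_norm _))// (le_trans h)//.
  by rewrite lerDr.
have E1 : \forall x \ae @lebesgue_rV R n, g1 x = gamma1 x by apply: filterS e1 => x; apply.
have E2 : \forall x \ae @lebesgue_rV R n, g2 x = gamma2 x by apply: filterS e2 => x; apply.
have DNf f : Cc_infty W f -> DN_map s Omega gamma1 f f = DN_map s Omega gamma2 f f.
  by move=> fC; exact: DN.
have DNf' f : Cc_infty W f -> DN_map s Omega gamma2 f f = DN_map s Omega gamma1 f f.
  by move=> fC; rewrite DNf.
(* Almost every point of [W] is a point of continuity of both representatives at which they take the
   values of [gamma1] and [gamma2]. *)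
near=> x => Wx.
have x1 : g1 x = gamma1 x by near: x.
have x2 : g2 x = gamma2 x by near: x.
have l1 : gamma0 <= gamma1 x by near: x.
have l2 : gamma0 <= gamma2 x by near: x.
have k1 : {for x, continuous g1} by apply: (near c1 x) => //.
have k2 : {for x, continuous g2} by apply: (near c2 x) => //.
rewrite -x1 -x2; apply/le_anti/andP; split.
  apply: (DN_map_le s0 s1 n1 p0 m1 m2 b1 b2 oW WO Wx E1 E2 k1 k2 G0 _ DNf).
  by rewrite x2 (le_trans _ l2)// ltW.
apply: (DN_map_le s0 s1 n1 p0 m2 m1 b2 b1 oW WO Wx E2 E1 k2 k1 G0 _ DNf').
by rewrite x1 (le_trans _ l1)// ltW.
Unshelve. all: by end_near. Qed.
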